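(* Let $\Omega \subset \mathbb{R}^2$ be a bounded convex domain with smooth boundary, let $f:\mathbb{R}\to\mathbb{R}$ be a smooth positive function, and let $u \in C^\infty(\overline{\Omega})$ satisfy $$-\Delta u = f(u) \ \text{ in } \Omega, \qquad u = 0 \ \text{ on } \partial\Omega.$$ Assume: (1) For each point $p\in\partial\Omega$, the curvature of $\partial\Omega$ at $p$ satisfies $K(p)>0$, and there is an ellipse $E$, enclosing a finite area $A$, containing $\Omega$ and tangent to $\partial\Omega$ at $p$ such that, at $p$, $$K_E\left(\frac{\pi^{2/3}}{A^{2/3}K_E^{4/3}} + 1 + \frac{(\partial_s K_E)^2}{9K_E^4}\right) \ \ge\ K\left(1+\frac{(\partial_s K)^2}{9K^4}\right),$$ where $K$ and $K_E$ are the curvatures of $\partial\Omega$ and $E$ respectively, and $\partial_s$ is the derivative with respect to arclength. (2) $f(0)=1$, and on the interval $[0,\max_{\overline{\Omega}}u]$ we have $f>0$, $f''\le 0$ and $f'\le 0$. Then $u$ is concave on $\overline{\Omega}$.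
   Context: The ellipse $E$ is a (non-degenerate) ellipse curve in the plane and may depend on $p$. That $E$ contains $\Omega$ means that $\Omega$ is contained in the region enclosed by $E$. That $E$ is tangent to $\partial\Omega$ at $p$ means that $p\in E$ and the tangent lines of $E$ and $\partial\Omega$ at $p$ coincide (only first order contact is required). Curvatures of the boundary curves are taken with the sign convention that makes them nonnegative for boundaries of convex regions. $\partial_s K$ and $\partial_s K_E$ denote the derivatives of $K$ along $\partial\Omega$ and of $K_E$ along $E$ with respect to the respective arclength parameters (the orientation is irrelevant, since only squares appear). *)

(* Defs.v *)
From HB Require Import structures.
From mathcomp Require Import all_boot all_order all_algebra.
From mathcomp Require Import all_classical all_reals all_analysis.
Import Order.TTheory GRing.Theory Num.Theory.
Import numFieldNormedType.Exports.

Set Implicit Arguments.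
Unset Strict Implicit.
Unset Printing Implicit Defensive.

Local Open Scope ring_scope.
Local Open Scope classical_set_scope.

(* The library's norm on a product is the max norm: it is only used here for
   the topology, boundedness and directional derivatives of the plane. *)
Notation plane R := (R^o * R^o)%type.

Definition boundary (R : realType) (D : set (plane R)) : set (plane R) :=
  closure D `\` interior D.

(* Coordinates of [q] in the orthonormal frame rotated by the angle [th]. *)
Definition rotated (R : realType) (th : R) (q : plane R) : plane R :=
  (cos th * q.1 + sin th * q.2, - sin th * q.1 + cos th * q.2).

Definition smooth (R : realType) (g : R -> R) : Prop :=
  forall n x, derivable (derive1n n g) x 1.

Definition smooth_boundary (R : realType) (D : set (plane R)) : Prop :=
  forall p, boundary D p ->
    exists (th : R) (g : R -> R), smooth g /\
      \forall q \near p, D q <-> g (rotated th q).1 < (rotated th q).2.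

Definition bounded_convex_domain (R : realType) (D : set (plane R)) : Prop :=
  [/\ open D, D !=set0, bounded_set D & convex_set D].

Definition partial (R : realType) (i : bool) (v : plane R -> R) : plane R -> R :=
  'D_(if i then (0, 1) else (1, 0)) v.

Definition partials (R : realType) (l : seq bool) (v : plane R -> R) :
  plane R -> R := foldr (@partial R) v l.

Definition laplacian (R : realType) (v : plane R -> R) (p : plane R) : R :=
  partials [:: false; false] v p + partials [:: true; true] v p.

Definition smooth_on (R : realType) (D : set (plane R)) (v : plane R -> R) :
    Prop :=
  forall l p, D p ->
    {for p, continuous (partials l v)} /\
    forall i : bool,
      derivable (partials l v) p (if i then (0, 1) else (1, 0)).

(* v is in C^oo of the closure of the open set D: v is continuous on the
   closure, smooth in D, and all its partial derivatives in D extend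
   continuously to the closure. *)
Definition smooth_on_closure (R : realType) (D : set (plane R))
    (v : plane R -> R) : Prop :=
  [/\ smooth_on D v,
      {within closure D, continuous v} &
      forall l, exists w : plane R -> R,
        {within closure D, continuous w} /\
        forall p, D p -> w p = partials l v p].

(* s |-> (x s, y s), for s near 0, is an arclength parametrization of the
   boundary of D near its point p = (x 0, y 0), with D lying to the left. *)
Definition boundary_arc (R : realType) (D : set (plane R)) (p : plane R)
    (x y : R -> R) : Prop :=
  (x 0, y 0) = p /\
  \forall s \near (0 : R),
    [/\ forall n, derivable (derive1n n x) s 1 /\ derivable (derive1n n y) s 1,
        derive1 x s ^+ 2 + derive1 y s ^+ 2 = 1,
        boundary D (x s, y s) &
        \forall t \near 0^'+, D (x s - t * derive1 y s, y s + t * derive1 x s)].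

(* Curvature of the boundary of D, with respect to the inner normal (hence
   nonnegative for convex D). Near a point where the boundary is smooth, two
   arcs as above coincide near 0, so the value does not depend on the arc. *)
Definition curvature (R : realType) (D : set (plane R)) (p : plane R) : R :=
  xget 0 [set k : R | exists x y, boundary_arc D p x y /\
                      k = derive1 x 0 * derive1n 2 y 0 - derive1 y 0 * derive1n 2 x 0].

Definition dcurvature (R : realType) (D : set (plane R)) (p : plane R) : R :=
  xget 0 [set k : R | exists x y, boundary_arc D p x y /\
                      k = derive1 (fun s : R => curvature D (x s, y s)) 0].

Definition tangent_line (R : realType) (D : set (plane R)) (p : plane R) :
    set (plane R) :=
  [set q | exists x y (t : R), boundary_arc D p x y /\
           q = (p.1 + t * derive1 x 0, p.2 + t * derive1 y 0)].

Record ellipse (R : realType) := Ellipse {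
  ellipse_center : plane R;
  tilt : R;
  semiaxis1 : R;
  semiaxis2 : R;
  semiaxis1_gt0 : 0 < semiaxis1;
  semiaxis2_gt0 : 0 < semiaxis2 }.

Definition ellipse_form (R : realType) (E : ellipse R) (q : plane R) : R :=
  let z := rotated (tilt E) (q.1 - (ellipse_center E).1, q.2 - (ellipse_center E).2) in
  (z.1 / semiaxis1 E) ^+ 2 + (z.2 / semiaxis2 E) ^+ 2.

Definition ellipse_curve (R : realType) (E : ellipse R) : set (plane R) :=
  [set q | ellipse_form E q = 1].

Definition ellipse_region (R : realType) (E : ellipse R) : set (plane R) :=
  [set q | ellipse_form E q < 1].

Definition area (R : realType) (D : set (plane R)) : \bar R :=
  ((@lebesgue_measure R) \x (@lebesgue_measure R))%E D.

Definition concave_on (R : realType) (D : set (plane R)) (v : plane R -> R) :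
    Prop :=
  convex_function D (fun q => - v q : R^o).

(* Main.v *)
(* Write [H] for the Hessian of [u]. By the equation and [f' <= 0], [f'' <= 0], for a
   fixed direction [e] the function [u_ee] is subharmonic where it is positive, so the
   maximum [M] of the top eigenvalue of [H], if positive, is reached at a boundary
   point [p], with an eigenvector [e]; at [p] the tangential derivative of [u_ee]
   vanishes and the inner normal one is nonpositive. Differentiating [u = 0] along the
   boundary up to third order gives, with [v] the inner normal derivative and [T], [N]
   the unit tangent and inner normal,
     [H(T,T) = - K v]  and  [D^3 u(T,T,T) + 3 K H(T,N) + K' v = 0].
   The information on [u_ee] makes [D^3 u(T,T,T)] and [H(T,N)] of the same sign, hence
   [3 K |H(T,N)| <= |K' v|]. On the other hand the torsion function of the ellipse [E]
   dominates [u] and vanishes at [p], and the left-hand side of the curvature condition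
   is exactly the inverse of its normal derivative, so that
   [K v (1 + K'^2 / 9 K^4) <= 1]. Together,
     [det H = K v (1 - K v) - H(T,N)^2 >= 0],
   whereas [tr H = -1] and [M > 0] give [det H = - M (1 + M) < 0]. *)
Require Import Defs.
From HB Require Import structures.
From mathcomp Require Import all_boot all_order all_algebra.
From mathcomp Require Import all_classical all_reals all_analysis.
From mathcomp Require Import ring lra.
Import Order.TTheory GRing.Theory Num.Theory.
Import numFieldNormedType.Exports.

Set Implicit Arguments.
Unset Strict Implicit.
Unset Printing Implicit Defensive.

Local Open Scope ring_scope.
Local Open Scope classical_set_scope.

(** * First-order expansions in the plane *)

Section basics.
Variable R : realType.
Implicit Types (q : plane R) (C : set (plane R)) (F : plane R -> R).

(** The top eigenvalue is continuous but may fail to be differentiable, so it is maximised over the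
    compact boundary and the eigenvector found at the maximum point [p] is then frozen: if [M > 0],
    the function [u_ee] is smooth, at most [M] on the closure and equal to [M] at [p]. Only weak
    inequalities result, so no Hopf lemma enters; strictness comes from [M (1 + M) > 0]. Third
    derivatives of [u] are needed at [p], with the domain on one side only. Hence all calculus is
    phrased with first-order expansions relative to the closure; convexity, through segments,
    carries them from the interior to the boundary. The area term of the curvature condition is
    geometric: let [r] be half the gradient norm of the quadratic form of [E] at [p]. Then
    [K_E r^3 = (a b)^-2] and [A = pi a b], so [K_E] times that term is exactly [r]. The left-hand
    side thus becomes the inverse of [(a b)^2 r / (a^2 + b^2)]. Curvatures are chosen values; a
    local defining function shows that every arc computes the same one. *)

Lemma near_planeP (P : set (plane R)) q0 :
  (\forall q \near q0, P q) <->
  exists2 d : R, 0 < d &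
    forall q, `|q.1 - q0.1| < d -> `|q.2 - q0.2| < d -> P q.
Proof.
split=> [/nbhs_ballP[d /= d0 dP]|[d d0 dP]].
  exists d => // q q1 q2; apply: dP; split=> /=.
    by rewrite -ball_normE /= distrC.
  by rewrite -ball_normE /= distrC.
apply/nbhs_ballP; exists d => //= q [/=]; rewrite -!ball_normE /= => q1 q2.
by apply: dP; rewrite distrC.
Qed.

Lemma near_realP (P : set R) s0 :
  (\forall s \near s0, P s) <->
  exists2 d : R, 0 < d & forall s, `|s - s0| < d -> P s.
Proof.
split=> [/nbhs_ballP[d /= d0 dP]|[d d0 dP]].
  by exists d => // s sd; apply: dP; rewrite -ball_normE /= distrC.
apply/nbhs_ballP; exists d => //= q; rewrite -!ball_normE /= => q1.
by apply: dP; rewrite distrC.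
Qed.

Lemma near_rightP (P : set R) (s0 : R) :
  (\forall s \near s0^'+, P s) <->
  exists2 d : R, 0 < d & forall t, 0 < t -> t < d -> P (s0 + t).
Proof.
split=> [/nbhs_ballP[d /= d0 dP]|[d d0 dP]].
  exists d => // t t0 td; apply: dP; last by rewrite ltrDl.
  by rewrite -ball_normE /= opprD addNKr normrN gtr0_norm.
apply/nbhs_ballP; exists d => //= q; rewrite -!ball_normE /= => q1 q2.
have := dP (q - s0); rewrite subr_gt0 subrKC; apply => //.
by move: q1; rewrite ltr_distlC; lra.
Qed.

Lemma within_planeP C F :
  {within C, continuous F} <->
  forall q0, C q0 -> forall e : R, 0 < e -> exists2 d : R, 0 < d &
    forall q, C q -> `|q.1 - q0.1| < d -> `|q.2 - q0.2| < d ->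
    `|F q - F q0| < e.
Proof.
split=> [/subspace_continuousP cF q0 Cq0 e e0|cF].
  have /cvgrPdist_lt/(_ e e0) := cF q0 Cq0.
  rewrite /within /= => /near_planeP[d d0 dP]; exists d => // q Cq q1 q2.
  by rewrite distrC; exact: dP.
apply/subspace_continuousP => q0 Cq0; apply/cvgrPdist_lt => e e0.
have [d d0 dP] := cF q0 Cq0 e e0; rewrite /within /=.
by apply/near_planeP; exists d => // q q1 q2 Cq; rewrite distrC; exact: dP.
Qed.

(** Clearing the denominator makes [h = 0] harmless, so such bounds compose without excluding it. *)
Lemma is_derive_epsP (V : normedModType R) (a v : V) (f : V -> R) (l : R) :
  is_derive a v f l <->
  forall e : R, 0 < e -> exists2 d : R, 0 < d &
    forall h : R, `|h| < d -> `|f (h *: v + a) - f a - l * h| <= e * `|h|.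
Proof.
have key : is_derive a v f l <->
    (fun h : R => h^-1 *: ((f \o shift a) (h *: v) - f a)) @ 0^' --> l.
  split=> [[df <-]|fl]; first exact: df.
  by split; [apply/cvg_ex; exists l | exact: cvg_lim fl].
rewrite key; split=> [/cvgrPdist_le fl e e0|fl].
  have := fl e e0; rewrite /dnbhs /within /= => /near_realP[d d0 dP].
  exists d => // h hd; have [->|h0] := eqVneq h 0.
    by rewrite scale0r add0r subrr mulr0 subr0 normr0 mulr0.
  have := dP h; rewrite subr0 => /(_ hd h0).
  rewrite -(ler_pM2r (_ : 0 < `|h|)) ?normr_gt0// -normrM mulrBl.
  by rewrite /shift /= [_ *: _]/(_ * _) mulrAC mulVf// mul1r distrC.
apply/cvgrPdist_le => e e0; have [d d0 dP] := fl e e0.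
rewrite /dnbhs /within /=; apply/near_realP; exists d => // h.
rewrite subr0 => hd h0; rewrite -(ler_pM2r (_ : 0 < `|h|)) ?normr_gt0// -normrM.
rewrite mulrBl /shift /= [_ *: _]/(_ * _) mulrAC mulVf// mul1r distrC.
exact: dP.
Qed.

Lemma is_derive1_epsP (a : R) (f : R -> R) (l : R) :
  is_derive a 1 f l <->
  forall e : R, 0 < e -> exists2 d : R, 0 < d &
    forall s : R, `|s - a| < d -> `|f s - f a - l * (s - a)| <= e * `|s - a|.
Proof.
rewrite is_derive_epsP; split=> H e e0; have [d d0 dP] := H e e0; exists d => //.
  move=> s sd; have := dP (s - a) sd.
  by rewrite [_ *: _](_ : _ = s - a) ?subrK// [LHS]mulr1.
move=> h hd; rewrite [h *: _](_ : _ = h); last by rewrite [LHS]mulr1.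
by have := dP (h + a); rewrite addrK; exact.
Qed.

(* First-order expansion of [F] at [q0] along [C]; [C] need not be open, and it is
   used with closed sets at their boundary points, where ['D_v F] makes no sense. *)
Definition has_grad C F (a b : R) q0 :=
  forall e : R, 0 < e -> exists2 d : R, 0 < d &
    forall q, C q -> `|q.1 - q0.1| < d -> `|q.2 - q0.2| < d ->
    `|F q - F q0 - (a * (q.1 - q0.1) + b * (q.2 - q0.2))| <=
      e * (`|q.1 - q0.1| + `|q.2 - q0.2|).

Lemma has_grad_sub C C' F a b q0 : C' `<=` C ->
  has_grad C F a b q0 -> has_grad C' F a b q0.
Proof.
move=> CC H e e0; have [d d0 dP] := H e e0; exists d => // q Cq.
exact/dP/CC.
Qed.

Lemma has_grad_open C F a b q0 : open C -> C q0 ->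
  has_grad C F a b q0 -> has_grad setT F a b q0.
Proof.
move=> oC Cq0 H e e0; have [d d0 dP] := H e e0.
have /near_planeP[d' d'0 d'P] : \forall q \near q0, C q by exact: open_nbhs_nbhs.
exists (Num.min d d'); first by rewrite lt_min d0.
move=> q _; rewrite !lt_min => /andP[q1 q1'] /andP[q2 q2'].
by apply: dP => //; exact: d'P.
Qed.

Lemma has_gradD C F G a b a' b' q0 :
  has_grad C F a b q0 -> has_grad C G a' b' q0 ->
  has_grad C (fun q => F q + G q) (a + a') (b + b') q0.
Proof.
move=> HF HG e e0.
have e20 : 0 < e / 2 by rewrite divr_gt0.
have [d d0 dP] := HF _ e20; have [d' d'0 d'P] := HG _ e20.
exists (Num.min d d'); first by rewrite lt_min d0.
move=> q Cq; rewrite !lt_min => /andP[q1 q1'] /andP[q2 q2'].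
have := lerD (dP q Cq q1 q2) (d'P q Cq q1' q2').
rewrite -mulrDl -splitr; apply: le_trans; apply: le_trans (ler_normD _ _).
by rewrite le_eqVlt; apply/orP; left; apply/eqP; congr (`|_|); ring.
Qed.

Lemma has_gradZ C F k a b q0 :
  has_grad C F a b q0 -> has_grad C (fun q => k * F q) (k * a) (k * b) q0.
Proof.
move=> HF e e0.
have k0 : 0 < `|k| + 1 by rewrite ltr_wpDl.
have [d d0 dP] := HF (e / (`|k| + 1)) (divr_gt0 e0 k0).
exists d => // q Cq q1 q2.
rewrite (_ : _ - _ = k * (F q - F q0 - (a * (q.1 - q0.1) + b * (q.2 - q0.2)))); last ring.
rewrite normrM; apply: (@le_trans _ _ ((`|k| + 1) * `|F q - F q0 - (a * (q.1 - q0.1) + b * (q.2 - q0.2))|)).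
  by rewrite ler_wpM2r// lerDl.
apply: le_trans (ler_wpM2l (ltW k0) (dP q Cq q1 q2)) _.
by rewrite le_eqVlt; apply/orP; left; apply/eqP; field; rewrite gt_eqF.
Qed.

Lemma has_grad_ext C F G a b q0 : {in C, F =1 G} -> C q0 ->
  has_grad C F a b q0 -> has_grad C G a b q0.
Proof.
move=> FG Cq0 H e e0; have [d d0 dP] := H e e0; exists d => // q Cq q1 q2.
by rewrite -!FG ?inE//; exact: dP.
Qed.

Lemma has_grad_cont C F a b q0 : has_grad C F a b q0 ->
  forall e : R, 0 < e -> exists2 d : R, 0 < d &
    forall q, C q -> `|q.1 - q0.1| < d -> `|q.2 - q0.2| < d ->
    `|F q - F q0| < e.
Proof.
move=> H e e0; have [d d0 dP] := H 1 ltr01.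
pose k := 2 * (1 + `|a| + `|b|).
have k0 : 0 < k by rewrite mulr_gt0// ltr_wpDr// ltr_wpDr.
exists (Num.min d (e / k)); first by rewrite lt_min d0 divr_gt0.
move=> q Cq; rewrite !lt_min => /andP[q1 q1'] /andP[q2 q2'].
have := dP q Cq q1 q2; set z := _ - _ - _ => Hz.
rewrite (_ : _ - _ = z + (a * (q.1 - q0.1) + b * (q.2 - q0.2))); last by rewrite /z; ring.
apply: le_lt_trans (ler_normD _ _) _.
apply: le_lt_trans (lerD Hz (ler_normD _ _)) _; rewrite !normrM mul1r.
move: q1' q2'; rewrite !ltr_pdivlMr// /k.
have := normr_ge0 a; have := normr_ge0 b.
have := normr_ge0 (q.1 - q0.1); have := normr_ge0 (q.2 - q0.2).
move: `|a| `|b| `|_ - _| `|_ - _| => A B x y x0 y0 A0 B0; nra.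
Qed.

(** The increment of the product is that of the linear combination [G q0 * F + F q0 * G] plus the
    product of the two increments, one of which is small and the other at most [k] times the
    distance. *)
Lemma has_gradM C F G a b a' b' q0 :
  has_grad C F a b q0 -> has_grad C G a' b' q0 ->
  has_grad C (fun q => F q * G q) (a * G q0 + F q0 * a') (b * G q0 + F q0 * b') q0.
Proof.
move=> HF HG e e0.
have HH := has_gradD (has_gradZ (G q0) HF) (has_gradZ (F q0) HG).
have e20 : 0 < e / 2 by rewrite divr_gt0.
have [d1 d10 d1P] := HH _ e20.
pose k := `|a'| + `|b'| + 1.
have k0 : 0 < k by rewrite ltr_wpDl// addr_ge0.
have [d2 d20 d2P] := has_grad_cont HF (divr_gt0 e20 k0).
have [d3 d30 d3P] := HG _ ltr01.
exists (Num.min d1 (Num.min d2 d3)); first by rewrite !lt_min d10 d20.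
move=> q Cq; rewrite !lt_min => /and3P[p1 p2 p3] /and3P[p1' p2' p3'].
have {d1P} := d1P q Cq p1 p1'; set z := _ - _ - _ => Hz.
have {d3P} := d3P q Cq p3 p3'; set y := _ - _ - _ => Hy.
have {d2P} := d2P q Cq p2 p2'; set x := _ - _ => Hx.
rewrite (_ : _ - _ = z + x * (y + (a' * (q.1 - q0.1) + b' * (q.2 - q0.2)))); last first.
  by rewrite /z /x /y; ring.
apply: le_trans (ler_normD _ _) _.
rewrite [in leRHS](splitr e) [leRHS]mulrDl; apply: lerD => //.
rewrite normrM.
set r := _ + _ in Hy *.
have r0 : 0 <= r by rewrite addr_ge0.
have : `|y + (a' * (q.1 - q0.1) + b' * (q.2 - q0.2))| <= k * r.
  apply: le_trans (ler_normD _ _) _.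
  apply: le_trans (lerD Hy (ler_normD _ _)) _; rewrite !normrM mul1r /k /r.
  have := normr_ge0 a'; have := normr_ge0 b'.
  have := normr_ge0 (q.1 - q0.1); have := normr_ge0 (q.2 - q0.2).
  move: `|a'| `|b'| `|_ - _| `|_ - _| => A B s t s0 t0 A0 B0; nra.
move=> H; apply: le_trans (ler_pM _ _ (ltW Hx) H) _ => //.
by rewrite le_eqVlt; apply/orP; left; apply/eqP; field; rewrite gt_eqF.
Qed.

Lemma has_grad_fst C q0 : has_grad C fst 1 0 q0.
Proof.
move=> e e0; exists 1 => // q _ _ _.
by rewrite mul1r mul0r addr0 subrr normr0 mulr_ge0 ?addr_ge0// ltW.
Qed.

Lemma has_grad_cst C c q0 : has_grad C (fun=> c) 0 0 q0.
Proof.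
move=> e e0; exists 1 => // q _ _ _.
by rewrite !mul0r addr0 !subrr normr0 mulr_ge0 ?addr_ge0// ltW.
Qed.

Lemma has_grad_comp C F a b q0 (g : R -> R) dg :
  is_derive (F q0) 1 g dg -> has_grad C F a b q0 ->
  has_grad C (fun q => g (F q)) (dg * a) (dg * b) q0.
Proof.
move=> /is_derive1_epsP Hg HF e e0.
have e20 : 0 < e / 2 by rewrite divr_gt0.
pose k := `|a| + `|b| + 1.
have k0 : 0 < k by rewrite ltr_wpDl// addr_ge0.
have l0 : 0 < `|dg| + 1 by rewrite ltr_wpDl.
have [d1 d10 d1P] := Hg _ (divr_gt0 e20 k0).
have [d2 d20 d2P] := has_grad_cont HF d10.
(* The bound 1 on the remainder of [F] makes its increment at most [k * r]; the second bound makes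
   [dg] times that remainder at most [e / 2 * r]. *)
have m0 : 0 < Num.min 1 (e / 2 / (`|dg| + 1)) by rewrite lt_min ltr01 divr_gt0.
have [d3 d30 d3P] := HF _ m0.
exists (Num.min d2 d3); first by rewrite !lt_min d30 d20.
move=> q Cq; rewrite !lt_min => /andP[p2 p3] /andP[p2' p3'].
have {d1P d2P} := d1P _ (d2P q Cq p2 p2'); set z := _ - _ - _ => Hz.
have {d3P} := d3P q Cq p3 p3'; set y := _ - _ - (_ + _).
set r := `|q.1 - q0.1| + `|q.2 - q0.2|.
have r0 : 0 <= r by rewrite addr_ge0.
set m := Num.min _ _ => Hy.
have m1 : m <= 1 by rewrite /m ge_min lexx.
have m2 : m * (`|dg| + 1) <= e / 2 by rewrite -ler_pdivlMr// /m ge_min lexx orbT.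
rewrite (_ : _ - _ = z + dg * y); last by rewrite /z /y; ring.
apply: le_trans (ler_normD _ _) _.
rewrite [in leRHS](splitr e) [leRHS]mulrDl; apply: lerD => //.
  apply: le_trans Hz _.
  rewrite -mulrA; apply: ler_wpM2l; first exact: ltW.
  rewrite mulrC ler_pdivrMr//.
  rewrite (_ : F q - F q0 = y + (a * (q.1 - q0.1) + b * (q.2 - q0.2))); last first.
    by rewrite /y; ring.
  apply: le_trans (ler_normD _ _) _.
  apply: le_trans (lerD (le_trans Hy (ler_wpM2r r0 m1)) (ler_normD _ _)) _.
  rewrite !normrM mul1r /k /r.
  have := normr_ge0 a; have := normr_ge0 b.
  have := normr_ge0 (q.1 - q0.1); have := normr_ge0 (q.2 - q0.2).
  move: `|a| `|b| `|_ - _| `|_ - _| => A B s t s0 t0 A0 B0; nra.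
rewrite normrM; apply: le_trans (ler_wpM2r r0 m2).
apply: le_trans (ler_wpM2l (normr_ge0 _) Hy) _.
rewrite mulrA ler_wpM2r// mulrC; apply: ler_wpM2l; last by rewrite lerDl.
by rewrite /m le_min ler01 ltW// divr_gt0.
Qed.

(** Since the curve only has to stay in [C], the chain rule applies to arcs running inside the
    boundary of a closed [C]. *)
Lemma has_grad_curve C F a b (x y : R -> R) (s dx dy : R) :
  has_grad C F a b (x s, y s) ->
  is_derive s 1 x dx -> is_derive s 1 y dy ->
  (\forall t \near s, C (x t, y t)) ->
  is_derive s 1 (fun t => F (x t, y t)) (a * dx + b * dy).
Proof.
move=> HF Hx Hy /near_realP[d d0 dP]; apply/is_derive1_epsP => e e0.
have e20 : 0 < e / 2 by rewrite divr_gt0.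
move/is_derive1_epsP: (Hx) => Ex; move/is_derive1_epsP: (Hy) => Ey.
pose k := 2 + `|dx| + `|dy|; pose l := 1 + `|a| + `|b|.
have k0 : 0 < k by rewrite !ltr_wpDr.
have l0 : 0 < l by rewrite !ltr_wpDr.
have [d1 d10 d1P] := HF _ (divr_gt0 e20 k0).
have m0 : 0 < Num.min 1 (e / 2 / l) by rewrite lt_min ltr01 divr_gt0.
have [d2 d20 d2P] := Ex _ m0; have [d3 d30 d3P] := Ey _ m0.
pose d4 := Num.min (Num.min d (d1 / k)) (Num.min d2 d3).
have d40 : 0 < d4 by rewrite !lt_min d0 d20 d30 divr_gt0.
exists d4 => // t; rewrite !lt_min => /andP[/andP[td td1] /andP[td2 td3]].
have {d2P} := d2P _ td2; set X := _ - _ - _ => HX.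
have {d3P} := d3P _ td3; set Y := _ - _ - _ => HY.
move: HX HY; set m := Num.min _ _ => HX HY.
have m1 : m <= 1 by rewrite /m ge_min lexx.
have m2 : m * l <= e / 2 by rewrite -ler_pdivlMr// /m ge_min lexx orbT.
have h0 := normr_ge0 (t - s).
have Lx : `|x t - x s| <= (1 + `|dx|) * `|t - s|.
  rewrite (_ : _ - _ = X + dx * (t - s)); last by rewrite /X; ring.
  apply: le_trans (ler_normD _ _) _; rewrite mulrDl normrM lerD2r.
  exact: le_trans HX (ler_wpM2r h0 m1).
have Ly : `|y t - y s| <= (1 + `|dy|) * `|t - s|.
  rewrite (_ : _ - _ = Y + dy * (t - s)); last by rewrite /Y; ring.
  apply: le_trans (ler_normD _ _) _; rewrite mulrDl normrM lerD2r.
  exact: le_trans HY (ler_wpM2r h0 m1).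
have := d1P (x t, y t) (dP t td) => /=.
move: td1; rewrite ltr_pdivlMr// => td1.
have H1 : `|x t - x s| < d1.
  apply: le_lt_trans Lx _; apply: le_lt_trans td1; rewrite mulrC ler_wpM2l// /k.
  by have := normr_ge0 dy; lra.
have H2 : `|y t - y s| < d1.
  apply: le_lt_trans Ly _; apply: le_lt_trans td1; rewrite mulrC ler_wpM2l// /k.
  by have := normr_ge0 dx; lra.
move=> /(_ H1 H2); set z := _ - _ - _ => Hz.
rewrite (_ : _ - _ = z + (a * X + b * Y)); last by rewrite /z /X /Y; ring.
apply: le_trans (ler_normD _ _) _.
rewrite [in leRHS](splitr e) [leRHS]mulrDl; apply: lerD.
  apply: le_trans Hz _.
  rewrite -mulrA; apply: ler_wpM2l; first exact: ltW.
  rewrite mulrC ler_pdivrMr//.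
  by rewrite /k; lra.
apply: le_trans (ler_normD _ _) _; rewrite !normrM.
apply: le_trans (ler_wpM2r h0 m2); rewrite /l.
have := normr_ge0 a; have := normr_ge0 b.
move: HX HY m0 h0 => {Hz H1 H2 Lx Ly z}; rewrite -/m.
move: `|a| `|b| `|X| `|Y| `|t - s| => A B x' y' r; nra.
Qed.

Lemma has_grad_dir C F a b q0 (v : plane R) : open C -> C q0 ->
  has_grad C F a b q0 -> is_derive q0 v F (a * v.1 + b * v.2).
Proof.
move=> oC Cq0 /(has_grad_open oC Cq0) H; apply/is_derive_epsP => e e0.
pose k := `|v.1| + `|v.2| + 1.
have k0 : 0 < k by rewrite ltr_wpDl// addr_ge0.
have [d d0 dP] := H _ (divr_gt0 e0 k0).
exists (d / k); first by rewrite divr_gt0.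
move=> h; rewrite ltr_pdivlMr// => hd.
have v10 := normr_ge0 v.1; have v20 := normr_ge0 v.2; have h0 := normr_ge0 h.
have := dP (h *: v + q0) Logic.I; rewrite /= !addrK.
rewrite -![h *: _]/(h * _) !normrM => /(_ _ _)/wrap[].
- by apply: le_lt_trans hd; rewrite ler_wpM2l// /k; lra.
- by apply: le_lt_trans hd; rewrite ler_wpM2l// /k; lra.
rewrite (_ : a * _ + _ = (a * v.1 + b * v.2) * h); last by ring.
move/le_trans; apply; rewrite -mulrDr -mulrA; apply: ler_wpM2l; first exact: ltW.
rewrite mulrC ler_pdivrMr//.
by rewrite ler_wpM2l// /k; lra.
Qed.

Lemma has_grad_nonpos C F a b q0 (v : plane R) :
  has_grad C F a b q0 ->
  (\forall t \near 0^'+, C (q0.1 + t * v.1, q0.2 + t * v.2) /\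
     F (q0.1 + t * v.1, q0.2 + t * v.2) <= F q0) ->
  a * v.1 + b * v.2 <= 0.
Proof.
move=> H /near_rightP[d d0 dP]; rewrite leNgt; apply/negP => pos.
pose k := `|v.1| + `|v.2| + 1.
have v10 := normr_ge0 v.1; have v20 := normr_ge0 v.2.
have k0 : 0 < k by rewrite ltr_wpDl// addr_ge0.
(* Along the ray the error is then less than half of the linear growth, because [k] exceeds
   [|v.1| + |v.2|]. *)
have e0 : 0 < (a * v.1 + b * v.2) / (2 * k) by rewrite divr_gt0// mulr_gt0.
have [d' d'0 d'P] := H _ e0.
pose t := Num.min d (d' / k) / 2.
have t0 : 0 < t by rewrite divr_gt0// lt_min d0 divr_gt0.
have td : t < d.
  apply: (@lt_le_trans _ _ (Num.min d (d' / k))); last by rewrite ge_min lexx.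
  by rewrite ltr_pdivrMr// ltr_pMr ?ltr1n// lt_min d0 divr_gt0.
have td' : t * k < d'.
  rewrite -ltr_pdivlMr//.
  apply: (@lt_le_trans _ _ (Num.min d (d' / k))); last by rewrite ge_min lexx orbT.
  by rewrite ltr_pdivrMr// ltr_pMr ?ltr1n// lt_min d0 divr_gt0.
clearbody t; have [] := dP t t0 td; rewrite add0r => Ct Ft.
have := d'P _ Ct => /=; rewrite !(addrC q0.1) !(addrC q0.2) !addrK !normrM (gtr0_norm t0).
move=> /(_ _ _)/wrap[].
- by apply: le_lt_trans td'; rewrite ler_wpM2l ?ltW// /k; lra.
- by apply: le_lt_trans td'; rewrite ler_wpM2l ?ltW// /k; lra.
rewrite ler_norml => /andP[+ _].
move: Ft; rewrite (addrC q0.1) (addrC q0.2).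
set G := F _ => Ft /=; set L := a * v.1 + b * v.2 in pos e0 *.
rewrite (_ : a * _ + _ = t * L); last by rewrite /L; ring.
suff : L / (2 * k) * (t * `|v.1| + t * `|v.2|) < t * L.
  by move=> H1 H2; move: H1 H2 Ft; lra.
rewrite -mulrDr mulrCA ltr_pM2l// mulrAC ltr_pdivrMr ?mulr_gt0//.
by rewrite ltr_pM2l// /k; lra.
Qed.

End basics.

(** * Differentiability from partial derivatives, and symmetry of second derivatives *)

Section differentiation.
Variable R : realType.
Implicit Types (q : plane R) (C D : set (plane R)) (F : plane R -> R).

(** The segment between [a] and [b] is described by distances to its endpoints, so that it can be
    applied without knowing which of the two is larger. *)
Lemma mvt_bound (f df : R -> R) (a b m e : R) :
  (forall c, `|c - a| <= `|b - a| -> `|c - b| <= `|b - a| ->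
    is_derive c 1 f (df c)) ->
  (forall c, `|c - a| <= `|b - a| -> `|c - b| <= `|b - a| -> `|df c - m| <= e) ->
  `|f b - f a - m * (b - a)| <= e * `|b - a|.
Proof.
move=> fd He.
have [c [c1 c2 ->]] : exists c, [/\ `|c - a| <= `|b - a|, `|c - b| <= `|b - a|
    & f b - f a = df c * (b - a)].
  have [ab|/ltW ba] := leP a b.
    have H x : a <= x <= b -> is_derive x 1 f (df x).
      move=> /andP[ax xb]; apply: fd; rewrite ?(distrC x b) !ger0_norm ?subr_ge0//; lra.
    have [| |c] := @MVT_segment _ f df a b ab.
    - by move=> x; rewrite in_itv /= => /andP[ax xb]; apply: H; rewrite !ltW.
    - by apply: derivable_within_continuous => x; rewrite in_itv /= => /H[].
    rewrite in_itv /= => /andP[ac cb] E; exists c.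
    rewrite (distrC c b) !ger0_norm ?subr_ge0//.
    by split => //; lra.
  have H x : b <= x <= a -> is_derive x 1 f (df x).
    move=> /andP[ax xb]; apply: fd; rewrite ?(distrC x a) ?(distrC b a) !ger0_norm ?subr_ge0//; lra.
  have [| |c] := @MVT_segment _ f df b a ba.
  - by move=> x; rewrite in_itv /= => /andP[ax xb]; apply: H; rewrite !ltW.
  - by apply: derivable_within_continuous => x; rewrite in_itv /= => /H[].
  rewrite in_itv /= => /andP[ac cb] E; exists c.
  rewrite (distrC c a) (distrC b a) !ger0_norm ?subr_ge0//.
  by split => //; lra.
by rewrite -mulrBl normrM ler_wpM2r// He.
Qed.

Lemma derive_section1 F (l s y : R) :
  is_derive ((s, y) : plane R) (1, 0) F l -> is_derive s 1 (fun t : R => F (t, y)) l.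
Proof.
move=> /is_derive_epsP H; apply/is_derive1_epsP => e e0.
have [d d0 dP] := H e e0; exists d => // t td.
have := dP _ td; rewrite (_ : _ *: _ + _ = (t, y))//.
by congr (_, _); rewrite /= -![_ *: _]/(_ * _) ?mulr1 ?subrK ?mulr0 ?add0r.
Qed.

Lemma derive_section2 F (l x s : R) :
  is_derive ((x, s) : plane R) (0, 1) F l -> is_derive s 1 (fun t : R => F (x, t)) l.
Proof.
move=> /is_derive_epsP H; apply/is_derive1_epsP => e e0.
have [d d0 dP] := H e e0; exists d => // t td.
have := dP _ td; rewrite (_ : _ *: _ + _ = (x, t))//.
by congr (_, _); rewrite /= -![_ *: _]/(_ * _) ?mulr1 ?subrK ?mulr0 ?add0r.
Qed.

(** The increment is split at [(q0.1, q.2)]: the vertical step uses the derivative of [F] at [q0],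
    the horizontal one the mean value theorem and the continuity of [F1]. *)
Lemma C1_has_grad D F F1 F2 q0 : open D -> D q0 ->
  (forall p, D p -> is_derive p (1, 0) F (F1 p)) ->
  (forall p, D p -> is_derive p (0, 1) F (F2 p)) ->
  {for q0, continuous F1} ->
  has_grad setT F (F1 q0) (F2 q0) q0.
Proof.
move=> oD Dq0 HF1 HF2 cF1 e e0.
have /near_planeP[d d0 dP] : \forall q \near q0, D q by exact: open_nbhs_nbhs.
have /cvgrPdist_le/(_ e e0)/near_planeP[d1 d10 d1P] := cF1.
have := derive_section2 (l := F2 q0) (x := q0.1) (s := q0.2) (F := F).
rewrite -surjective_pairing => /(_ (HF2 _ Dq0))/is_derive1_epsP/(_ e e0)[d2 d20 d2P].
exists (Num.min d (Num.min d1 d2)); first by rewrite !lt_min d0 d10.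
move=> q _; rewrite !lt_min => /and3P[p p1 p2] /and3P[p' p1' p2'].
have box c : `|c - q0.1| <= `|q.1 - q0.1| -> D (c, q.2).
  by move=> cq; apply: dP => //=; exact: le_lt_trans cq p.
have H1 := @mvt_bound (fun t => F (t, q.2)) (fun t => F1 (t, q.2)) q0.1 q.1 (F1 q0) e.
have {}H1 := H1 (fun c cq _ => derive_section1 (HF1 _ (box c cq))).
have {}H1 := H1 _; move: H1 => /(_ _)/wrap[].
  move=> c cq _ /=; rewrite distrC; apply: (d1P (c, q.2)) => //=.
  exact: le_lt_trans cq p1.
move/(lerD (d2P _ p2')).
rewrite -!surjective_pairing -mulrDr [in leRHS]addrC; apply: le_trans.
apply: le_trans (ler_normD _ _).
by rewrite le_eqVlt; apply/orP; left; apply/eqP; congr (`|_|); ring.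
Qed.

(* The second difference of [F] over a square of side [h] is [h^2] times either mixed
   derivative, up to [o(h^2)], as soon as [F1] and [F2] are differentiable at [q0]. *)
Lemma young D F F1 F2 (F11 F12 F21 F22 : R) q0 : open D -> D q0 ->
  (forall p, D p -> is_derive p (1, 0) F (F1 p)) ->
  (forall p, D p -> is_derive p (0, 1) F (F2 p)) ->
  has_grad setT F1 F11 F12 q0 -> has_grad setT F2 F21 F22 q0 ->
  F12 = F21.
Proof.
move=> oD Dq0 HF1 HF2 G1 G2; apply/eqP; rewrite -subr_eq0 -normr_eq0.
rewrite eq_le normr_ge0 andbT; apply/ler_addgt0Pl => e e0; rewrite addr0.
have e60 : 0 < e / 6 by rewrite divr_gt0.
have /near_planeP[d d0 dP] : \forall q \near q0, D q by exact: open_nbhs_nbhs.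
have [d1 d10 d1P] := G1 _ e60; have [d2 d20 d2P] := G2 _ e60.
pose h := Num.min d (Num.min d1 d2) / 2.
have hm : 0 < Num.min d (Num.min d1 d2) by rewrite !lt_min d0 d10 d20.
have h0 : 0 < h by rewrite divr_gt0.
have : h < Num.min d (Num.min d1 d2) by rewrite ltr_pdivrMr// ltr_pMr ?ltr1n.
rewrite !lt_min => /and3P[hd h1 h2]; clearbody h => {hm}.
case: q0 Dq0 G1 G2 dP d1P d2P => x0 y0 Dq0 G1 G2 dP d1P d2P.
pose S := F (x0 + h, y0 + h) - F (x0 + h, y0) - F (x0, y0 + h) + F (x0, y0).
have hn : `|h| = h by rewrite gtr0_norm.
have S1 : `|S - F12 * h * h| <= e / 2 * h * h.
  have := @mvt_bound (fun t => F (t, y0 + h) - F (t, y0))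
    (fun t => F1 (t, y0 + h) - F1 (t, y0)) x0 (x0 + h) (F12 * h) (e / 2 * h).
  rewrite addrAC subrr add0r hn => /(_ _ _)/wrap[].
  - move=> c ch _; apply: is_deriveB; apply: derive_section1; apply: HF1; apply: dP => /=.
    + exact: le_lt_trans hd.
    + by rewrite addrAC subrr add0r hn.
    + exact: le_lt_trans hd.
    + by rewrite subrr normr0.
  - move=> c c1 _.
    have := d1P (c, y0 + h) Logic.I (le_lt_trans c1 h1).
    rewrite /= (addrAC y0) subrr add0r hn => /(_ h1) A1.
    have := d1P (c, y0) Logic.I (le_lt_trans c1 h1).
    rewrite /= subrr normr0 => /(_ d10) A2.
    have K : e / 6 * (`|c - x0| + h) + e / 6 * (`|c - x0| + 0) <= e / 2 * h by nra.
    move: A1 A2; rewrite !ler_norml => /andP[? ?] /andP[? ?]; apply/andP; split; lra.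
  by rewrite /S; apply: le_trans; rewrite le_eqVlt; apply/orP; left; apply/eqP; congr (`|_|); ring.
have S2 : `|S - F21 * h * h| <= e / 2 * h * h.
  have := @mvt_bound (fun t => F (x0 + h, t) - F (x0, t))
    (fun t => F2 (x0 + h, t) - F2 (x0, t)) y0 (y0 + h) (F21 * h) (e / 2 * h).
  rewrite addrAC subrr add0r hn => /(_ _ _)/wrap[].
  - move=> c ch _; apply: is_deriveB; apply: derive_section2; apply: HF2; apply: dP => /=.
    + by rewrite addrAC subrr add0r hn.
    + exact: le_lt_trans hd.
    + by rewrite subrr normr0.
    + exact: le_lt_trans hd.
  - move=> c c1 _.
    have := d2P (x0 + h, c) Logic.I.
    rewrite /= (addrAC x0) subrr add0r hn => /(_ h2 (le_lt_trans c1 h2)) A1.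
    have := d2P (x0, c) Logic.I.
    rewrite /= subrr normr0 => /(_ d20 (le_lt_trans c1 h2)) A2.
    have K : e / 6 * (`|c - y0| + h) + e / 6 * (`|c - y0| + 0) <= e / 2 * h by nra.
    move: A1 A2; rewrite !ler_norml => /andP[? ?] /andP[? ?]; apply/andP; split; lra.
  by rewrite /S; apply: le_trans; rewrite le_eqVlt; apply/orP; left; apply/eqP; congr (`|_|); ring.
have := lerD S1 S2; rewrite -[X in X + _ <= _]normrN => /(le_trans (ler_normD _ _)).
rewrite (_ : _ + _ = (F12 - F21) * (h * h)); last by ring.
rewrite normrM normrM hn (_ : e / 2 * h * h + _ = e * (h * h)); last by field.
by rewrite ler_pM2r// mulr_gt0.
Qed.

Lemma closure_planeP D q0 : closure D q0 <-> forall d : R, 0 < d ->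
  exists q, [/\ D q, `|q.1 - q0.1| < d & `|q.2 - q0.2| < d].
Proof.
split=> [H d d0|H B /near_planeP[d d0 dB]].
  have /H[q [Dq [q1 q2]]] : nbhs q0 [set q : plane R | `|q.1 - q0.1| < d /\ `|q.2 - q0.2| < d].
    by apply/near_planeP; exists d.
  by exists q.
by have [q [Dq q1 q2]] := H d d0; exists q; split=> //; exact: dB.
Qed.

Lemma closure_le D (B : set (plane R)) F (c : R) : open B ->
  {within closure D, continuous F} -> (forall q, D q -> B q -> F q <= c) ->
  forall q, closure D q -> B q -> F q <= c.
Proof.
move=> oB /within_planeP cF Fc q Cq Bq; apply/ler_addgt0Pl => e e0.
have [d d0 dP] := cF q Cq e e0.
have /near_planeP[d' d'0 d'P] : \forall q \near q, B q by exact: open_nbhs_nbhs.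
have /closure_planeP/(_ (Num.min d d'))[|z []] := Cq; first by rewrite lt_min d0.
rewrite !lt_min => Dz /andP[z1 z1'] /andP[z2 z2'].
have := dP z (@subset_closure _ _ _ Dz) z1 z2; have := Fc _ Dz (d'P _ z1' z2').
by rewrite ltr_norml => ? /andP[? _]; lra.
Qed.

End differentiation.

(** * Derivatives up to the boundary of a convex domain *)

Section convex_closure.
Variable R : realType.
Implicit Types (q : plane R) (C D : set (plane R)) (F : plane R -> R).

Lemma convex_setP D : convex_set (D : set (convex_lmodType (plane R))) <->
  forall q q' (t : R), D q -> D q' -> 0 <= t <= 1 ->
    D (q.1 + t * (q'.1 - q.1), q.2 + t * (q'.2 - q.2)).
Proof.
split=> [cD q q' t Dq Dq' t01|cD q q' l].
  have /= := cD q' q (Itv01 (andP t01).1 (andP t01).2).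
  rewrite !inE => /(_ Dq' Dq); congr D.
  by congr pair; rewrite /= -![_ *: _]/(_ * _) /unstable.onem; ring.
rewrite !inE => Dq Dq'; have := cD q' q l%:num Dq' Dq.
rewrite !ge0 le1 => /(_ isT); congr D.
by congr pair; rewrite /= -![_ *: _]/(_ * _) /unstable.onem; ring.
Qed.

Lemma segment_bound D F (F1 F2 : plane R -> R) (a b e : R) q q' :
  open D -> D q -> D q' ->
  (forall p, D p -> has_grad D F (F1 p) (F2 p) p) ->
  (forall t : R, 0 <= t <= 1 ->
    let p := (q.1 + t * (q'.1 - q.1), q.2 + t * (q'.2 - q.2)) in
    [/\ D p, `|F1 p - a| <= e & `|F2 p - b| <= e]) ->
  `|F q' - F q - (a * (q'.1 - q.1) + b * (q'.2 - q.2))| <=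
    e * (`|q'.1 - q.1| + `|q'.2 - q.2|).
Proof.
move=> oD Dq Dq' HF H.
pose x t : R := q.1 + t * (q'.1 - q.1); pose y t : R := q.2 + t * (q'.2 - q.2).
have t01 (c : R) : `|c - 0| <= `|1 - 0 : R| -> `|c - 1| <= `|1 - 0 : R| -> 0 <= c <= 1.
  rewrite !subr0 normr1 !ler_norml => /andP[? ?] /andP[? ?].
  by apply/andP; split; lra.
have := @mvt_bound _ (fun t => F (x t, y t))
  (fun t => F1 (x t, y t) * (q'.1 - q.1) + F2 (x t, y t) * (q'.2 - q.2)) 0 1
  (a * (q'.1 - q.1) + b * (q'.2 - q.2)) (e * (`|q'.1 - q.1| + `|q'.2 - q.2|)).
rewrite !subr0 normr1 !mulr1 /x /y !mul0r !addr0 !mul1r !subrKC -!surjective_pairing.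
apply.
  move=> c c1 c2; have /H[Dp _ _] : 0 <= c <= 1 by apply: t01; move: c1 c2; rewrite ?subr0 ?normr1.
  apply: has_grad_curve; first exact: HF.
  - by apply: is_derive_eq; rewrite /GRing.scale /= ; ring.
  - by apply: is_derive_eq; rewrite /GRing.scale /= ; ring.
  - have cx (u v : R) : (fun t : R => u + t * v) @ c --> u + c * v.
      by apply: cvgD; [exact: cvg_cst|apply: cvgM; [exact: cvg_id|exact: cvg_cst]].
    have cD : nbhs ((q.1 + c * (q'.1 - q.1), q.2 + c * (q'.2 - q.2)) : plane R) D.
      exact: open_nbhs_nbhs.
    exact: (cvg_pair (cx q.1 (q'.1 - q.1)) (cx q.2 (q'.2 - q.2)) cD).
move=> c c1 c2; have /H[Dp A1 A2] : 0 <= c <= 1 by apply: t01; move: c1 c2; rewrite ?subr0 ?normr1.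
set f1 := F1 _ in A1 *; set f2 := F2 _ in A2 *.
rewrite (_ : _ - _ = (f1 - a) * (q'.1 - q.1) + (f2 - b) * (q'.2 - q.2)); last by ring.
apply: le_trans (ler_normD _ _) _; rewrite !normrM mulrDr.
by apply: lerD; rewrite ler_wpM2r.
Qed.

Lemma closure_has_grad D F (F1 F2 : plane R -> R) :
  open D -> convex_set (D : set (convex_lmodType (plane R))) ->
  {within closure D, continuous F} ->
  {within closure D, continuous F1} -> {within closure D, continuous F2} ->
  (forall p, D p -> has_grad D F (F1 p) (F2 p) p) ->
  forall p, closure D p -> has_grad (closure D) F (F1 p) (F2 p) p.
Proof.
move=> oD /convex_setP cD /within_planeP cF /within_planeP cF1 /within_planeP cF2.
move=> HF q0 Dq0 e e0.
have [d1 d10 d1P] := cF1 _ Dq0 _ e0; have [d2 d20 d2P] := cF2 _ Dq0 _ e0.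
exists (Num.min d1 d2); first by rewrite lt_min d10.
have subC := @subset_closure _ D.
set d := Num.min d1 d2.
have d0 : 0 < d by rewrite lt_min d10.
have box (x y z t : R) : 0 <= t <= 1 -> `|x - z| < d -> `|y - z| < d ->
    `|x + t * (y - x) - z| < d.
  move=> /andP[t0 t1]; rewrite !ltr_norml => /andP[? ?] /andP[? ?].
  by have [th|th] := leP t (1 / 2); apply/andP; split; nra.
have bound z z' : D z -> D z' -> `|z.1 - q0.1| < d -> `|z.2 - q0.2| < d ->
    `|z'.1 - q0.1| < d -> `|z'.2 - q0.2| < d ->
    `|F z' - F z - (F1 q0 * (z'.1 - z.1) + F2 q0 * (z'.2 - z.2))| <=
    e * (`|z'.1 - z.1| + `|z'.2 - z.2|).
  move=> Dz Dz' z1 z2 z1' z2'; apply: (segment_bound oD Dz Dz' HF) => t t01 /=.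
  have Dt := cD z z' t Dz Dz' t01.
  have := box z.1 z'.1 q0.1 t t01 z1 z1'; have := box z.2 z'.2 q0.2 t t01 z2 z2'.
  rewrite !lt_min => /andP[B1 B2] /andP[B3 B4].
  by split=> //; apply: ltW; [apply: d1P|apply: d2P] => //; exact: subC.
move=> q Dq q1 q2; apply/ler_addgt0Pl => r r0.
(* Replacing both endpoints by points of [D] within [n] costs [4 e n] on the right-hand side, [2 n]
   on the values of [F] and [2 n] in each coordinate of the linear part: [K n = r] in all. *)
pose K := 4 * e + 2 + 2 * `|F1 q0| + 2 * `|F2 q0|.
have K0 : 0 < K.
  by rewrite /K; have := normr_ge0 (F1 q0); have := normr_ge0 (F2 q0); move: e0; lra.
have rK : 0 < r / K by rewrite divr_gt0.
set n := r / K in rK.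
have approx p : closure D p -> `|p.1 - q0.1| < d -> `|p.2 - q0.2| < d ->
    exists z, [/\ D z, `|z.1 - q0.1| < d /\ `|z.2 - q0.2| < d,
      `|z.1 - p.1| < n, `|z.2 - p.2| < n & `|F z - F p| < n].
  move=> Dp p1 p2; have [d3 d30 d3P] := cF _ Dp _ rK.
  have /closure_planeP/(_ (Num.min (Num.min d3 n)
    (Num.min (d - `|p.1 - q0.1|) (d - `|p.2 - q0.2|))))[|z []] := Dp.
    by rewrite !lt_min !subr_gt0 d30 rK p1.
  rewrite !lt_min => Dz /andP[/andP[A1 A2] /andP[A3 _]] /andP[/andP[A4 A5] /andP[_ A6]].
  exists z; split=> //; last by apply: d3P => //; exact: subC.
  split.
    rewrite (_ : _ - _ = (z.1 - p.1) + (p.1 - q0.1)); last by ring.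
    by apply: le_lt_trans (ler_normD _ _) _; move: A3; lra.
  rewrite (_ : _ - _ = (z.2 - p.2) + (p.2 - q0.2)); last by ring.
  by apply: le_lt_trans (ler_normD _ _) _; move: A6; lra.
have [z [Dz [z1 z2] z3 z4 z5]] := approx q Dq q1 q2.
have [z' [Dz' [z1' z2'] z3' z4' z5']] : exists z, [/\ D z, `|z.1 - q0.1| < d /\ `|z.2 - q0.2| < d,
      `|z.1 - q0.1| < n, `|z.2 - q0.2| < n & `|F z - F q0| < n].
  by apply: approx => //; rewrite subrr normr0.
have := bound z' z Dz' Dz z1' z2' z1 z2.
have Kn : K * n = r by rewrite /n mulrCA mulfV ?mulr1// gt_eqF.
move: Kn; rewrite /K; clearbody n => Kn.
have T1 : `|z.1 - z'.1| <= `|q.1 - q0.1| + 2 * n.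
  rewrite (_ : z.1 - _ = (q.1 - q0.1) + ((z.1 - q.1) - (z'.1 - q0.1))); last by ring.
  apply: le_trans (ler_normD _ _) _; rewrite lerD2l.
  by apply: le_trans (ler_normB _ _) _; move: z3 z3'; lra.
have T2 : `|z.2 - z'.2| <= `|q.2 - q0.2| + 2 * n.
  rewrite (_ : z.2 - _ = (q.2 - q0.2) + ((z.2 - q.2) - (z'.2 - q0.2))); last by ring.
  apply: le_trans (ler_normD _ _) _; rewrite lerD2l.
  by apply: le_trans (ler_normB _ _) _; move: z4 z4'; lra.
set W := _ - _ - _ => HW.
rewrite (_ : _ - _ - _ = W - (F z - F q) + (F z' - F q0)
   + (F1 q0 * ((z.1 - q.1) - (z'.1 - q0.1)) + F2 q0 * ((z.2 - q.2) - (z'.2 - q0.2)))); last first.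
  by rewrite /W; ring.
apply: le_trans (ler_normD _ _) _.
have A1 : `|F1 q0 * (z.1 - q.1 - (z'.1 - q0.1)) + F2 q0 * (z.2 - q.2 - (z'.2 - q0.2))| <=
   `|F1 q0| * (2 * n) + `|F2 q0| * (2 * n).
  apply: le_trans (ler_normD _ _) _; rewrite !normrM.
  apply: lerD; apply: ler_wpM2l => //; apply: le_trans (ler_normB _ _) _.
    by move: z3 z3'; lra.
  by move: z4 z4'; lra.
have A2 : `|W - (F z - F q) + (F z' - F q0)| <= `|W| + 2 * n.
  apply: le_trans (ler_normD _ _) _; have := ler_normB W (F z - F q).
  by move: z5 z5'; lra.
have A3 : e * (`|z.1 - z'.1| + `|z.2 - z'.2|) <=
    e * (`|q.1 - q0.1| + 2 * n + (`|q.2 - q0.2| + 2 * n)).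
  by apply: ler_wpM2l; [exact: ltW|exact: lerD].
move: A1 A2 A3 HW Kn; lra.
Qed.

End convex_closure.

(** * The weak maximum principle *)

Section maximum_principle.
Variable R : realType.
Implicit Types (q : plane R) (C D : set (plane R)) (F G : plane R -> R).

Lemma within_cst C (c : R) : {within C, continuous (fun _ : plane R => c)}.
Proof. by apply: continuous_subspaceT => x; exact: cvg_cst. Qed.

Lemma within_fst C : {within C, continuous (fst : plane R -> R)}.
Proof. by apply: continuous_subspaceT => x; exact: cvg_fst. Qed.

Lemma within_snd C : {within C, continuous (snd : plane R -> R)}.
Proof. by apply: continuous_subspaceT => x; exact: cvg_snd. Qed.

Lemma within_add C F G : {within C, continuous F} -> {within C, continuous G} ->
  {within C, continuous (fun q => F q + G q)}.
Proof.
move=> /subspace_continuousP cF /subspace_continuousP cG.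
by apply/subspace_continuousP => q Cq; apply: cvgD; [exact: cF|exact: cG].
Qed.

Lemma within_mul C F G : {within C, continuous F} -> {within C, continuous G} ->
  {within C, continuous (fun q => F q * G q)}.
Proof.
move=> /subspace_continuousP cF /subspace_continuousP cG.
by apply/subspace_continuousP => q Cq; apply: cvgM; [exact: cF|exact: cG].
Qed.

Lemma within_opp C F : {within C, continuous F} ->
  {within C, continuous (fun q => - F q)}.
Proof.
move=> /subspace_continuousP cF.
by apply/subspace_continuousP => q Cq; apply: cvgN; exact: cF.
Qed.

Lemma bounded_plane D : bounded_set D -> exists2 K : R, 0 < K &
  forall q, closure D q -> `|q.1| <= K /\ `|q.2| <= K.
Proof.
move=> [M [_ HM]].
have K0 : 0 < `|M| + 1 by rewrite ltr_wpDl.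
have MK : M < `|M| + 1 by apply: le_lt_trans (ler_norm _) _; rewrite ltrDl.
exists (`|M| + 2) => [|q /closure_planeP/(_ 1 ltr01)[z [/(HM _ MK) + z1 z2]]].
  by rewrite ltr_wpDl.
move=> /= zM; have : Num.max `|z.1| `|z.2| <= `|M| + 1 := zM.
rewrite ge_max => /andP[H1 H2]; split.
  rewrite (_ : q.1 = z.1 - (z.1 - q.1)); last by ring.
  by apply: le_trans (ler_normB _ _) _; lra.
rewrite (_ : q.2 = z.2 - (z.2 - q.2)); last by ring.
by apply: le_trans (ler_normB _ _) _; lra.
Qed.

Lemma compact_closure_plane D : bounded_set D -> compact (closure D).
Proof.
move=> /bounded_plane[K K0 HK].
apply: (@subclosed_compact _ _ (`[- K, K]%classic `*` `[- K, K]%classic)).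
- exact: closed_closure.
- by apply: compact_setX; exact: segment_compact.
- by move=> q /HK[H1 H2]; split; rewrite /= in_itv /= -ler_norml.
Qed.

Lemma derive_at_max (f : R -> R) (a l : R) : is_derive a 1 f l ->
  (\forall t \near a, f t <= f a) -> l = 0.
Proof.
move=> /is_derive1_epsP H /near_realP[d d0 dP].
apply/eqP; rewrite -normr_eq0 eq_le normr_ge0 andbT; apply/ler_addgt0Pl => e e0.
rewrite addr0; have [d1 d10 d1P] := H e e0.
pose h := Num.min d d1 / 2.
have hm : 0 < Num.min d d1 by rewrite lt_min d0.
have h0 : 0 < h by rewrite divr_gt0.
have : h < Num.min d d1 by rewrite ltr_pdivrMr// ltr_pMr ?ltr1n.
rewrite lt_min => /andP[hd hd1]; clearbody h.
have P1 := d1P (a + h); have P2 := d1P (a - h).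
have Q1 := dP (a + h); have Q2 := dP (a - h).
move: P1 P2 Q1 Q2; rewrite (addrAC a h) (addrAC a (- h)) !subrr !add0r normrN gtr0_norm//.
move=> /(_ hd1) + /(_ hd1) + /(_ hd) + /(_ hd).
rewrite !ler_norml => /andP[A1 A2] /andP[B1 B2] C1 C2.
by apply/andP; split; rewrite -(ler_pM2r h0); lra.
Qed.

(** If [l > 0], then [df] is positive just to the right of [a], and the mean value theorem makes [f]
    exceed [f a] there. *)
Lemma derive2_at_max (f df : R -> R) (a l : R) :
  (\forall t \near a, is_derive (t : R) 1 f (df t)) -> is_derive a 1 df l ->
  (\forall t \near a, f t <= f a) -> l <= 0.
Proof.
move=> Hf /is_derive1_epsP Hdf fa; rewrite leNgt; apply/negP => l0.
have df0 : df a = 0 by apply: derive_at_max fa; exact: nbhs_singleton Hf.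
move/near_realP : Hf => [d d0 dP]; move/near_realP : fa => [d1 d10 d1P].
have l20 : 0 < l / 2 by rewrite divr_gt0.
have [d2 d20 d2P] := Hdf _ l20.
pose h := Num.min d (Num.min d1 d2) / 2.
have hm : 0 < Num.min d (Num.min d1 d2) by rewrite !lt_min d0 d10 d20.
have h0 : 0 < h by rewrite divr_gt0.
have : h < Num.min d (Num.min d1 d2) by rewrite ltr_pdivrMr// ltr_pMr ?ltr1n.
rewrite !lt_min => /and3P[hd hd1 hd2]; clearbody h.
have ah : a < a + h by rewrite ltrDl.
have H x : a <= x <= a + h -> is_derive x 1 f (df x).
  move=> /andP[ax xh]; apply: dP; rewrite ger0_norm ?subr_ge0//; lra.
have [| |c] := @MVT _ f df a (a + h) ah.
- by move=> x; rewrite in_itv /= => /andP[ax xb]; apply: H; rewrite !ltW.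
- by apply: derivable_within_continuous => x; rewrite in_itv /= => /H[].
rewrite in_itv /= => /andP[ac cb] E.
have := d1P (a + h); rewrite (addrAC a) subrr add0r gtr0_norm// => /(_ hd1).
rewrite -subr_le0 E (addrAC a) subrr add0r leNgt => /negP; apply.
rewrite mulr_gt0//.
have ca : `|c - a| = c - a by rewrite gtr0_norm ?subr_gt0.
have := d2P c; rewrite ca df0 subr0 => /(_ _)/wrap[]; first by lra.
by rewrite ler_norml => /andP[A _]; nra.
Qed.

Lemma open_boundary D q : open D -> closure D q -> D q \/ boundary D q.
Proof.
move=> oD Dq; have [|nDq] := pselect (D q); [by left|right].
by split=> //; move/interior_id : oD => ->.
Qed.

(** Adding [e |q|^2] makes the Laplacian strictly positive where [w > c], which excludes an interior
    maximum there. Asking for subharmonicity only where [w > c] is what makes the principle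
    applicable to [u_ee], whose Laplacian has a known sign only where [u_ee] is nonnegative. *)
Lemma weak_maximum_principle D (w w1 w2 w11 w22 : plane R -> R) (c : R) :
  open D -> bounded_set D -> {within closure D, continuous w} ->
  (forall p, D p -> [/\ is_derive p (1, 0) w (w1 p), is_derive p (0, 1) w (w2 p),
     is_derive p (1, 0) w1 (w11 p) & is_derive p (0, 1) w2 (w22 p)]) ->
  (forall p, D p -> c < w p -> 0 <= w11 p + w22 p) ->
  (forall p, boundary D p -> w p <= c) ->
  forall p, closure D p -> w p <= c.
Proof.
move=> oD bD cw Hw sub bnd p0 Dp0; rewrite leNgt; apply/negP => wp0.
have [K K0 HK] := bounded_plane bD.
(* As [|q|^2 <= 2 K^2] on the closure, the perturbation stays below [w p0 - c], so [w] still exceeds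
   [c] at the maximum point of [g]. *)
pose e := (w p0 - c) / (2 * (K * K) + 1).
have KK : 0 < 2 * (K * K) + 1 by rewrite ltr_wpDl// mulr_ge0// mulr_ge0// ltW.
have e0 : 0 < e by rewrite divr_gt0// subr_gt0.
have eK : e * (2 * (K * K) + 1) = w p0 - c by rewrite mulfVK// gt_eqF.
pose g (q : plane R) := w q + e * (q.1 * q.1 + q.2 * q.2).
have cg : {within closure D, continuous g}.
  apply: within_add cw _; apply: within_mul; first exact: within_cst.
  by apply: within_add; apply: within_mul; by [exact: within_fst|exact: within_snd].
have [m] := compact_EVT_max (ex_intro _ p0 Dp0) (compact_closure_plane bD) cg.
rewrite inE => Dm gm.
have gp0 : g p0 <= g m by apply: gm; rewrite inE.
have [Km1 Km2] := HK _ Dm.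
have cm : c < w m.
  have H (x : R) : `|x| <= K -> x * x <= K * K.
    by rewrite ler_norml => /andP[A B]; nra.
  have := H _ Km1; have := H _ Km2; move: gp0; rewrite /g.
  have : 0 <= p0.1 * p0.1 + p0.2 * p0.2 by rewrite addr_ge0// -expr2 sqr_ge0.
  nra.
have [Dm'|] := open_boundary oD Dm; last by move/bnd; rewrite leNgt cm.
have /near_planeP[d d0 dP] : \forall q \near m, D q by exact: open_nbhs_nbhs.
have H1 : w11 m + 2 * e <= 0.
  have H t : `|t - m.1| < d -> D (t, m.2).
    by move=> td; apply: dP => //=; rewrite subrr normr0.
  apply: (@derive2_at_max (fun t => w (t, m.2) + e * (t * t))
      (fun t => w1 (t, m.2) + e * (2 * t)) m.1).
  - apply/near_realP; exists d => // t td; have [A _ _ _] := Hw _ (H _ td).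
    have := derive_section1 A => A'.
    by apply: is_derive_eq; rewrite /GRing.scale /=; ring.
  - have [_ _ A _] := Hw _ Dm'; move: A; rewrite {1}[m]surjective_pairing => A.
    have A' := derive_section1 A.
    by apply: is_derive_eq; rewrite /GRing.scale /=; ring.
  - apply/near_realP; exists d => // t td.
    have := gm (t, m.2); rewrite inE => /(_ (@subset_closure _ _ _ (H _ td))).
    by rewrite /g /= -surjective_pairing; lra.
have H2 : w22 m + 2 * e <= 0.
  have H t : `|t - m.2| < d -> D (m.1, t).
    by move=> td; apply: dP => //=; rewrite subrr normr0.
  apply: (@derive2_at_max (fun t => w (m.1, t) + e * (t * t))
      (fun t => w2 (m.1, t) + e * (2 * t)) m.2).
  - apply/near_realP; exists d => // t td; have [_ A _ _] := Hw _ (H _ td).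
    have := derive_section2 A => A'.
    by apply: is_derive_eq; rewrite /GRing.scale /=; ring.
  - have [_ _ _ A] := Hw _ Dm'; move: A; rewrite {1}[m]surjective_pairing => A.
    have A' := derive_section2 A.
    by apply: is_derive_eq; rewrite /GRing.scale /=; ring.
  - apply/near_realP; exists d => // t td.
    have := gm (m.1, t); rewrite inE => /(_ (@subset_closure _ _ _ (H _ td))).
    by rewrite /g /= -surjective_pairing; lra.
by have := sub _ Dm' cm; lra.
Qed.

Lemma concave_segment (f df d2f : R -> R) :
  (forall t : R, 0 <= t <= 1 -> is_derive t 1 f (df t)) ->
  (forall t : R, 0 <= t <= 1 -> is_derive t 1 df (d2f t)) ->
  (forall t : R, 0 <= t <= 1 -> d2f t <= 0) ->
  forall t : R, 0 <= t <= 1 -> (1 - t) * f 0 + t * f 1 <= f t.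
Proof.
move=> Hf Hdf H2 t /andP[t0 t1].
have mvt (h dh : R -> R) a b : 0 <= a -> a <= b -> b <= 1 ->
    (forall s : R, 0 <= s <= 1 -> is_derive s 1 h (dh s)) ->
    exists c, [/\ a <= c, c <= b & h b - h a = dh c * (b - a)].
  move=> a0 ab b1 Hh.
  have H x : a <= x <= b -> is_derive x 1 h (dh x).
    by move=> /andP[ax xb]; apply: Hh; rewrite (le_trans a0 ax) (le_trans xb b1).
  have [| |c] := @MVT_segment _ h dh a b ab.
  - by move=> x; rewrite in_itv /= => /andP[ax xb]; apply: H; rewrite !ltW.
  - by apply: derivable_within_continuous => x; rewrite in_itv /= => /H[].
  by rewrite in_itv /= => /andP[ac cb] E; exists c.
have [c1 [c10 c1t E1]] := mvt f df 0 t (lexx _) t0 t1 Hf.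
have [c2 [c2t c21 E2]] := mvt f df t 1 t0 t1 (lexx _) Hf.
have [c3 [c31 c32 E3]] := mvt df d2f c1 c2 c10 (le_trans c1t c2t) c21 Hdf.
have : df c2 - df c1 <= 0.
  by rewrite E3 mulr_le0_ge0 ?subr_ge0 ?(le_trans c1t c2t)// H2//; apply/andP; split; lra.
have : 0 <= t * (1 - t) by rewrite mulr_ge0// subr_ge0.
move: E1 E2; rewrite subr0; nra.
Qed.

End maximum_principle.

(** * Boundary arcs *)

Section arcs.
Variable R : realType.
Implicit Types (p q : plane R) (C D : set (plane R)) (F : plane R -> R)
  (x y f g : R -> R).

Lemma is_derive_near_cst f (a l c : R) : is_derive a 1 f l ->
  (\forall s \near a, f s = c) -> l = 0.
Proof.
move=> /is_derive1_epsP Hf /near_realP[d d0 dP].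
apply/eqP; rewrite -normr_eq0 eq_le normr_ge0 andbT; apply/ler_addgt0Pl => e e0.
rewrite addr0; have [d1 d10 d1P] := Hf e e0.
have hm : 0 < Num.min d d1 by rewrite lt_min d0.
have h0 : 0 < Num.min d d1 / 2 by rewrite divr_gt0.
have : Num.min d d1 / 2 < Num.min d d1 by rewrite ltr_pdivrMr// ltr_pMr ?ltr1n.
move: (_ / 2) h0 => h h0; rewrite lt_min => /andP[hd hd1].
have := d1P (a + h); have := dP (a + h); have := dP a.
rewrite subrr normr0 (addrAC a) subrr add0r gtr0_norm// => -> // -> //.
rewrite subrr sub0r normrN normrM (gtr0_norm h0) => /(_ hd1).
by rewrite ler_pM2r.
Qed.

Lemma is_derive1D f g (a l m : R) : is_derive a 1 f l -> is_derive a 1 g m ->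
  is_derive a 1 (fun t => f t + g t) (l + m).
Proof. by move=> ? ?; apply: is_deriveD. Qed.

Lemma is_derive1M f g (a l m : R) : is_derive a 1 f l -> is_derive a 1 g m ->
  is_derive a 1 (fun t => f t * g t) (l * g a + f a * m).
Proof.
move=> ? ?; apply: (is_derive_eq (is_deriveM _ _)).
by rewrite /GRing.scale /= addrC mulrC.
Qed.

Lemma is_derive1Z f (c a l : R) : is_derive a 1 f l ->
  is_derive a 1 (fun t => c * f t) (c * l).
Proof. by move=> ?; apply: is_deriveZ. Qed.

Lemma derive1_shift f (s t : R) : derive1 (fun r => f (r + s)) t = derive1 f (t + s).
Proof.
rewrite /derive1 [X in X @ _](_ : _ = fun h => h^-1 *: (f (h + (t + s)) - f (t + s)))//.
by apply/funext => h; rewrite addrA.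
Qed.

Lemma derive1n_shift n f (s : R) :
  derive1n n (fun r => f (r + s)) = (fun r => derive1n n f (r + s)).
Proof.
elim: n => //= n IH; rewrite !/(derive1n _.+1 _) /=.
by rewrite -/(derive1n n _) IH; apply/funext => t; rewrite derive1_shift.
Qed.

Lemma derivable_shift f (s t : R) : derivable f (t + s) 1 ->
  derivable (fun r => f (r + s)) t 1.
Proof.
move=> /derivableP/is_derive1_epsP H.
suff [] : is_derive t 1 (fun r => f (r + s)) ('D_1 f (t + s)) by [].
apply/is_derive1_epsP => e e0; have [d d0 dP] := H e e0; exists d => // r rt.
by have := dP (r + s); rewrite opprD addrACA subrr addr0; exact.
Qed.

Lemma boundary_arc_shift D p x y : boundary_arc D p x y ->
  \forall s \near (0 : R),
    boundary_arc D (x s, y s) (fun r => x (r + s)) (fun r => y (r + s)).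
Proof.
move=> [_ /near_realP[d d0 dP]]; apply/near_realP; exists (d / 2).
  by rewrite divr_gt0.
move=> s; rewrite subr0 => sd; split; first by rewrite !add0r.
apply/near_realP; exists (d / 2); first by rewrite divr_gt0.
move=> t; rewrite subr0 => td.
have /dP[H1 H2 H3 H4] : `|t + s - 0| < d.
  by rewrite subr0 (splitr d); apply: le_lt_trans (ler_normD _ _) _; exact: ltrD.
split.
- by move=> n; rewrite !derive1n_shift; have [] := H1 n; split; exact: derivable_shift.
- by rewrite !derive1_shift.
- exact: H3.
- by rewrite !derive1_shift.
Qed.

Definition arc_curvature x y (s : R) : R :=
  derive1 x s * derive1n 2 y s - derive1 y s * derive1n 2 x s.

Lemma derivable_is_derive1 f (s : R) : derivable f s 1 -> is_derive s 1 f (derive1 f s).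
Proof. by move=> /derivableP; rewrite derive1E. Qed.

(** Differentiating the unit speed makes the acceleration orthogonal to the tangent, hence equal to
    its component [k] times the normal [(- y1, x1)]. *)
Lemma unit_speed_frenet (x1 x2 y1 y2 : R -> R) (s : R) :
  is_derive s 1 x1 (x2 s) -> is_derive s 1 y1 (y2 s) ->
  (\forall t \near s, x1 t ^+ 2 + y1 t ^+ 2 = 1) ->
  let k := x1 s * y2 s - y1 s * x2 s in
  is_derive s 1 x1 (- k * y1 s) /\ is_derive s 1 y1 (k * x1 s).
Proof.
move=> dx dy unit k.
have orth : x1 s * x2 s + y1 s * y2 s = 0.
  have : is_derive s 1 (fun t => x1 t ^+ 2 + y1 t ^+ 2) (2 * (x1 s * x2 s + y1 s * y2 s)).
    by apply: is_derive_eq; rewrite /GRing.scale /=; ring.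
  move/is_derive_near_cst => /(_ 1 unit)/eqP.
  by rewrite mulf_eq0 pnatr_eq0 /= => /eqP.
have := nbhs_singleton unit; rewrite !expr2 => u.
split; [apply: is_derive_eq dx _|apply: is_derive_eq dy _].
  rewrite (_ : x2 s = - k * y1 s + x1 s * (x1 s * x2 s + y1 s * y2 s) +
    (1 - (x1 s * x1 s + y1 s * y1 s)) * x2 s); last by rewrite /k; ring.
  by rewrite orth u subrr mulr0 mul0r !addr0.
rewrite (_ : y2 s = k * x1 s + y1 s * (x1 s * x2 s + y1 s * y2 s) +
  (1 - (x1 s * x1 s + y1 s * y1 s)) * y2 s); last by rewrite /k; ring.
by rewrite orth u subrr mulr0 mul0r !addr0.
Qed.

Lemma near_near (P : set R) (a : R) :
  (\forall s \near a, P s) -> \forall s \near a, \forall t \near s, P t.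
Proof.
move=> /near_realP[d d0 dP]; apply/near_realP; exists d; [exact: d0|move=> s sd].
apply/near_realP; exists (d - `|s - a|); first by rewrite subr_gt0.
move=> t ts; apply: dP; rewrite (_ : t - a = (t - s) + (s - a)); last by ring.
by apply: le_lt_trans (ler_normD _ _) _; rewrite -ltrBrDr.
Qed.

(** The Frenet equations with tangent [(x1, y1)] and normal [(- y1, x1)]. In this form the second
    and third derivatives along an arc involve only [k] and [k1]. *)
Definition frenet_curve (x y x1 y1 k k1 : R -> R) (s : R) :=
  [/\ is_derive s 1 x (x1 s), is_derive s 1 y (y1 s),
      is_derive s 1 x1 (- k s * y1 s), is_derive s 1 y1 (k s * x1 s) &
      is_derive s 1 k (k1 s)].

Lemma derivable_cross (x1 x2 y1 y2 : R -> R) (s : R) :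
  derivable x1 s 1 -> derivable x2 s 1 -> derivable y1 s 1 -> derivable y2 s 1 ->
  derivable (fun t => x1 t * y2 t - y1 t * x2 t) s 1.
Proof.
move=> /derivable_is_derive1 a /derivable_is_derive1 b.
move=> /derivable_is_derive1 c /derivable_is_derive1 d.
suff [] : is_derive s 1 (fun t => x1 t * y2 t - y1 t * x2 t)
  (derive1 x1 s * y2 s + x1 s * derive1 y2 s - (derive1 y1 s * x2 s + y1 s * derive1 x2 s)) by [].
by apply: is_derive_eq; rewrite /GRing.scale /=; ring.
Qed.

Lemma arc_frenet D p x y : boundary_arc D p x y ->
  let k := arc_curvature x y in
  \forall s \near (0 : R), frenet_curve x y (derive1 x) (derive1 y) k (derive1 k) s.
Proof.
move=> [_ arc] k; near=> s.
have [H1 H2 _ _] : [/\ forall n, derivable (derive1n n x) s 1 /\ derivable (derive1n n y) s 1,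
        derive1 x s ^+ 2 + derive1 y s ^+ 2 = 1,
        boundary D (x s, y s) &
        \forall t \near 0^'+, D (x s - t * derive1 y s, y s + t * derive1 x s)].
  by near: s.
have [/derivable_is_derive1 x1 /derivable_is_derive1 y1] := H1 0%N.
have [/derivable_is_derive1 x2 /derivable_is_derive1 y2] := H1 1%N.
have [x3 y3] := H1 2%N.
have [|A B] := unit_speed_frenet x2 y2.
  by near: s; apply: near_near; apply: filterS arc => s [].
split; [exact: x1|exact: y1|exact: A|exact: B|].
apply: derivable_is_derive1.
case: x2 => x2 _; case: y2 => y2 _.
exact: (derivable_cross x2 x3 y2 y3).
Unshelve. all: by end_near. Qed.

(** These are the first three derivatives at 0 of [F (x s, y s) = 0], with the derivatives of the
    tangent eliminated by the Frenet equations. The third one also produces [- k^2] times the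
    tangential derivative of [F], which vanishes by the first identity. *)
Lemma curve_third_order C (F F1 F2 F11 F12 F22 F111 F112 F122 F222 : plane R -> R)
    (x y x1 y1 k k1 : R -> R) :
  (forall q, C q -> has_grad C F (F1 q) (F2 q) q) ->
  (forall q, C q -> has_grad C F1 (F11 q) (F12 q) q) ->
  (forall q, C q -> has_grad C F2 (F12 q) (F22 q) q) ->
  (forall q, C q -> has_grad C F11 (F111 q) (F112 q) q) ->
  (forall q, C q -> has_grad C F12 (F112 q) (F122 q) q) ->
  (forall q, C q -> has_grad C F22 (F122 q) (F222 q) q) ->
  (\forall s \near (0 : R), frenet_curve x y x1 y1 k k1 s) ->
  (\forall s \near (0 : R), C (x s, y s) /\ F (x s, y s) = 0) ->
  let p := (x 0, y 0) in let a := x1 0 in let b := y1 0 in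
  [/\ F1 p * a + F2 p * b = 0,
      F11 p * a * a + 2 * F12 p * a * b + F22 p * b * b
        + k 0 * (F2 p * a - F1 p * b) = 0 &
      F111 p * a * a * a + 3 * F112 p * a * a * b + 3 * F122 p * a * b * b + F222 p * b * b * b
        + 3 * k 0 * (- F11 p * a * b + F12 p * (a * a - b * b) + F22 p * a * b)
        + k1 0 * (F2 p * a - F1 p * b) = 0].
Proof.
move=> HF H1 H2 H11 H12 H22 Hfr HC.
have cl : \forall s \near (0 : R), C (x s, y s) by apply: filterS HC => s [].
have E0 : \forall s \near (0 : R), F (x s, y s) = 0 by apply: filterS HC => s [].
have cl2 := near_near cl.
have E1 : \forall s \near (0 : R),
    F1 (x s, y s) * x1 s + F2 (x s, y s) * y1 s = 0.
  near=> s.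
  have [dx dy _ _ _] : frenet_curve x y x1 y1 k k1 s by near: s.
  have Cs : C (x s, y s) by near: s.
  apply: (@is_derive_near_cst (fun t => F (x t, y t)) s _ 0); last by near: s; exact: (near_near E0).
  by apply: (has_grad_curve (HF _ Cs) dx dy); near: s.
have E2 : \forall s \near (0 : R),
    F11 (x s, y s) * x1 s * x1 s + 2 * F12 (x s, y s) * x1 s * y1 s +
    F22 (x s, y s) * y1 s * y1 s
        + k s * (F2 (x s, y s) * x1 s + - 1 * (F1 (x s, y s) * y1 s)) = 0.
  near=> s.
  have [dx dy dx1 dy1 _] : frenet_curve x y x1 y1 k k1 s by near: s.
  have Cs : C (x s, y s) by near: s.
  have Cn : \forall t \near s, C (x t, y t) by near: s.
  have D1 := has_grad_curve (H1 _ Cs) dx dy Cn.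
  have D2 := has_grad_curve (H2 _ Cs) dx dy Cn.
  have D3 : is_derive s 1 (fun t => F1 (x t, y t) * x1 t + F2 (x t, y t) * y1 t)
    (F11 (x s, y s) * x1 s * x1 s + 2 * F12 (x s, y s) * x1 s * y1 s +
    F22 (x s, y s) * y1 s * y1 s
        + k s * (F2 (x s, y s) * x1 s + - 1 * (F1 (x s, y s) * y1 s))).
    by apply: is_derive_eq (is_derive1D (is_derive1M D1 dx1) (is_derive1M D2 dy1)) _; ring.
  by apply: (is_derive_near_cst D3); near: s; exact: (near_near E1).
split; first exact: nbhs_singleton E1.
  by have /= E := nbhs_singleton E2; apply: etrans E; ring.
have [dx dy dx1 dy1 dk] := nbhs_singleton Hfr.
have Cs := nbhs_singleton cl.
have D1 := has_grad_curve (H1 _ Cs) dx dy cl.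
have D2 := has_grad_curve (H2 _ Cs) dx dy cl.
have D11 := has_grad_curve (H11 _ Cs) dx dy cl.
have D12 := has_grad_curve (H12 _ Cs) dx dy cl.
have D22 := has_grad_curve (H22 _ Cs) dx dy cl.
apply: (is_derive_near_cst _ E2).
apply: is_derive_eq (is_derive1D (is_derive1D (is_derive1D
  (is_derive1M (is_derive1M D11 dx1) dx1)
  (is_derive1M (is_derive1M (is_derive1Z 2 D12) dx1) dy1))
  (is_derive1M (is_derive1M D22 dy1) dy1))
  (is_derive1M dk (is_derive1D (is_derive1M D2 dx1)
     (is_derive1Z (-1) (is_derive1M D1 dy1))))) _.
have /= E := nbhs_singleton E1.
apply/eqP; rewrite -subr_eq0 (_ : _ - _ =
  - (k 0 * k 0) * (F1 (x 0, y 0) * x1 0 + F2 (x 0, y 0) * y1 0)); last by ring.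
by rewrite E mulr0.
Unshelve. all: by end_near. Qed.

End arcs.

(** * Curvature of a boundary given by a defining function *)

Section defining_function.
Variable R : realType.
Implicit Types (p q : plane R) (C D : set (plane R)) (F : plane R -> R)
  (x y f g : R -> R).

Definition coord1 (th : R) (c q : plane R) : R :=
  cos th * (q.1 - c.1) + sin th * (q.2 - c.2).
Definition coord2 (th : R) (c q : plane R) : R :=
  - sin th * (q.1 - c.1) + cos th * (q.2 - c.2).

Lemma has_grad_coord1 C th c q0 : has_grad C (coord1 th c) (cos th) (sin th) q0.
Proof.
move=> e e0; exists 1 => // q _ _ _.
rewrite /coord1 (_ : _ - _ = 0); last by ring.
by rewrite normr0 mulr_ge0 ?addr_ge0// ltW.
Qed.

Lemma has_grad_coord2 C th c q0 : has_grad C (coord2 th c) (- sin th) (cos th) q0.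
Proof.
move=> e e0; exists 1 => // q _ _ _.
rewrite /coord2 (_ : _ - _ = 0); last by ring.
by rewrite normr0 mulr_ge0 ?addr_ge0// ltW.
Qed.

Lemma has_grad_separable C th c G H (g h : R) q0 :
  is_derive (coord1 th c q0) 1 G g -> is_derive (coord2 th c q0) 1 H h ->
  has_grad C (fun q => G (coord1 th c q) + H (coord2 th c q))
    (g * cos th + h * - sin th) (g * sin th + h * cos th) q0.
Proof.
move=> HG HH; apply: has_gradD.
  exact: has_grad_comp HG (@has_grad_coord1 _ _ _ _).
exact: has_grad_comp HH (@has_grad_coord2 _ _ _ _).
Qed.

(** A separable defining function in rotated coordinates, with nonzero gradient on its zero set. One
    shape covers both the domain, locally above a graph ([H] is then the identity), and ellipses
    ([G] and [H] are then quadratic); the mixed second derivative is always 0. *)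
Definition defining D p (th : R) (c : plane R) (G G1 G2 H H1 H2 : R -> R) :=
  [/\ (forall t : R, is_derive t 1 G (G1 t)) /\ (forall t : R, is_derive t 1 G1 (G2 t)),
      (forall t : R, is_derive t 1 H (H1 t)) /\ (forall t : R, is_derive t 1 H1 (H2 t)),
      \forall q \near p, D q <-> 0 < G (coord1 th c q) + H (coord2 th c q) &
      \forall q \near p, G (coord1 th c q) + H (coord2 th c q) = 0 ->
        0 < G1 (coord1 th c q) ^+ 2 + H1 (coord2 th c q) ^+ 2].

Lemma near_near_plane (P : set (plane R)) p :
  (\forall q \near p, P q) -> \forall q \near p, \forall z \near q, P z.
Proof.
move=> /near_planeP[d d0 dP]; apply/near_planeP; exists d; [exact: d0|move=> q q1 q2].
apply/near_planeP.
exists (Num.min (d - `|q.1 - p.1|) (d - `|q.2 - p.2|)).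
  by rewrite lt_min !subr_gt0 q1.
move=> z; rewrite !lt_min => /andP[z1 _] /andP[_ z2]; apply: dP.
  rewrite (_ : z.1 - p.1 = (z.1 - q.1) + (q.1 - p.1)); last by ring.
  by apply: le_lt_trans (ler_normD _ _) _; rewrite -ltrBrDr.
rewrite (_ : z.2 - p.2 = (z.2 - q.2) + (q.2 - p.2)); last by ring.
by apply: le_lt_trans (ler_normD _ _) _; rewrite -ltrBrDr.
Qed.

Lemma defining_near D p th c G G1 G2 H H1 H2 :
  defining D p th c G G1 G2 H H1 H2 ->
  \forall q \near p, defining D q th c G G1 G2 H H1 H2.
Proof.
move=> [HG HH /near_near_plane A /near_near_plane B].
near=> q; split; [exact: HG|exact: HH|near: q; exact: A|near: q; exact: B].
Unshelve. all: by end_near. Qed.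

Lemma defining_boundary D p th c G G1 G2 H H1 H2 :
  defining D p th c G G1 G2 H H1 H2 -> boundary D p ->
  G (coord1 th c p) + H (coord2 th c p) = 0.
Proof.
move=> [[HG _] [HH _] /near_planeP[d d0 dP] _] [Dp nDp].
set phi := fun q => G (coord1 th c q) + H (coord2 th c q).
have cphi := has_grad_cont (@has_grad_separable setT th c G H _ _ p (HG _) (HH _)).
have [neg|pos|//] := ltrgtP (phi p) 0.
  have /cphi[d1 d10 d1P] : 0 < - phi p by rewrite oppr_gt0.
  have /closure_planeP/(_ (Num.min d d1))[|q []] := Dp; first by rewrite lt_min d0.
  rewrite !lt_min => Dq /andP[q1 q1'] /andP[q2 q2'].
  have := (dP q q1 q2).1 Dq; have := d1P q Logic.I q1' q2'.
  rewrite -/(phi q) -/(phi p) ltr_norml => /andP[_]; lra.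
exfalso; apply: nDp; rewrite /interior /=; apply/near_planeP.
have [d1 d10 d1P] := cphi _ pos.
exists (Num.min d d1); first by rewrite lt_min d0.
move=> q; rewrite !lt_min => /andP[q1 q1'] /andP[q2 q2'].
apply/(dP q q1 q2); have := d1P q Logic.I q1' q2'.
by rewrite -/(phi q) -/(phi p) ltr_norml => /andP[+ _]; lra.
Qed.

Lemma is_derive1C f g (a l m : R) : is_derive (g a) 1 f l -> is_derive a 1 g m ->
  is_derive a 1 (fun t => f (g t)) (l * m).
Proof. exact: is_derive1_comp. Qed.

Lemma derive_at_min_right f (l : R) : is_derive (0 : R) 1 f l ->
  (\forall t \near 0^'+, f 0 <= f t) -> 0 <= l.
Proof.
move=> /is_derive1_epsP Hf /near_rightP[d d0 dP]; rewrite leNgt; apply/negP => l0.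
have [d1 d10 d1P] := Hf (- l / 2) (divr_gt0 (etrans (oppr_gt0 l) l0) (ltr0Sn _ 1)).
have h0 : 0 < Num.min d d1 / 2 by rewrite divr_gt0// lt_min d0.
have : Num.min d d1 / 2 < Num.min d d1.
  by rewrite ltr_pdivrMr// ltr_pMr ?ltr1n// lt_min d0.
move: (_ / 2) h0 => h h0; rewrite lt_min => /andP[hd hd1].
have := dP h h0 hd; rewrite add0r; have := d1P h.
by rewrite subr0 gtr0_norm// => /(_ hd1); rewrite ler_norml => /andP[_]; nra.
Qed.

Lemma derive_near f (l : R) (a e : R) : is_derive a 1 f l -> 0 < e ->
  \forall s \near a, `|f s - f a| < e.
Proof.
move=> [df _] e0; have /cvgrPdist_lt/(_ e e0) : f @ a --> f a.
  by apply: differentiable_continuous; apply/derivable1_diffP.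
by apply: filterS => s; rewrite distrC.
Qed.

(** Here [w] is the derivative of the defining function along the inner normal, that is, the norm of
    its gradient. Its second derivative along the arc gives [k w] as minus the Hessian on the
    tangent; multiplying by [w^2] replaces the tangent by the gradient, so that the right-hand side
    no longer sees the arc. *)
Lemma defining_arc D p x y th c G G1 G2 H H1 H2 :
  defining D p th c G G1 G2 H H1 H2 -> boundary_arc D p x y ->
  let X1 := cos th * derive1 x 0 + sin th * derive1 y 0 in
  let Y1 := - sin th * derive1 x 0 + cos th * derive1 y 0 in
  let g := G1 (coord1 th c p) in let h := H1 (coord2 th c p) in
  exists w : R, [/\ 0 < w, h = w * X1, g = - (w * Y1) &
    arc_curvature x y 0 * w ^+ 3 =
      - (G2 (coord1 th c p) * h ^+ 2 + H2 (coord2 th c p) * g ^+ 2)].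
Proof.
move=> Hdef arc.
have Hfr := arc_frenet arc.
have [p0 Harc] := arc.
set k := arc_curvature x y in Hfr *.
move: (derive1 x) (derive1 y) Hfr Harc {arc} => x1 y1 Hfr Harc X1 Y1 g h.
clearbody k.
have unit0 : x1 0 ^+ 2 + y1 0 ^+ 2 = 1 by have [] := nbhs_singleton Harc.
pose X t := coord1 th c (x t, y t); pose Y t := coord2 th c (x t, y t).
pose X' t := cos th * x1 t + sin th * y1 t; pose Y' t := - sin th * x1 t + cos th * y1 t.
have Hfr' : \forall s \near (0 : R), frenet_curve X Y X' Y' k (derive1 k) s.
  apply: filterS Hfr => s [dx dy dx1 dy1 dk]; split; last exact: dk.
  - by apply: (has_grad_curve (@has_grad_coord1 setT th c _) dx dy); exact: filterT.
  - by apply: (has_grad_curve (@has_grad_coord2 setT th c _) dx dy); exact: filterT.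
  - apply: is_derive_eq (is_derive1D (is_derive1Z _ dx1) (is_derive1Z _ dy1)) _.
    by rewrite /Y'; ring.
  - apply: is_derive_eq (is_derive1D (is_derive1Z _ dx1) (is_derive1Z _ dy1)) _.
    by rewrite /X'; ring.
have [[HG1 HG2] [HH1 HH2] _ _] := Hdef.
have cxy e : 0 < e -> \forall s \near (0 : R), `|x s - p.1| < e /\ `|y s - p.2| < e.
  move=> e0; have [dx dy _ _ _] := nbhs_singleton Hfr.
  by rewrite -p0 /=; apply: filterS2 (derive_near dx e0) (derive_near dy e0) => s; split.
have E0 : \forall s \near (0 : R), G (X s) + H (Y s) = 0.
  move/near_planeP : (defining_near Hdef) => [d d0 dP].
  apply: filterS2 (cxy d d0) Harc => s [s1 s2] [_ _ bs _].
  exact: defining_boundary (dP (x s, y s) s1 s2) bs.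
have E1 : \forall s \near (0 : R), G1 (X s) * X' s + H1 (Y s) * Y' s = 0.
  near=> s.
  have [dX dY _ _ _] : frenet_curve X Y X' Y' k (derive1 k) s by near: s.
  have D1 : is_derive s 1 (fun t => G (X t) + H (Y t)) (G1 (X s) * X' s + H1 (Y s) * Y' s).
    exact: is_derive1D (is_derive1C (HG1 _) dX) (is_derive1C (HH1 _) dY).
  by apply: (is_derive_near_cst D1); near: s; exact: (near_near E0).
have [dX dY dX1 dY1 _] := nbhs_singleton Hfr'.
have E2 : G2 (X 0) * X' 0 ^+ 2 + H2 (Y 0) * Y' 0 ^+ 2 + k 0 * (H1 (Y 0) * X' 0 - G1 (X 0) * Y' 0) = 0.
  have D2 : is_derive (0 : R) 1 (fun t => G1 (X t) * X' t + H1 (Y t) * Y' t)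
    (G2 (X 0) * X' 0 ^+ 2 + H2 (Y 0) * Y' 0 ^+ 2 + k 0 * (H1 (Y 0) * X' 0 - G1 (X 0) * Y' 0)).
    apply: is_derive_eq (is_derive1D (is_derive1M (is_derive1C (HG2 _) dX) dX1)
      (is_derive1M (is_derive1C (HH2 _) dY) dY1)) _.
    ring.
  exact: is_derive_near_cst D2 E1.
have E3 := nbhs_singleton E1.
(* The derivative at 0 of the defining function along the inward ray, where it starts from 0 and is
   positive. *)
have E4 : 0 <= H1 (Y 0) * X' 0 - G1 (X 0) * Y' 0.
  have D3 : is_derive (0 : R) 1 (fun t => G (X 0 + - Y' 0 * t) + H (Y 0 + X' 0 * t))
     (H1 (Y 0) * X' 0 - G1 (X 0) * Y' 0).
    have lin (u v : R) : is_derive (0 : R) 1 (fun t => u + v * t) v.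
      by apply: is_derive_eq; rewrite /GRing.scale /=; ring.
    apply: is_derive_eq (is_derive1D (is_derive1C (HG1 _) (lin _ _))
       (is_derive1C (HH1 _) (lin _ _))) _.
    by rewrite !mulr0 !addr0; ring.
  apply: (derive_at_min_right D3).
  have [_ _ _] := nbhs_singleton Harc; rewrite !mulr0 !addr0 (nbhs_singleton E0).
  have [_ _ /near_planeP[d d0 dP] _] := Hdef.
  move=> Dn; have /near_rightP[d1 d10 d1P] := Dn.
  pose m := 1 + `|x1 0| + `|y1 0|.
  have m0 : 0 < m by rewrite !ltr_wpDr.
  apply/near_rightP; exists (Num.min d1 (d / m)); first by rewrite lt_min d10 divr_gt0.
  move=> t t0; rewrite lt_min ltr_pdivlMr// => /andP[td1 td]; have := d1P t t0 td1.
  rewrite !add0r => Dt; have := dP (x 0 - t * y1 0, y 0 + t * x1 0).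
  have xp : p.1 = x 0 by rewrite -p0.
  have yp : p.2 = y 0 by rewrite -p0.
  have x10 := normr_ge0 (x1 0); have y10 := normr_ge0 (y1 0).
  rewrite /= xp yp (addrAC (x 0)) (addrAC (y 0)) !subrr !add0r normrN !normrM (gtr0_norm t0).
  move=> /(_ _ _)/wrap[].
  - by apply: le_lt_trans td; rewrite ler_wpM2l ?ltW// /m; lra.
  - by apply: le_lt_trans td; rewrite ler_wpM2l ?ltW// /m; lra.
  case=> /(_ Dt)/ltW + _.
  rewrite (_ : coord1 _ _ _ = X 0 + - Y' 0 * t); last by rewrite /X /Y' /coord1 /=; ring.
  by rewrite (_ : coord2 _ _ _ = Y 0 + X' 0 * t)//; rewrite /Y /X' /coord2 /=; ring.
have unitXY : X' 0 ^+ 2 + Y' 0 ^+ 2 = 1.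
  rewrite -[RHS]unit0 -[RHS]mul1r -(cos2Dsin2 th) /X' /Y'; ring.
have wE : (H1 (Y 0) * X' 0 - G1 (X 0) * Y' 0) ^+ 2 = G1 (X 0) ^+ 2 + H1 (Y 0) ^+ 2.
  apply: subr0_eq; rewrite (_ : _ - _ =
    (G1 (X 0) ^+ 2 + H1 (Y 0) ^+ 2) * (X' 0 ^+ 2 + Y' 0 ^+ 2 - 1)
    - (G1 (X 0) * X' 0 + H1 (Y 0) * Y' 0) ^+ 2); last by ring.
  by rewrite E3 unitXY subrr mulr0 expr0n subr0.
have XE : coord1 th c p = X 0 by rewrite -p0.
have YE : coord2 th c p = Y 0 by rewrite -p0.
have hE : h = (H1 (Y 0) * X' 0 - G1 (X 0) * Y' 0) * X' 0.
  rewrite /h YE; apply: subr0_eq; rewrite (_ : _ - _ =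
    H1 (Y 0) * (1 - (X' 0 ^+ 2 + Y' 0 ^+ 2))
    + Y' 0 * (G1 (X 0) * X' 0 + H1 (Y 0) * Y' 0)); last by ring.
  by rewrite E3 unitXY subrr !mulr0 addr0.
have gE : g = - ((H1 (Y 0) * X' 0 - G1 (X 0) * Y' 0) * Y' 0).
  rewrite /g XE; apply: subr0_eq; rewrite (_ : _ - _ =
    G1 (X 0) * (1 - (X' 0 ^+ 2 + Y' 0 ^+ 2))
    + X' 0 * (G1 (X 0) * X' 0 + H1 (Y 0) * Y' 0)); last by ring.
  by rewrite E3 unitXY subrr !mulr0 addr0.
set w := _ - _ in E4 wE hE gE E2 *; exists w; split; [|exact: hE|exact: gE|].
  rewrite lt_neqAle E4 andbT eq_sym -sqrf_eq0 wE gt_eqF//.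
  have [_ _ _ /nbhs_singleton] := Hdef; rewrite XE YE; apply.
  exact: nbhs_singleton E0.
rewrite XE YE hE gE; apply: subr0_eq; rewrite (_ : _ - _ = w ^+ 2 *
  (G2 (X 0) * X' 0 ^+ 2 + H2 (Y 0) * Y' 0 ^+ 2 + k 0 * w)); last by ring.
by rewrite E2 mulr0.
Unshelve. all: by end_near. Qed.

Definition has_defining_function D p := exists th c G G1 G2 H H1 H2,
  defining D p th c G G1 G2 H H1 H2.

Lemma arc_unit_speed D p x y : boundary_arc D p x y ->
  derive1 x 0 ^+ 2 + derive1 y 0 ^+ 2 = 1.
Proof. by move=> [_ arc]; have [] := nbhs_singleton arc. Qed.

(** By [defining_arc], both [w^2] and [k w^3] depend on the defining function alone; since [w > 0],
    any arc has the same [k] as the one behind the choice. *)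
Lemma curvature_arc D p x y : has_defining_function D p -> boundary_arc D p x y ->
  curvature D p = arc_curvature x y 0.
Proof.
move=> [th [c [G [G1 [G2 [H [H1 [H2 Hdef]]]]]]]] arc.
have : [set k : R | exists x y, boundary_arc D p x y /\
    k = derive1 x 0 * derive1n 2 y 0 - derive1 y 0 * derive1n 2 x 0] (curvature D p).
  by apply: xgetPex; exists (arc_curvature x y 0), x, y.
move=> [x' [y' [arc' ->]]]; rewrite -/(arc_curvature x' y' 0).
have [w [w0 h1 g1 k1]] := defining_arc Hdef arc.
have [v [v0 h2 g2 k2]] := defining_arc Hdef arc'.
have u1 := arc_unit_speed arc; have u2 := arc_unit_speed arc'.
have sq (a b z : R) : a ^+ 2 + b ^+ 2 = 1 ->
    (z * (cos th * a + sin th * b)) ^+ 2 + (- (z * (- sin th * a + cos th * b))) ^+ 2 = z ^+ 2.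
  move=> ab; rewrite -[RHS]mulr1 -ab -[RHS]mul1r -(cos2Dsin2 th); ring.
have wv : v = w.
  apply/eqP; rewrite -(eqrXn2 (_ : 0 < 2)%N) ?ltW//.
  by rewrite -(sq _ _ v u2) -(sq _ _ w u1) -h1 -g1 -h2 -g2.
move: k2; rewrite wv -k1; move: (arc_curvature _ _ _) (arc_curvature _ _ _) => k k'.
have w3 : w ^+ 3 != 0 by rewrite gt_eqF// exprn_gt0.
by move/(mulIf w3).
Qed.

(** The arc is the one behind the choice in [dcurvature]. Along it, [curvature D (x s, y s)] is
    computed by the same arc restarted at [s], because a defining function at [p] also serves at
    nearby points. *)
Lemma dcurvature_arc D p : has_defining_function D p -> (exists x y, boundary_arc D p x y) ->
  exists x y, [/\ boundary_arc D p x y, curvature D p = arc_curvature x y 0 &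
    dcurvature D p = derive1 (arc_curvature x y) 0].
Proof.
move=> dfn [x [y arc]].
have : [set k : R | exists x y, boundary_arc D p x y /\
    k = derive1 (fun s : R => curvature D (x s, y s)) 0] (dcurvature D p).
  by apply: xgetPex; exists (derive1 (fun s : R => curvature D (x s, y s)) 0), x, y.
move=> [{arc}x [{}y [arc ->]]]; exists x, y; split; [exact: arc| |].
  exact: curvature_arc.
rewrite !derive1E; apply: near_eq_derive.
have [th [c [G [G1 [G2 [H [H1 [H2 Hdef]]]]]]]] := dfn.
have [p0 _] := arc.
have near_dfn : \forall s \near (0 : R), has_defining_function D (x s, y s).
  have /near_planeP[d d0 dP] := defining_near Hdef.
  have [dx dy _ _ _] := nbhs_singleton (arc_frenet arc).
  apply: filterS2 (derive_near dx d0) (derive_near dy d0) => s sx sy.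
  by exists th, c, G, G1, G2, H, H1, H2; apply: dP; rewrite -p0.
apply: filterS2 near_dfn (boundary_arc_shift arc) => s ds arcs.
rewrite (curvature_arc ds arcs) /arc_curvature !derive1_shift !derive1n_shift.
by rewrite add0r.
Qed.

Lemma smooth_boundary_defining D p : smooth_boundary D -> boundary D p -> has_defining_function D p.
Proof.
move=> sD /sD[th [g [sg HD]]].
exists th, (0, 0), (fun t => - g t), (fun t => - derive1 g t), (fun t => - derive1n 2 g t),
  id, (fun=> 1), (fun=> 0).
have c1 q : coord1 th (0, 0) q = (rotated th q).1 by rewrite /coord1 /= !subr0.
have c2 q : coord2 th (0, 0) q = (rotated th q).2 by rewrite /coord2 /= !subr0.
split.
- split=> t.
    exact: is_deriveN (derivable_is_derive1 (sg 0%N t)).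
  exact: is_deriveN (derivable_is_derive1 (sg 1%N t)).
- by split=> t; [exact: is_derive_id|exact: is_derive_cst].
- apply: filterS HD => q; rewrite c1 c2 => ->.
  by split; rewrite addrC subr_gt0.
- by near=> q => _; rewrite expr1n ltr_wpDl// sqr_ge0.
Unshelve. all: by end_near. Qed.

End defining_function.

(** * Ellipses *)

Section ellipse_area.
Variable R : realType.
Local Notation mu := (@lebesgue_measure R).

(** The integrand is the length of a vertical chord of an ellipse. As the square root of a negative
    number is 0, integrating over the line amounts to integrating over the shadow of the ellipse,
    where [x = c + t sqrt(al) sin th] is substituted. *)
Lemma integral_half_ellipse (c al t : R) : 0 < al -> 0 < t ->
  (\int[mu]_x (2 / al * Num.sqrt (al - ((x - c) / t) ^+ 2))%:E = (pi * t)%:E)%E.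
Proof.
move=> al0 t0.
pose S := t * Num.sqrt al.
have sal : 0 < Num.sqrt al by rewrite sqrtr_gt0.
have S0 : 0 < S by rewrite mulr_gt0.
pose F (th : R) : R := c + S * sin th.
pose g (x : R) : R := 2 / al * Num.sqrt (al - ((x - c) / t) ^+ 2).
have pi20 : - (pi / 2) < pi / 2 :> R by rewrite gtrN// divr_gt0// pi_gt0.
have Fa : F (- (pi / 2)) = c - S by rewrite /F sinN sin_pihalf mulrN mulr1.
have Fb : F (pi / 2) = c + S by rewrite /F sin_pihalf mulr1.
have dF (th : R) : is_derive th 1 F (S * cos th).
  by apply: is_derive_eq; rewrite /GRing.scale /=; ring.
have F'E : F^`() = fun th : R => S * cos th.
  by apply/funext => th; rewrite derive1E derive_val.
have cF : continuous F.
  by move=> x; apply: differentiable_continuous; apply/derivable1_diffP; case: (dF x).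
have cF' : continuous (fun th : R => S * cos th).
  by move=> x; apply: cvgM; [exact: cvg_cst|exact: continuous_cos].
have cg : continuous g.
  move=> x; apply: cvgM; first exact: cvg_cst.
  apply: (continuous_comp (f := fun x => al - ((x - c) / t) ^+ 2)); last exact: sqrt_continuous.
  apply: cvgB; first exact: cvg_cst.
  apply: (@cvgM _ _ _ _ (fun x => (x - c) / t) (fun x => (x - c) / t));
    by apply: cvgM; [apply: cvgB; [exact: cvg_id|exact: cvg_cst]|exact: cvg_cst].
transitivity (\int[mu]_(x in `[F (- (pi / 2))%R, F (pi / 2)%R]) (g x)%:E)%E.
  rewrite [RHS]integral_mkcond; apply: eq_integral => x _.
  rewrite patchE; case: ifPn => //; rewrite notin_setE /= in_itv /= Fa Fb => xS.
  rewrite ler0_sqrtr ?mulr0// subr_le0.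
  have -> : al = (S / t) ^+ 2 by rewrite /S mulrAC mulfV ?gt_eqF// mul1r sqr_sqrtr// ltW.
  rewrite !expr_div_n ler_pM2r ?invr_gt0 ?exprn_gt0//.
  have Sx : S <= `|x - c|.
    rewrite leNgt; apply/negP => xcS; apply: xS; move: xcS.
    by rewrite ltr_norml => /andP[? ?]; apply/andP; split; lra.
  by rewrite -[leRHS]real_normK ?num_real// lerXn2r ?nnegrE// ltW.
have incF : {in `[(- (pi / 2)), (pi / 2)]%R &, {homo F : x y / x < y}}.
  by move=> x y xI yI xy; rewrite /F ltrD2l ltr_pM2l// ltr_sin.
have cF'oo : {in `](- (pi / 2)), (pi / 2)[%R, continuous F^`()}.
  by move=> x _; rewrite F'E; exact: cF'.
have cF'l : cvg (F^`() x @[x --> (- (pi / 2))^'+]).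
  by apply/cvg_ex; eexists; rewrite F'E; apply/cvg_at_right_filter/cF'.
have cF'r : cvg (F^`() x @[x --> (pi / 2)^'-]).
  by apply/cvg_ex; eexists; rewrite F'E; apply/cvg_at_left_filter/cF'.
have FLR : derivable_oo_LRcontinuous F (- (pi / 2)) (pi / 2).
  split.
  + by move=> x _; case: (dF x).
  + exact/cvg_at_right_filter/cF.
  + exact/cvg_at_left_filter/cF.
apply: etrans (integration_by_substitution_increasing (ltW pi20) incF cF'oo
  cF'l cF'r FLR (continuous_subspaceT cg)) _.
pose P (th : R) : R := t * (th + sin th * cos th).
have dP (th : R) : is_derive th 1 P (t * (1 + (cos th ^+ 2 - sin th ^+ 2))).
  by apply: is_derive_eq; rewrite /GRing.scale /=; ring.
transitivity (\int[mu]_(x in `[(- (pi / 2))%R, (pi / 2)%R]) (2 * t * cos x ^+ 2)%:E)%E.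
  apply: eq_integral => x; rewrite inE /= in_itv /= => xI.
  congr EFin; rewrite fctE F'E /g /F /=.
  have cosx : 0 <= cos x by exact: cos_ge0_pihalf.
  rewrite (_ : al - _ = al * cos x ^+ 2); last first.
    rewrite (addrC c) addrK cos2sin2 mulrBr mulr1; congr (_ - _).
    rewrite /S -[in RHS](sqr_sqrtr (ltW al0)); field; rewrite gt_eqF//.
  rewrite sqrtrM ?(ltW al0)// sqrtr_sqr ger0_norm// /S.
  have := sqr_sqrtr (ltW al0); move: sal; move: (Num.sqrt al) => r r0 <-.
  field; rewrite gt_eqF//.
apply: etrans (@continuous_FTC2 _ _ P _ _ pi20 _ _ _) _.
- apply: continuous_subspaceT => x; apply: cvgM; first exact: cvg_cst.
  by apply: (@cvgM _ _ _ _ cos cos); exact: continuous_cos.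
- have cP : continuous P.
    by move=> x; apply: differentiable_continuous; apply/derivable1_diffP; case: (dP x).
  split.
  + by move=> x _; case: (dP x).
  + exact/cvg_at_right_filter/cP.
  + exact/cvg_at_left_filter/cP.
- by move=> x _; rewrite derive1E derive_val cos2sin2; ring.
by rewrite -EFinB; congr EFin; rewrite /P cosN cos_pihalf !mulr0 !addr0; field.
Qed.

End ellipse_area.

Section ellipse.
Variable R : realType.
Implicit Types (E : ellipse R) (p q : plane R).

(** For [z <= 0] both sides are false, the root being 0; vertical lines missing an ellipse thus give
    empty balls. *)
Lemma ltr_norm_sqrt (w z : R) : (`|w| < Num.sqrt z) = (w ^+ 2 < z).
Proof.
have [z0|z0] := ltP 0 z; first by rewrite -sqrtr_sqr ltr_sqrt.
rewrite ler0_sqrtr// !ltNge normr_ge0 /=; symmetry; apply/negbTE; rewrite negbK.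
by rewrite (le_trans z0)// sqr_ge0.
Qed.

(** Completing the square in the second coordinate: [al] is the coefficient of [y^2] in the form,
    [be] half that of [x y], and [(a b)^-2] the determinant. The section at [x] is then an interval
    of half-length [sqrt(Z) / al]. *)
Lemma area_ellipse E :
  area (ellipse_region E) = (pi * (semiaxis1 E * semiaxis2 E))%:E.
Proof.
have a0 := semiaxis1_gt0 E; have b0 := semiaxis2_gt0 E.
set a := semiaxis1 E in a0 *; set b := semiaxis2 E in b0 *.
pose cs := cos (tilt E); pose sn := sin (tilt E); pose c := ellipse_center E.
pose al := (sn / a) ^+ 2 + (cs / b) ^+ 2.
pose be := sn * cs * ((a ^+ 2)^-1 - (b ^+ 2)^-1).
have cssn : cs ^+ 2 + sn ^+ 2 = 1 by exact: cos2Dsin2.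
have al0 : 0 < al.
  rewrite lt_neqAle addr_ge0 ?sqr_ge0// andbT eq_sym paddr_eq0 ?sqr_ge0//.
  apply/negP => /andP[]; rewrite !sqrf_eq0 !mulf_eq0 !invr_eq0 (gt_eqF a0) (gt_eqF b0) !orbF.
  move=> /eqP s0 /eqP c0; move: cssn; rewrite s0 c0 expr0n /= addr0 => /eqP.
  by rewrite eq_sym oner_eq0.
have t0 : 0 < a * b by rewrite mulr_gt0.
rewrite -(integral_half_ellipse c.1 al0 t0) /area /product_measure1.
apply: eq_integral => x _ /=.
set Z := al - ((x - c.1) / (a * b)) ^+ 2.
rewrite (_ : xsection _ x = ball (c.2 - be * (x - c.1) / al) (Num.sqrt Z / al)).
  rewrite lebesgue_measure_ball; last by rewrite divr_ge0 ?sqrtr_ge0// ltW.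
  by congr EFin; rewrite mulr2n; field; rewrite gt_eqF.
have key (y : R) : Z - ((c.2 - be * (x - c.1) / al - y) * al) ^+ 2 =
    al * (1 - (((cs * (x - c.1) + sn * (y - c.2)) / a) ^+ 2 +
               ((- sn * (x - c.1) + cs * (y - c.2)) / b) ^+ 2)).
  have alE : (c.2 - be * (x - c.1) / al - y) * al = - (be * (x - c.1) + al * (y - c.2)).
    by field; rewrite gt_eqF.
  rewrite alE (_ : Z = al - ((x - c.1) / (a * b) * (cs ^+ 2 + sn ^+ 2)) ^+ 2); last first.
    by rewrite cssn mulr1.
  by rewrite /al /be; field; rewrite !gt_eqF.
apply/seteqP; split=> y; rewrite /xsection /= inE /ellipse_region /= /ellipse_form /rotated /=
  -ball_normE /= -/a -/b -/cs -/sn -/c ltr_pdivlMr// -{2}(gtr0_norm al0) -normrM ltr_norm_sqrt.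
  by rewrite -subr_gt0 => H; rewrite -subr_gt0 key pmulr_rgt0.
by rewrite -subr_gt0 key pmulr_rgt0// subr_gt0.
Qed.

(** Half the norm of the gradient of [ellipse_form]. *)
Definition ellipse_gradnorm E q : R :=
  Num.sqrt ((coord1 (tilt E) (ellipse_center E) q / semiaxis1 E ^+ 2) ^+ 2 +
            (coord2 (tilt E) (ellipse_center E) q / semiaxis2 E ^+ 2) ^+ 2).

Lemma ellipse_defining E p :
  let a := semiaxis1 E in let b := semiaxis2 E in
  defining (ellipse_region E) p (tilt E) (ellipse_center E)
    (fun t => 1 - (t / a) ^+ 2) (fun t => - (2 * t / a ^+ 2)) (fun=> - (2 / a ^+ 2))
    (fun t => - (t / b) ^+ 2) (fun t => - (2 * t / b ^+ 2)) (fun=> - (2 / b ^+ 2)).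
Proof.
move=> a b; have a0 : 0 < a := semiaxis1_gt0 E; have b0 : 0 < b := semiaxis2_gt0 E.
have d1 (k t : R) : is_derive t 1 (fun t : R => - (2 * t / k)) (- (2 / k)).
  by apply: is_derive_eq; rewrite /GRing.scale /=; ring.
have d2 (k t : R) : is_derive t 1 (fun t : R => - (t / k) ^+ 2) (- (2 * t / k ^+ 2)).
  by apply: is_derive_eq; rewrite /GRing.scale /= -exprVn; ring.
split.
- split=> t; last exact: d1.
  have d0 : is_derive t 1 (fun=> 1 : R) (0 : R) by exact: is_derive_cst.
  by apply: is_derive_eq (is_derive1D d0 (d2 a t)) _; rewrite add0r.
- by split=> t; [exact: d2|exact: d1].
- by near=> q; rewrite -addrA -opprD subr_gt0.
- near=> q => /eqP; rewrite -addrA -opprD subr_eq0 eq_sym => /eqP.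
  set X := coord1 _ _ _; set Y := coord2 _ _ _ => XY.
  rewrite lt_neqAle addr_ge0 ?sqr_ge0// andbT eq_sym paddr_eq0 ?sqr_ge0//.
  apply/negP => /andP[]; rewrite !sqrf_eq0 !oppr_eq0 !mulf_eq0 !invr_eq0 !expf_eq0 /=.
  rewrite (gt_eqF a0) (gt_eqF b0) pnatr_eq0 !orbF /= => /eqP X0 /eqP Y0.
  move: XY; rewrite X0 Y0 !mul0r !expr0n /= addr0 => /eqP.
  by rewrite eq_sym oner_eq0.
Unshelve. all: by end_near. Qed.

Lemma ellipse_has_defining_function E p : has_defining_function (ellipse_region E) p.
Proof. by do 8 eexists; exact: ellipse_defining. Qed.

(** The [w] of [defining_arc] is [2 r], and its second-order term is [8 (a b)^-2] times the
    left-hand side of the equation of the ellipse, that is, times 1. *)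
Lemma ellipse_arc E p x y : boundary_arc (ellipse_region E) p x y ->
  let a := semiaxis1 E in let b := semiaxis2 E in
  let th := tilt E in let c := ellipse_center E in
  let X := coord1 th c p in let Y := coord2 th c p in
  let r := ellipse_gradnorm E p in
  [/\ 0 < r, (X / a) ^+ 2 + (Y / b) ^+ 2 = 1 /\ r ^+ 2 = (X / a ^+ 2) ^+ 2 + (Y / b ^+ 2) ^+ 2,
    - Y / b ^+ 2 = r * (cos th * derive1 x 0 + sin th * derive1 y 0),
    X / a ^+ 2 = r * (- sin th * derive1 x 0 + cos th * derive1 y 0) &
    arc_curvature x y 0 * r ^+ 3 = (a * b) ^- 2].
Proof.
move=> arc a b th c X Y r.
have a0 : 0 < a := semiaxis1_gt0 E; have b0 : 0 < b := semiaxis2_gt0 E.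
have bp : boundary (ellipse_region E) p.
  by have [<- H] := arc; have [_ _ +] := nbhs_singleton H.
have dfn := ellipse_defining E p.
have := defining_boundary dfn bp; rewrite -/a -/b -/th -/c -/X -/Y => /eqP.
rewrite -addrA -opprD subr_eq0 eq_sym => /eqP XY.
have [w [w0 h1 g1 k1]] := defining_arc dfn arc.
move: h1 g1 k1; rewrite -/a -/b -/th -/c -/X -/Y.
have u := arc_unit_speed arc.
move: (arc_curvature x y 0) (derive1 x 0) (derive1 y 0) u => k x1 y1 u h1 g1 k1.
have r2 : r ^+ 2 = (X / a ^+ 2) ^+ 2 + (Y / b ^+ 2) ^+ 2.
  by rewrite sqr_sqrtr// addr_ge0// sqr_ge0.
have u' : (cos th * x1 + sin th * y1) ^+ 2 + (- sin th * x1 + cos th * y1) ^+ 2 = 1.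
  by rewrite -[RHS]u -[RHS]mul1r -(cos2Dsin2 th); ring.
have rE : r = w / 2.
  apply/eqP; rewrite -(eqrXn2 (_ : 0 < 2)%N) ?sqrtr_ge0 ?divr_ge0 ?ltW// r2.
  apply/eqP; rewrite -[RHS]mulr1 -[X in _ = _ * X]u'.
  rewrite [RHS](_ : _ = ((w * (cos th * x1 + sin th * y1)) ^+ 2 + (- (w * (- sin th * x1 + cos th * y1))) ^+ 2) / 4); last by field.
  by rewrite -h1 -g1; field; rewrite !gt_eqF.
split.
- by rewrite rE divr_gt0.
- by split; [exact: XY|exact: r2].
- by rewrite rE mulrAC -h1; field; rewrite gt_eqF.
- rewrite rE [RHS](_ : _ = - (- (w * (- sin th * x1 + cos th * y1))) / 2); last by field.
  by rewrite -g1; field; rewrite gt_eqF.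
- have -> : k * r ^+ 3 = k * w ^+ 3 / 8 by rewrite rE; field.
  by rewrite k1 -[RHS]mulr1 -[X in _ = _ * X]XY; field; rewrite !gt_eqF.
Qed.

(** The last hypothesis, the derivative of [K^2 r^6] along the ellipse, gives [dK]. With
    [s = (u / a)^2] and [P = s b^2 + (1 - s) a^2 = (a b)^2 r^2], the claim reduces to [P (a^2 + b^2
    - P) = (a b)^2 + s (1 - s) (a^2 - b^2)^2]. *)
Lemma ellipse_algebra (a b r K dK u v X Y : R) : 0 < a -> 0 < b -> 0 < r ->
  K * r ^+ 3 = (a * b) ^- 2 -> (u / a) ^+ 2 + (v / b) ^+ 2 = 1 ->
  r ^+ 2 = (u / a ^+ 2) ^+ 2 + (v / b ^+ 2) ^+ 2 ->
  - v / b ^+ 2 = r * X -> u / a ^+ 2 = r * Y ->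
  2 * K * dK * r ^+ 2 ^+ 3 +
    K ^+ 2 * (3 * r ^+ 2 ^+ 2 * (2 * (u * X / a ^+ 4 + v * Y / b ^+ 4))) = 0 ->
  K * (1 + dK ^+ 2 / (9 * K ^+ 4)) + r = (a ^+ 2 + b ^+ 2) / ((a * b) ^+ 2 * r).
Proof.
move=> a0 b0 r0 k3 uv r2 v1 u1 E1.
have an : a != 0 by rewrite gt_eqF.
have bn : b != 0 by rewrite gt_eqF.
have rn : r != 0 by rewrite gt_eqF.
have KE : K = ((a * b) ^+ 2 * r ^+ 3)^-1.
  by rewrite invfM -k3 mulfK// expf_neq0.
have XE : X = - v / (b ^+ 2 * r) by rewrite invfM mulrA v1 mulrC mulKf.
have YE : Y = u / (a ^+ 2 * r) by rewrite invfM mulrA u1 mulrC mulKf.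
have dKE : dK = - (3 * K * (u * v * (a ^+ 2 - b ^+ 2) / (r ^+ 3 * (a * b) ^+ 4))).
  have Kn : 2 * K * r ^+ 2 ^+ 3 != 0.
    by rewrite KE !mulf_neq0 ?pnatr_eq0 ?expf_neq0// invr_neq0// mulf_neq0 ?expf_neq0// mulf_neq0.
  apply: (mulfI Kn); apply: subr0_eq; rewrite -E1 XE YE KE; field.
  by rewrite an bn rn.
have W : dK ^+ 2 / (9 * K ^+ 4) = (u / a) ^+ 2 * (v / b) ^+ 2 * (a ^+ 2 - b ^+ 2) ^+ 2 / (a * b) ^+ 2.
  by rewrite dKE KE; field; rewrite an bn rn.
have nz : (a * b) ^+ 2 * r ^+ 3 != 0 by rewrite mulf_neq0 ?expf_neq0// mulf_neq0.
apply: (mulIf nz); rewrite W.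
rewrite [LHS](_ : _ = 1 + (u / a) ^+ 2 * (v / b) ^+ 2 * (a ^+ 2 - b ^+ 2) ^+ 2 / (a * b) ^+ 2
   + (a * b) ^+ 2 * (r ^+ 2) ^+ 2); last by rewrite KE; field; rewrite an bn rn.
rewrite [RHS](_ : _ = (a ^+ 2 + b ^+ 2) * r ^+ 2); last by field; rewrite an bn rn.
rewrite r2 (_ : (v / b ^+ 2) ^+ 2 = (v / b) ^+ 2 / b ^+ 2); last by field; rewrite bn.
rewrite (_ : (u / a ^+ 2) ^+ 2 = (u / a) ^+ 2 / a ^+ 2); last by field; rewrite an.
rewrite (_ : (v / b) ^+ 2 = 1 - (u / a) ^+ 2); last by rewrite -uv addrAC subrr add0r.
by field; rewrite an bn.
Qed.

(* The right-hand side is the inverse of the normal derivative of the torsion function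
   of [E]. *)
Lemma ellipse_curvature E p : (exists x y, boundary_arc (ellipse_region E) p x y) ->
  let a := semiaxis1 E in let b := semiaxis2 E in
  let K := curvature (ellipse_region E) p in
  let dK := dcurvature (ellipse_region E) p in
  let r := ellipse_gradnorm E p in
  [/\ 0 < r, K * r ^+ 3 = (a * b) ^- 2 &
    K * (1 + dK ^+ 2 / (9 * K ^+ 4)) + r = (a ^+ 2 + b ^+ 2) / ((a * b) ^+ 2 * r)].
Proof.
move=> arcs a b K dK r.
have a0 : 0 < a := semiaxis1_gt0 E; have b0 : 0 < b := semiaxis2_gt0 E.
have [x [y [arc]]] := dcurvature_arc (ellipse_has_defining_function E p) arcs.
rewrite -/K -/dK => KE dKE.
have [r0 [XY r2] Y1 X1 k3] := ellipse_arc arc.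
rewrite -/a -/b -/r -KE in r0 XY r2 Y1 X1 k3.
split; [exact: r0|exact: k3|].
set th := tilt E in XY r2 Y1 X1; set c := ellipse_center E in XY r2 Y1 X1.
pose X t := coord1 th c (x t, y t); pose Y t := coord2 th c (x t, y t).
have [p0 _] := arc.
have p1 : (x 0, y 0) = p by [].
pose rho t := (X t / a ^+ 2) ^+ 2 + (Y t / b ^+ 2) ^+ 2.
(* Squaring [K r^3 = (a b)^-2] replaces the square root in [r] by the polynomial [rho], which is
   easily differentiated along the arc. *)
have near_k : \forall s \near (0 : R), arc_curvature x y s ^+ 2 * rho s ^+ 3 = (a * b) ^- 4.
  apply: filterS (boundary_arc_shift arc) => s /ellipse_arc [_ [_ +] _ _].
  rewrite -/a -/b -/th -/c -/(X s) -/(Y s) -/(rho s) => <-.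
  rewrite /arc_curvature !derive1_shift !derive1n_shift add0r => k3'.
  rewrite -/(arc_curvature x y s) in k3' *.
  rewrite (_ : (a * b) ^- 4 = ((a * b) ^- 2) ^+ 2); last by field; rewrite !gt_eqF.
  by rewrite -k3'; ring.
have [dx dy _ _ dk] := nbhs_singleton (arc_frenet arc).
move: dk near_k; rewrite -dKE.
have k0 : arc_curvature x y 0 = K by [].
move: (arc_curvature x y) k0 => k k0 dk near_k.
move: dx dy Y1 X1; move: (derive1 x 0) (derive1 y 0) => x1 y1 dx dy Y1 X1.
have dX : is_derive (0 : R) 1 X (cos th * x1 + sin th * y1).
  by apply: (has_grad_curve (@has_grad_coord1 R setT th c _) dx dy); exact: filterT.
have dY : is_derive (0 : R) 1 Y (- sin th * x1 + cos th * y1).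
  by apply: (has_grad_curve (@has_grad_coord2 R setT th c _) dx dy); exact: filterT.
move: dX dY Y1 X1; move: (cos th * x1 + sin th * y1) (- sin th * x1 + cos th * y1).
move=> X' Y' dX dY Y1 X1.
have := is_derive_near_cst _ near_k.
have drho : is_derive (0 : R) 1 rho (2 * (X 0 * X' / a ^+ 4 + Y 0 * Y' / b ^+ 4)).
  have dXX := is_derive1Z (a ^- 4) (is_derive1M dX dX).
  have dYY := is_derive1Z (b ^- 4) (is_derive1M dY dY).
  rewrite (_ : rho = fun t => a ^- 4 * (X t * X t) + b ^- 4 * (Y t * Y t)); last first.
    by apply/funext => t; rewrite /rho; field; rewrite !gt_eqF.
  by apply: is_derive_eq (is_derive1D dXX dYY) _; field; rewrite !gt_eqF.
have dkr := is_derive1M (is_derive1M dk dk) (is_derive1M drho (is_derive1M drho drho)).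
have {dkr} : is_derive (0 : R) 1 (fun t => k t ^+ 2 * rho t ^+ 3)
    (2 * k 0 * dK * rho 0 ^+ 3 + k 0 ^+ 2 * (3 * rho 0 ^+ 2 * (2 * (X 0 * X' / a ^+ 4 + Y 0 * Y' / b ^+ 4)))).
  rewrite (_ : (fun t => k t ^+ 2 * rho t ^+ 3) = (fun t => k t * k t * (rho t * (rho t * rho t)))); last first.
    by apply/funext => t; ring.
  by apply: is_derive_eq dkr _; ring.
move=> dkr /(_ _ dkr).
have -> : X 0 = coord1 th c p by rewrite -p0.
have -> : Y 0 = coord2 th c p by rewrite -p0.
have -> : rho 0 = r ^+ 2 by rewrite r2 /rho /X /Y p0.
rewrite k0.
move: (coord1 th c p) (coord2 th c p) XY r2 Y1 X1 => u v uv r2 v1 u1 E1.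
exact: ellipse_algebra E1.
Qed.

(** From [A = pi a b] and [K r^3 = (a b)^-2], the area term times [K] is
    [(a b)^(-2/3) K^(-1/3) = r], the extra summand of [ellipse_curvature]. *)
Lemma ellipse_condition_lhs E p (A : R) : (exists x y, boundary_arc (ellipse_region E) p x y) ->
  area (ellipse_region E) = A%:E ->
  let a := semiaxis1 E in let b := semiaxis2 E in
  let K := curvature (ellipse_region E) p in
  let dK := dcurvature (ellipse_region E) p in
  K * (pi `^ (2 / 3) / (A `^ (2 / 3) * K `^ (4 / 3)) + 1 + dK ^+ 2 / (9 * K ^+ 4)) =
  (a ^+ 2 + b ^+ 2) / ((a * b) ^+ 2 * ellipse_gradnorm E p).
Proof.
move=> arcs + a b K dK; rewrite area_ellipse -/a -/b => -[<-].
have a0 : 0 < a := semiaxis1_gt0 E; have b0 : 0 < b := semiaxis2_gt0 E.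
have [r0 k3 <-] := ellipse_curvature arcs; rewrite -/a -/b -/K -/dK in k3 *.
set r := ellipse_gradnorm E p in r0 k3 *.
have KE : K = ((a * b) ^+ 2)^-1 * r^-1 ^+ 3.
  by rewrite -k3 exprVn mulfK// expf_neq0// gt_eqF.
have K0 : 0 < K by rewrite KE mulr_gt0// ?invr_gt0 ?exprn_gt0// ?invr_gt0// mulr_gt0.
have ab0 : 0 < a * b by rewrite mulr_gt0.
rewrite -(addrA _ 1) mulrDr [RHS]addrC; congr (_ + _).
rewrite powRM ?pi_ge0 ?ltW// (_ : 4 / 3 = 1 + 1 / 3 :> R); last by field.
rewrite powRD; last by rewrite (gt_eqF K0) implybT.
rewrite powRr1 ?(ltW K0)// (powRrM (a * b)) powR_mulrn ?(ltW ab0)//.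
have p0 : 0 < pi `^ (2 / 3) :> R by rewrite powR_gt0// pi_gt0.
have c0 : 0 < ((a * b) ^+ 2) `^ (3^-1) by rewrite powR_gt0// exprn_gt0.
have d0 : 0 < K `^ (1 / 3) by rewrite powR_gt0.
have cd : ((a * b) ^+ 2) `^ (3^-1) * K `^ (1 / 3) = r^-1.
  rewrite div1r -powRM ?(ltW K0) ?exprn_ge0 ?(ltW ab0)//.
  rewrite KE mulrA mulfV ?mul1r; last by rewrite expf_neq0// gt_eqF.
  by rewrite -powR_mulrn ?invr_ge0 ?ltW// -powRrM mulfV ?powRr1// ?invr_ge0 ?ltW.
rewrite -[RHS]invrK -cd; move: p0 c0 d0 => {cd}.
move: (pi `^ _) (_ `^ 3^-1) (K `^ (1 / 3)) => P C Q p0 c0 d0.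
by field; rewrite !gt_eqF.
Qed.

End ellipse.

(** * Solutions smooth up to the boundary *)

Section extension.
Variable R : realType.
Implicit Types (p q : plane R) (C D : set (plane R)) (F G : plane R -> R).

Lemma within_comp C F (g : R -> R) : continuous g -> {within C, continuous F} ->
  {within C, continuous (fun q => g (F q))}.
Proof.
move=> cg /subspace_continuousP cF; apply/subspace_continuousP => q Cq.
exact: cvg_comp (cF q Cq) (cg (F q)).
Qed.

Lemma closure_eq D F G : {within closure D, continuous F} -> {within closure D, continuous G} ->
  (forall q, D q -> F q = G q) -> forall q, closure D q -> F q = G q.
Proof.
move=> cF cG FG q Dq.
have H F1 G1 : {within closure D, continuous F1} -> {within closure D, continuous G1} ->
    (forall q, D q -> F1 q = G1 q) -> F1 q - G1 q <= 0.
  move=> cF1 cG1 FG1; apply: (closure_le openT (within_add cF1 (within_opp cG1)) _ Dq Logic.I).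
  by move=> z Dz _; rewrite FG1// subrr.
have A := H _ _ cF cG FG; have B := H _ _ cG cF (fun z Dz => esym (FG z Dz)).
by apply: le_anti; apply/andP; split; lra.
Qed.

Lemma has_grad_unique D F (a b a' b' : R) p : open D -> D p ->
  has_grad D F a b p -> has_grad D F a' b' p -> a = a' /\ b = b'.
Proof.
move=> oD Dp H H'.
have uniq (v : plane R) : a * v.1 + b * v.2 = a' * v.1 + b' * v.2.
  have [_ E1] := has_grad_dir v oD Dp H; have [_ E2] := has_grad_dir v oD Dp H'.
  exact: etrans (esym E1) E2.
have /= := uniq (1, 0); have /= := uniq (0, 1).
by rewrite !mulr1 !mulr0 !addr0 !add0r => -> ->.
Qed.

(** The head of a list is the last derivative taken. Two adjacent derivatives commute behind any
    prefix [m]: functions equal on the open [D] have equal gradients there, which adds one letter to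
    [m], and continuity carries the equality to the closure. *)
Lemma smooth_on_closure_extension D (u : plane R -> R) :
  open D -> convex_set (D : set (convex_lmodType (plane R))) -> smooth_on_closure D u ->
  exists U : seq bool -> plane R -> R,
  [/\ U [::] = u, (forall l, {within closure D, continuous (U l)}),
    (forall l p, D p -> U l p = partials l u p),
    (forall l p, closure D p ->
       has_grad (closure D) (U l) (U (false :: l) p) (U (true :: l) p) p) &
    (forall m l p, closure D p -> U (m ++ [:: true, false & l]) p = U (m ++ [:: false, true & l]) p)].
Proof.
move=> oD cvD [su cu /choice[W HW]].
(* The given extension [W [::]] is only known to agree with [u] on [D], while the conclusion
   concerns [u] itself. *)
pose U l := if l is [::] then u else W l.
have cU l : {within closure D, continuous (U l)} by case: l => [//|i l]; case: (HW (i :: l)).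
have DU l p : D p -> U l p = partials l u p by case: l => [//|i l]; case: (HW (i :: l)) => _; exact.
have dF l p : D p -> is_derive p (1, 0) (partials l u) (partials (false :: l) u p).
  by move=> Dp; have [_ /(_ false) /= H] := su l p Dp; apply: (DeriveDef H).
have dT l p : D p -> is_derive p (0, 1) (partials l u) (partials (true :: l) u p).
  by move=> Dp; have [_ /(_ true) /= H] := su l p Dp; apply: (DeriveDef H).
have grad0 l p : D p ->
    has_grad setT (partials l u) (partials (false :: l) u p) (partials (true :: l) u p) p.
  move=> Dp; apply: (C1_has_grad oD Dp (dF l) (dT l)).
  by have [] := su (false :: l) p Dp.
have gradD l p : D p -> has_grad D (U l) (U (false :: l) p) (U (true :: l) p) p.
  move=> Dp; rewrite !(DU (_ :: _))//.
  apply: (@has_grad_ext _ _ (partials l u)) => //.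
    by move=> q; rewrite inE => Dq; rewrite DU.
  exact: has_grad_sub (grad0 l p Dp).
have sym0 l p : D p -> partials [:: true, false & l] u p = partials [:: false, true & l] u p.
  move=> Dp; exact: (young oD Dp (dF l) (dT l) (grad0 (false :: l) p Dp) (grad0 (true :: l) p Dp)).
exists U; split => //.
  move=> l p Dp; exact: (closure_has_grad oD cvD (cU _) (cU _) (cU _) (gradD l)).
elim=> [|i m IH] l p Dp.
  apply: (closure_eq (cU _) (cU _) _ Dp) => q Dq.
  exact: etrans (DU _ _ Dq) (etrans (sym0 l q Dq) (esym (DU _ _ Dq))).
apply: (closure_eq (cU _) (cU _) _ Dp) => q Dq.
have E z : D z -> U (m ++ [:: true, false & l]) z = U (m ++ [:: false, true & l]) z.
  by move=> Dz; apply: IH; exact: subset_closure.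
have H : has_grad D (U (m ++ [:: false, true & l])) (U (false :: m ++ [:: true, false & l]) q)
    (U (true :: m ++ [:: true, false & l]) q) q.
  apply: (@has_grad_ext _ _ (U (m ++ [:: true, false & l]))) (gradD _ _ Dq) => //.
  by move=> z; rewrite inE => /E.
have [A B] := has_grad_unique oD Dq H (gradD _ _ Dq).
by case: i; rewrite ?cat_cons.
Qed.

End extension.

(** * The differentiated equation and the maximum principle for [u_ee] *)

Section concavity.
Context (R : realType).
Implicit Types (p q : plane R) (C D : set (plane R)) (F G : plane R -> R).

Lemma has_grad_partials D F (a b : R) p : open D -> D p -> has_grad (closure D) F a b p ->
  is_derive p (1, 0) F a /\ is_derive p (0, 1) F b.
Proof.
move=> oD Dp /(has_grad_sub (@subset_closure _ D)) H.
split.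
  by apply: is_derive_eq (has_grad_dir (1, 0) oD Dp H) _; rewrite /= mulr1 mulr0 addr0.
by apply: is_derive_eq (has_grad_dir (0, 1) oD Dp H) _; rewrite /= mulr1 mulr0 add0r.
Qed.

Definition quadratic (e1 e2 : R) (A B C : plane R -> R) (q : plane R) : R :=
  e1 * e1 * A q + 2 * e1 * e2 * B q + e2 * e2 * C q.

Lemma has_grad_quadratic S (e1 e2 : R) (A A1 A2 B B1 B2 C C1 C2 : plane R -> R) p :
  has_grad S A (A1 p) (A2 p) p -> has_grad S B (B1 p) (B2 p) p ->
  has_grad S C (C1 p) (C2 p) p ->
  has_grad S (quadratic e1 e2 A B C) (quadratic e1 e2 A1 B1 C1 p) (quadratic e1 e2 A2 B2 C2 p) p.
Proof.
move=> HA HB HC.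
exact: has_gradD (has_gradD (has_gradZ _ HA) (has_gradZ _ HB)) (has_gradZ _ HC).
Qed.

Lemma within_quadratic S (e1 e2 : R) (A B C : plane R -> R) :
  {within S, continuous A} -> {within S, continuous B} -> {within S, continuous C} ->
  {within S, continuous (quadratic e1 e2 A B C)}.
Proof.
by move=> cA cB cC; apply: within_add; [apply: within_add|]; apply: within_mul => //;
  exact: within_cst.
Qed.

Record extension_data D (U : seq bool -> plane R -> R) := ExtensionData {
  ext_within : forall l, {within closure D, continuous (U l)};
  ext_grad : forall l p, closure D p ->
       has_grad (closure D) (U l) (U (false :: l) p) (U (true :: l) p) p;
  ext_sym : forall m l p, closure D p ->
    U (m ++ [:: true, false & l]) p = U (m ++ [:: false, true & l]) p }.

Arguments ext_within {D U} _ l.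
Arguments ext_grad {D U} _ l {p}.
Arguments ext_sym {D U} _ m l {p}.

Section pde.
Variables (D : set (plane R)) (U : seq bool -> plane R -> R) (f f1 f2 : R -> R).
Hypotheses (oD : open D) (EU : extension_data D U).
Hypotheses (df : forall t : R, is_derive t 1 f (f1 t)) (df1 : forall t : R, is_derive t 1 f1 (f2 t)).
Hypothesis eqD : forall p, D p -> U [:: false; false] p + U [:: true; true] p = - f (U [::] p).

Let u := U [::].
Local Notation F := false.
Local Notation T := true.

Lemma derive_continuous (g g1 : R -> R) : (forall t : R, is_derive t 1 g (g1 t)) -> continuous g.
Proof.
move=> dg x; apply: differentiable_continuous; apply/derivable1_diffP.
by case: (dg x).
Qed.

Lemma pde_closure p : closure D p -> U [:: F; F] p + U [:: T; T] p = - f (u p).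
Proof.
have cf : {within closure D, continuous (fun q => - f (u q))}.
  apply: (@within_opp _ _ (fun q => f (u q))).
  exact: (within_comp (derive_continuous df) (ext_within EU [::])).
exact: (closure_eq (within_add (ext_within EU _) (ext_within EU _)) cf eqD).
Qed.

Lemma pde_grad p : closure D p ->
  U [:: F; F; F] p + U [:: F; T; T] p = - (f1 (u p) * U [:: F] p) /\
  U [:: T; F; F] p + U [:: T; T; T] p = - (f1 (u p) * U [:: T] p).
Proof.
have onD q : D q ->
    U [:: F; F; F] q + U [:: F; T; T] q = - (f1 (u q) * U [:: F] q) /\
    U [:: T; F; F] q + U [:: T; T; T] q = - (f1 (u q) * U [:: T] q).
  move=> Dq; have Cq := @subset_closure _ D _ Dq.
  have H0 := has_grad_sub (@subset_closure _ D)
    (has_gradD (ext_grad EU [:: F; F] Cq) (ext_grad EU [:: T; T] Cq)).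
  have H2 : has_grad D (fun q => -1 * f (u q)) (U [:: F; F; F] q + U [:: F; T; T] q)
      (U [:: T; F; F] q + U [:: T; T; T] q) q.
    by apply: (has_grad_ext _ Dq H0) => z; rewrite inE => /eqD ->; rewrite mulN1r.
  have H1 := has_grad_sub (@subset_closure _ D)
    (has_gradZ (-1) (has_grad_comp (df (u q)) (ext_grad EU [::] Cq))).
  have [-> ->] := has_grad_unique oD Dq H2 H1.
  by rewrite !mulN1r.
have c1 : {within closure D, continuous (fun q => f1 (u q))}.
  exact: (within_comp (derive_continuous df1) (ext_within EU [::])).
have ct i : {within closure D, continuous (fun q => - (f1 (u q) * U [:: i] q))}.
  apply: (@within_opp _ _ (fun q => f1 (u q) * U [:: i] q)).
  exact: within_mul c1 (ext_within EU [:: i]).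
move=> Cp; split.
  apply: (closure_eq (within_add (ext_within EU _) (ext_within EU _)) (ct F) _ Cp) => q Dq.
  by have [] := onD q Dq.
apply: (closure_eq (within_add (ext_within EU _) (ext_within EU _)) (ct T) _ Cp) => q Dq.
by have [] := onD q Dq.
Qed.

Lemma pde_hessian p : D p ->
  [/\ U [:: F; F; F; F] p + U [:: F; F; T; T] p =
        - (f2 (u p) * U [:: F] p * U [:: F] p + f1 (u p) * U [:: F; F] p),
      U [:: T; F; F; F] p + U [:: T; F; T; T] p =
        - (f2 (u p) * U [:: T] p * U [:: F] p + f1 (u p) * U [:: T; F] p) &
      U [:: T; T; F; F] p + U [:: T; T; T; T] p =
        - (f2 (u p) * U [:: T] p * U [:: T] p + f1 (u p) * U [:: T; T] p)].
Proof.
move=> Dp; have Cp := @subset_closure _ D _ Dp.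
have grad i : has_grad (closure D) (fun q => -1 * (f1 (u q) * U [:: i] q))
    (-1 * (f2 (u p) * U [:: F] p * U [:: i] p + f1 (u p) * U [:: F; i] p))
    (-1 * (f2 (u p) * U [:: T] p * U [:: i] p + f1 (u p) * U [:: T; i] p)) p.
  apply: has_gradZ; apply: has_gradM; last exact: ext_grad.
  exact: has_grad_comp (df1 _) (ext_grad EU _ Cp).
have grad' i : has_grad (closure D) (fun q => U [:: i; F; F] q + U [:: i; T; T] q)
    (U [:: F; i; F; F] p + U [:: F; i; T; T] p) (U [:: T; i; F; F] p + U [:: T; i; T; T] p) p.
  by apply: has_gradD; exact: ext_grad.
have E i q : closure D q -> U [:: i; F; F] q + U [:: i; T; T] q = -1 * (f1 (u q) * U [:: i] q).
  by move=> /pde_grad[A B]; case: i; rewrite mulN1r.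
have grad2 i : has_grad D (fun q => -1 * (f1 (u q) * U [:: i] q))
    (U [:: F; i; F; F] p + U [:: F; i; T; T] p) (U [:: T; i; F; F] p + U [:: T; i; T; T] p) p.
  apply: (has_grad_ext _ Dp (has_grad_sub (@subset_closure _ D) (grad' i))).
  by move=> q; rewrite inE => Dq; rewrite E//; exact: subset_closure.
have uni i := has_grad_unique oD Dp (grad2 i) (has_grad_sub (@subset_closure _ D) (grad i)).
have [A1 A2] := uni F; have [_ B2] := uni T.
by rewrite A1 A2 B2 !mulN1r.
Qed.

Definition hessian_form (e1 e2 : R) := quadratic e1 e2 (U [:: F; F]) (U [:: T; F]) (U [:: T; T]).

(** Where [u_ee > c >= 0], its Laplacian [- f'(u) u_ee - f''(u) u_e^2] is nonnegative. Used with
    [c = M] at the boundary maximum, and with [c = 0] to conclude. *)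
Lemma hessian_form_max (e1 e2 c : R) : bounded_set D -> 0 <= c ->
  (forall p, D p -> f1 (u p) <= 0 /\ f2 (u p) <= 0) ->
  (forall p, boundary D p -> hessian_form e1 e2 p <= c) ->
  forall p, closure D p -> hessian_form e1 e2 p <= c.
Proof.
move=> bD c0 f12 bnd.
pose w i := quadratic e1 e2 (U [:: i; F; F]) (U [:: i; T; F]) (U [:: i; T; T]).
pose w2 i := quadratic e1 e2 (U [:: i; i; F; F]) (U [:: i; i; T; F]) (U [:: i; i; T; T]).
apply: (weak_maximum_principle (w1 := w F) (w2 := w T) (w11 := w2 F) (w22 := w2 T) oD bD _ _ _ bnd).
- by apply: within_quadratic; exact: ext_within.
- move=> p Dp; have Cp := @subset_closure _ D _ Dp.
  have g0 := has_grad_quadratic e1 e2 (ext_grad EU [:: F; F] Cp) (ext_grad EU [:: T; F] Cp)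
    (ext_grad EU [:: T; T] Cp).
  have g1 i := has_grad_quadratic e1 e2 (ext_grad EU [:: i; F; F] Cp) (ext_grad EU [:: i; T; F] Cp)
    (ext_grad EU [:: i; T; T] Cp).
  have [a b] := has_grad_partials oD Dp g0.
  have [c1 _] := has_grad_partials oD Dp (g1 F).
  have [_ d1] := has_grad_partials oD Dp (g1 T).
  by split.
- move=> p Dp cw; have Cp := @subset_closure _ D _ Dp.
  have [A B C] := pde_hessian Dp.
  have [fa fb] := f12 p Dp.
  (* Fourth derivatives are permuted so that the Laplacian is taken first, where the equation
     differentiated twice applies. *)
  have s1 : U [:: F; F; T; T] p = U [:: T; T; F; F] p.
    rewrite -(ext_sym EU [:: F] [:: T] Cp) -(ext_sym EU [::] [:: F; T] Cp) /=.
    by rewrite -(ext_sym EU [:: T; F] [::] Cp) -(ext_sym EU [:: T] [:: F] Cp).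
  have s2 : U [:: F; F; T; F] p = U [:: T; F; F; F] p.
    by rewrite -(ext_sym EU [:: F] [:: F] Cp) -(ext_sym EU [::] [:: F; F] Cp).
  have s3 : U [:: T; T; T; F] p = U [:: T; F; T; T] p.
    by rewrite (ext_sym EU [:: T; T] [::] Cp) (ext_sym EU [:: T] [:: T] Cp).
  have -> : w2 F p + w2 T p = - (f1 (u p) * hessian_form e1 e2 p) -
     f2 (u p) * (e1 * U [:: F] p + e2 * U [:: T] p) ^+ 2.
    rewrite /w2 /hessian_form /quadratic.
    transitivity (e1 * e1 * (U [:: F; F; F; F] p + U [:: F; F; T; T] p)
      + 2 * e1 * e2 * (U [:: T; F; F; F] p + U [:: T; F; T; T] p)
      + e2 * e2 * (U [:: T; T; F; F] p + U [:: T; T; T; T] p)).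
      by rewrite s1 s2 s3; ring.
    by rewrite A B C; ring.
  rewrite addr_ge0// -mulNr; apply: mulr_ge0; rewrite ?sqr_ge0 ?oppr_ge0//.
  exact: le_trans c0 (ltW cw).
Qed.

End pde.
End concavity.
Arguments ext_within {R D U} _ l.
Arguments ext_grad {R D U} _ l {p}.
Arguments ext_sym {R D U} _ m l {p}.

(** * The Hessian at the boundary *)

Section algebra.
Variable R : realType.

(** The larger root of the characteristic polynomial of the symmetric matrix with rows [(A, B)] and
    [(B, C)]. The closed form makes continuity in the entries immediate. *)
Definition top_eigenvalue (A B C : R) : R :=
  (A + C) / 2 + Num.sqrt (((A - C) / 2) ^+ 2 + B ^+ 2).

(** Cauchy-Schwarz for [((A - C) / 2, B)] and [(x^2 - y^2, 2 x y)], the latter having norm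
    [x^2 + y^2]. *)
Lemma top_eigenvalue_bound (A B C x y : R) :
  A * x * x + 2 * B * x * y + C * y * y <= top_eigenvalue A B C * (x * x + y * y).
Proof.
rewrite /top_eigenvalue; set P := (A - C) / 2; set r := Num.sqrt _.
have r0 : 0 <= r by rewrite sqrtr_ge0.
have r2 : r ^+ 2 = P ^+ 2 + B ^+ 2 by rewrite sqr_sqrtr// addr_ge0// sqr_ge0.
have n0 : 0 <= x * x + y * y by rewrite addr_ge0// -expr2 sqr_ge0.
suff : P * (x * x - y * y) + B * (2 * x * y) <= r * (x * x + y * y).
  by rewrite /P; lra.
apply: le_trans (ler_norm _) _.
rewrite -(ler_pXn2r (_ : 0 < 2)%N) ?nnegrE ?mulr_ge0// real_normK ?num_real//.
rewrite exprMn r2 -subr_ge0.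
rewrite (_ : _ - _ = (P * (2 * x * y) - B * (x * x - y * y)) ^+ 2); last by ring.
exact: sqr_ge0.
Qed.

(** The vector [(l - C, B)] is an eigenvector because [(l - A) (l - C) = B^2]; when it is zero,
    [(0, 1)] serves. *)
Lemma top_eigenvector (A B C : R) : exists x y : R,
  [/\ x ^+ 2 + y ^+ 2 = 1, A * x + B * y = top_eigenvalue A B C * x &
    B * x + C * y = top_eigenvalue A B C * y].
Proof.
set l := top_eigenvalue A B C.
have lE : (l - A) * (l - C) = B ^+ 2.
  rewrite /l /top_eigenvalue; set r := Num.sqrt _.
  have r2 : r ^+ 2 = ((A - C) / 2) ^+ 2 + B ^+ 2.
    by rewrite sqr_sqrtr// addr_ge0// sqr_ge0.
  have -> : B ^+ 2 = r ^+ 2 - ((A - C) / 2) ^+ 2 by rewrite r2; ring.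
  by field.
have [n0|n0] := eqVneq ((l - C) ^+ 2 + B ^+ 2) 0.
  have : (l - C) ^+ 2 == 0 /\ B ^+ 2 == 0.
    by apply/andP; rewrite -paddr_eq0 ?sqr_ge0//; apply/eqP.
  rewrite !sqrf_eq0 subr_eq0 => -[/eqP lC /eqP B0].
  by exists 0, 1; rewrite B0 -lC; split; ring.
set n := Num.sqrt ((l - C) ^+ 2 + B ^+ 2).
have n2 : n ^+ 2 = (l - C) ^+ 2 + B ^+ 2 by rewrite sqr_sqrtr// addr_ge0// sqr_ge0.
have nn0 : n != 0 by rewrite -sqrf_eq0 n2.
exists ((l - C) / n), (B / n); split.
- by rewrite !expr_div_n -mulrDl -n2 mulfV// expf_neq0.
- apply: subr0_eq; rewrite (_ : _ - _ = (B ^+ 2 - (l - A) * (l - C)) / n); last by ring.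
  by rewrite lE subrr mul0r.
- by ring.
Qed.

(* [(t1, t2)] and [(-t2, t1)] are the tangent and the inner normal, [e] is the top
   eigenvector of the Hessian [H], and the gradient of [H(e,e)] is [-m] times the
   inner normal with [m >= 0].  In the frame [(e, J e)] one finds
   [u_TTT = sb * cb * (2 m cb^2 + 2 sb^2 (m - f' v))] and [H(T,N) = sb * cb * (1 + 2 M)],
   of the same sign, so that [u_TTT + 3 K H(T,N) + K' v = 0] bounds [H(T,N)] by
   [K' v / 3 K]; then [det H >= 0], against [det H = - M (1 + M)]. *)
Lemma boundary_eigenvalue_nonpos
    (t1 t2 e1 e2 M u1 u2 u11 u12 u22 u111 u112 u122 u222 k k' fp : R) :
  let v := u2 * t1 - u1 * t2 in
  let w1 := u111 * e1 * e1 + 2 * u112 * e1 * e2 + u122 * e2 * e2 in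
  let w2 := u112 * e1 * e1 + 2 * u122 * e1 * e2 + u222 * e2 * e2 in
  t1 ^+ 2 + t2 ^+ 2 = 1 -> e1 ^+ 2 + e2 ^+ 2 = 1 ->
  u11 * e1 + u12 * e2 = M * e1 -> u12 * e1 + u22 * e2 = M * e2 ->
  u11 + u22 = -1 -> u111 + u122 = - (fp * u1) -> u112 + u222 = - (fp * u2) ->
  fp <= 0 -> 0 <= v -> 0 < k -> v * (k * (1 + k' ^+ 2 / (9 * k ^+ 4))) <= 1 ->
  u1 * t1 + u2 * t2 = 0 ->
  u11 * t1 * t1 + 2 * u12 * t1 * t2 + u22 * t2 * t2 + k * v = 0 ->
  u111 * t1 * t1 * t1 + 3 * u112 * t1 * t1 * t2 + 3 * u122 * t1 * t2 * t2
    + u222 * t2 * t2 * t2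
    + 3 * k * (- u11 * t1 * t2 + u12 * (t1 * t1 - t2 * t2) + u22 * t1 * t2)
    + k' * v = 0 ->
  w1 * t1 + w2 * t2 = 0 -> w2 * t1 - w1 * t2 <= 0 -> M <= 0.
Proof.
move=> v w1 w2 tt ee H1 H2 tr tr1 tr2 fp0 v0 k0 cond g0 R2 R3 wt wn.
rewrite leNgt; apply/negP => M0.
pose cb := e1 * t1 + e2 * t2; pose sb := e2 * t1 - e1 * t2.
pose m := w1 * t2 - w2 * t1.
have m0 : 0 <= m by rewrite /m; lra.
have t1E : t1 = cb * e1 + sb * e2.
  by rewrite -[LHS]mulr1 -[X in _ * X = _]ee /cb /sb; ring.
have t2E : t2 = cb * e2 - sb * e1.
  by rewrite -[LHS]mulr1 -[X in _ * X = _]ee /cb /sb; ring.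
have w1E : w1 = m * t2.
  apply: subr0_eq; rewrite (_ : _ - _ = w1 * (1 - (t1 ^+ 2 + t2 ^+ 2)) + t1 * (w1 * t1 + w2 * t2)).
    by rewrite tt wt subrr !mulr0 addr0.
  by rewrite /m; ring.
have w2E : w2 = - (m * t1).
  apply: subr0_eq; rewrite (_ : _ - _ = w2 * (1 - (t1 ^+ 2 + t2 ^+ 2)) + t2 * (w1 * t1 + w2 * t2)).
    by rewrite tt wt subrr !mulr0 addr0.
  by rewrite /m; ring.
have u1E : u1 = - (v * t2).
  apply: subr0_eq; rewrite (_ : _ - _ = u1 * (1 - (t1 ^+ 2 + t2 ^+ 2)) + t1 * (u1 * t1 + u2 * t2)).
    by rewrite tt g0 subrr !mulr0 addr0.
  by rewrite /v; ring.
have u2E : u2 = v * t1.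
  apply: subr0_eq; rewrite (_ : _ - _ = u2 * (1 - (t1 ^+ 2 + t2 ^+ 2)) + t2 * (u1 * t1 + u2 * t2)).
    by rewrite tt g0 subrr !mulr0 addr0.
  by rewrite /v; ring.
have cs1 : cb ^+ 2 + sb ^+ 2 = 1.
  rewrite (_ : _ + _ = (e1 ^+ 2 + e2 ^+ 2) * (t1 ^+ 2 + t2 ^+ 2)); last by rewrite /cb /sb; ring.
  by rewrite ee tt mulr1.
(* With [h = (- e2, e1)] one has [T = cb e - sb h], and [d1] to [d4] are [D^3 u] on [(e,e,e)],
   [(e,e,h)], [(e,h,h)], [(h,h,h)]. The gradient of [u_ee] gives [d1] and [d2]; the differentiated
   equation gives [d1 + d3] and [d2 + d4]. *)
pose d1 := w1 * e1 + w2 * e2; pose d2 := w2 * e1 - w1 * e2.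
have d1E : d1 = - (m * sb) by rewrite /d1 w1E w2E /sb; ring.
have d2E : d2 = - (m * cb) by rewrite /d2 w1E w2E /cb; ring.
pose d3 := u111 * e1 * e2 * e2 + u112 * (e2 * e2 * e2 - 2 * e1 * e1 * e2)
  + u122 * (e1 * e1 * e1 - 2 * e1 * e2 * e2) + u222 * e1 * e1 * e2.
pose d4 := - (u111 * e2 * e2 * e2) + 3 * u112 * e1 * e2 * e2 - 3 * u122 * e1 * e1 * e2
  + u222 * e1 * e1 * e1.
have d3E : d3 = m * sb - fp * v * sb.
  have : d1 + d3 = - (fp * v * sb).
    transitivity ((e1 ^+ 2 + e2 ^+ 2) * ((u111 + u122) * e1 + (u112 + u222) * e2)).
      by rewrite /d1 /d3 /w1 /w2; ring.
    by rewrite ee tr1 tr2 u1E u2E /sb; ring.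
  by rewrite d1E => H; rewrite -[LHS](addKr (- (m * sb))) H; ring.
have d4E : d4 = m * cb - fp * v * cb.
  have : d2 + d4 = - (fp * v * cb).
    transitivity ((e1 ^+ 2 + e2 ^+ 2) * ((u112 + u222) * e1 - (u111 + u122) * e2)).
      by rewrite /d2 /d4 /w1 /w2; ring.
    by rewrite ee tr1 tr2 u1E u2E /cb; ring.
  by rewrite d2E => H; rewrite -[LHS](addKr (- (m * cb))) H; ring.
pose uTTT := sb * cb * (2 * m * cb ^+ 2 + 2 * sb ^+ 2 * (m - fp * v)).
have uTTTE : u111 * t1 * t1 * t1 + 3 * u112 * t1 * t1 * t2 + 3 * u122 * t1 * t2 * t2
    + u222 * t2 * t2 * t2 = uTTT.
  transitivity (cb ^+ 3 * d1 - 3 * cb ^+ 2 * sb * d2 + 3 * cb * sb ^+ 2 * d3 - sb ^+ 3 * d4).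
    by rewrite t1E t2E /d1 /d2 /d3 /d4 /w1 /w2; move: cb sb {t1E t2E w1E w2E u1E u2E cs1 d1E d2E d3E d4E uTTT} => c s; ring.
  by rewrite d1E d2E d3E d4E /uTTT; ring.
pose hTN := cb * sb * (1 + 2 * M).
have Hee : u11 * e1 * e1 + 2 * u12 * e1 * e2 + u22 * e2 * e2 = M.
  transitivity (e1 * (u11 * e1 + u12 * e2) + e2 * (u12 * e1 + u22 * e2)); first by ring.
  by rewrite H1 H2 -[RHS]mulr1 -[X in _ = _ * X]ee; ring.
have Heh : u12 * (e1 * e1 - e2 * e2) + (u22 - u11) * e1 * e2 = 0.
  transitivity (e1 * (u12 * e1 + u22 * e2) - e2 * (u11 * e1 + u12 * e2)); first by ring.
  by rewrite H1 H2; ring.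
have Hhh : u11 * e2 * e2 - 2 * u12 * e1 * e2 + u22 * e1 * e1 = -1 - M.
  transitivity ((u11 + u22) * (e1 ^+ 2 + e2 ^+ 2) - (u11 * e1 * e1 + 2 * u12 * e1 * e2 + u22 * e2 * e2)).
    by ring.
  by rewrite Hee tr ee mulr1.
have hTNE : - u11 * t1 * t2 + u12 * (t1 * t1 - t2 * t2) + u22 * t1 * t2 = hTN.
  transitivity (cb * sb * (u11 * e1 * e1 + 2 * u12 * e1 * e2 + u22 * e2 * e2)
    + (cb ^+ 2 - sb ^+ 2) * (u12 * (e1 * e1 - e2 * e2) + (u22 - u11) * e1 * e2)
    - cb * sb * (u11 * e2 * e2 - 2 * u12 * e1 * e2 + u22 * e1 * e1)).
    by rewrite {1 2 3 4}t1E {1 2 3 4}t2E; ring.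
  by rewrite Hee Heh Hhh /hTN; ring.
have hTT : - (k * v) = cb ^+ 2 * M - sb ^+ 2 * (1 + M).
  rewrite -[LHS]add0r -R2 (_ : _ - _ = u11 * t1 * t1 + 2 * u12 * t1 * t2 + u22 * t2 * t2); last by ring.
  transitivity (cb ^+ 2 * (u11 * e1 * e1 + 2 * u12 * e1 * e2 + u22 * e2 * e2)
    - 2 * cb * sb * (u12 * (e1 * e1 - e2 * e2) + (u22 - u11) * e1 * e2)
    + sb ^+ 2 * (u11 * e2 * e2 - 2 * u12 * e1 * e2 + u22 * e1 * e1)).
    by rewrite {1 2 3}t1E {1 2 3}t2E; ring.
  by rewrite Hee Heh Hhh; ring.
rewrite uTTTE hTNE in R3.
have pos : 0 <= uTTT * hTN.
  rewrite (_ : _ * _ = (sb * cb) ^+ 2 * ((1 + 2 * M) * (2 * (m * cb ^+ 2) + 2 * (sb ^+ 2 * (m - fp * v))))).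
    rewrite mulr_ge0 ?sqr_ge0// mulr_ge0//; first by lra.
    by rewrite addr_ge0// mulr_ge0// mulr_ge0 ?sqr_ge0// subr_ge0; nra.
  by rewrite /uTTT /hTN; ring.
have K1 : 9 * k ^+ 2 * hTN ^+ 2 <= (k' * v) ^+ 2.
  have -> : k' * v = - (uTTT + 3 * k * hTN) by apply: subr0_eq; rewrite opprK addrC.
  rewrite sqrrN -subr_ge0 (_ : _ - _ = uTTT ^+ 2 + 6 * (k * (uTTT * hTN))); last by ring.
  by rewrite addr_ge0 ?sqr_ge0// mulr_ge0// mulr_ge0// ltW.
have kn : k != 0 by rewrite gt_eqF.
have K2 : (k' * v) ^+ 2 <= 9 * k ^+ 2 * (k * v * (1 - k * v)).
  have : 0 <= k * v * (1 - v * (k * (1 + k' ^+ 2 / (9 * k ^+ 4)))).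
    by rewrite mulr_ge0 ?subr_ge0// mulr_ge0// ltW.
  have k9 : 0 < 9 * k ^+ 2 by rewrite mulr_gt0// exprn_gt0.
  rewrite -(pmulr_rge0 _ k9) -subr_ge0 => H; rewrite -subr_ge0; apply: le_trans H _.
  by rewrite le_eqVlt; apply/orP; left; apply/eqP; field.
have : hTN ^+ 2 <= k * v * (1 - k * v).
  have k9 : 0 < 9 * k ^+ 2 by rewrite mulr_gt0// exprn_gt0.
  by rewrite -(ler_pM2l k9); exact: le_trans K1 K2.
(* The identity [det H = - M (1 + M)] read in the frame [(T, N)]; the factors [cb^2 + sb^2] make it
   a polynomial identity. *)
have -> : k * v * (1 - k * v) = hTN ^+ 2 - M * (1 + M) * (cb ^+ 2 + sb ^+ 2) ^+ 2
   + (cb ^+ 2 * M - sb ^+ 2 * (1 + M)) * (cb ^+ 2 + sb ^+ 2 - 1).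
  have -> : k * v = - (cb ^+ 2 * M - sb ^+ 2 * (1 + M)) by rewrite -hTT opprK.
  by rewrite /hTN; ring.
rewrite cs1 expr1n mulr1 subrr mulr0 addr0; apply/negP; rewrite -ltNge.
by rewrite ltrBlDr ltrDl mulr_gt0// addr_gt0.
Qed.

End algebra.

(** * Concavity from the Hessian, and compactness of the boundary *)

Section boundary.
Context (R : realType).
Implicit Types (p q : plane R) (C D : set (plane R)) (F G : plane R -> R).
Local Notation F := false.
Local Notation T := true.

(** A segment between boundary points may run inside the boundary. The inequality is therefore first
    proved between points of [D], whose segments stay in [D], and then passed to the closure by
    approximating both endpoints. *)
Lemma concave_of_hessian D U : open D -> convex_set (D : set (convex_lmodType (plane R))) ->
  extension_data D U ->
  (forall e1 e2 p, closure D p -> hessian_form U e1 e2 p <= 0) ->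
  concave_on (closure D) (U [::]).
Proof.
move=> oD /convex_setP cD EU H.
have subC := @subset_closure _ D.
have onD q q' (t : R) : D q -> D q' -> 0 <= t <= 1 ->
    (1 - t) * U [::] q + t * U [::] q' <=
    U [::] (q.1 + t * (q'.1 - q.1), q.2 + t * (q'.2 - q.2)).
  move=> Dq Dq' t01.
  pose x (t : R) := q.1 + t * (q'.1 - q.1); pose y (t : R) := q.2 + t * (q'.2 - q.2).
  have dx (s : R) : is_derive s 1 x (q'.1 - q.1).
    by apply: is_derive_eq; rewrite /GRing.scale /=; ring.
  have dy (s : R) : is_derive s 1 y (q'.2 - q.2).
    by apply: is_derive_eq; rewrite /GRing.scale /=; ring.
  have Dxy (s : R) : 0 <= s <= 1 -> D (x s, y s) by exact: cD.
  have near_xy (s : R) : 0 <= s <= 1 -> \forall r \near s, closure D (x r, y r).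
    move=> s01; have /near_planeP[d d0 dP] : \forall q \near ((x s, y s) : plane R), D q.
      by apply: open_nbhs_nbhs; split; [|exact: Dxy].
    apply: filterS2 (derive_near (dx s) d0) (derive_near (dy s) d0) => r r1 r2.
    by apply: subC; exact: dP.
  have g l (s : R) : 0 <= s <= 1 -> is_derive s 1 (fun r => U l (x r, y r))
      (U (F :: l) (x s, y s) * (q'.1 - q.1) + U (T :: l) (x s, y s) * (q'.2 - q.2)).
    move=> s01; apply: (has_grad_curve (ext_grad EU l (subC _ (Dxy s s01))) (dx s) (dy s)).
    exact: near_xy.
  have := @concave_segment _ (fun r => U [::] (x r, y r))
    (fun s => (q'.1 - q.1) * U [:: F] (x s, y s) + (q'.2 - q.2) * U [:: T] (x s, y s))
    (fun s => hessian_form U (q'.1 - q.1) (q'.2 - q.2) (x s, y s)).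
  rewrite /x /y !mul0r !addr0 !mul1r !subrKC -!surjective_pairing; apply => //.
  - by move=> s s01; apply: is_derive_eq (g [::] s s01) _; ring.
  - move=> s s01; apply: is_derive_eq (is_derive1D (is_derive1Z _ (g [:: F] s s01))
      (is_derive1Z _ (g [:: T] s s01))) _.
    rewrite /hessian_form /quadratic -(ext_sym EU [::] [::] (subC _ (Dxy s s01))) /=.
    by rewrite /x /y; ring.
  - by move=> s s01; apply: H; apply: subC; exact: Dxy.
move=> l q' q; rewrite !inE => Cq' Cq.
have t01 : 0 <= (l%:num : R) <= 1 by apply/andP; split; [exact: ge0|exact: le1].
set t := l%:num in t01 *.
rewrite [X in - U _ X](_ : _ = (q.1 + t * (q'.1 - q.1), q.2 + t * (q'.2 - q.2))); last first.
  by congr pair; rewrite /= -![_ *: _]/(_ * _) /unstable.onem -/t; ring.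
rewrite convRE /unstable.onem -/t mulrN mulrN -opprD lerN2 addrC.
move: t01 => /[dup] t01 /andP[t0 t1].
set z := (_, _).
have cU := (within_planeP _ _).1 (ext_within EU [::]).
have approx (d : R) : 0 < d -> exists a b, [/\ D a, D b,
   (`|a.1 - q.1| < d /\ `|a.2 - q.2| < d) /\ (`|b.1 - q'.1| < d /\ `|b.2 - q'.2| < d),
   D (a.1 + t * (b.1 - a.1), a.2 + t * (b.2 - a.2)) &
   `|a.1 + t * (b.1 - a.1) - z.1| < d /\ `|a.2 + t * (b.2 - a.2) - z.2| < d].
  move=> d0; have /closure_planeP/(_ d d0)[a [Da a1 a2]] := Cq.
  have /closure_planeP/(_ d d0)[b [Db b1 b2]] := Cq'.
  exists a, b; split => //; first exact: cD.
  have box (r s r' s' : R) : `|r - r'| < d -> `|s - s'| < d ->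
      `|r + t * (s - r) - (r' + t * (s' - r'))| < d.
    rewrite !ltr_norml => /andP[? ?] /andP[? ?].
    by have [th|th] := leP t (1 / 2); apply/andP; split; nra.
  by split; exact: box.
have Cz : closure D z.
  apply/closure_planeP => d d0; have [a [b [_ _ _ Dz [z1 z2]]]] := approx d d0.
  by exists (a.1 + t * (b.1 - a.1), a.2 + t * (b.2 - a.2)).
apply/ler_addgt0Pl => e e0; have e20 : 0 < e / 2 by rewrite divr_gt0.
have [d1 d10 d1P] := cU _ Cq _ e20; have [d2 d20 d2P] := cU _ Cq' _ e20.
have [d3 d30 d3P] := cU _ Cz _ e20.
have [|a [b [Da Db [[a1 a2] [b1 b2]] Dz [z1 z2]]]] := approx (Num.min d1 (Num.min d2 d3)).
  by rewrite !lt_min d10 d20.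
move: a1 a2 b1 b2 z1 z2; rewrite !lt_min => /and3P[a1 _ _] /and3P[a2 _ _].
move=> /and3P[_ b1 _] /and3P[_ b2 _] /and3P[_ _ z1] /and3P[_ _ z2].
have A := d1P a (subC _ Da) a1 a2; have B := d2P b (subC _ Db) b1 b2.
have Z := d3P _ (subC _ Dz) z1 z2; have := onD a b t Da Db t01.
move: A B Z; rewrite !ltr_norml => /andP[A1 A2] /andP[B1 B2] /andP[Z1 Z2].
nra.
Qed.

Lemma has_grad_within C G (a b : plane R -> R) :
  (forall q, C q -> has_grad C G (a q) (b q) q) -> {within C, continuous G}.
Proof.
by move=> H; apply/within_planeP => q Cq e e0; exact: has_grad_cont (H q Cq) e e0.
Qed.

(** With an empty boundary, the maximum principle would bound the subharmonic function [q.1^2] by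
    any constant, for instance -1. *)
Lemma boundary_nonempty D : open D -> bounded_set D -> D !=set0 -> boundary D !=set0.
Proof.
move=> oD bD [p Dp]; apply/set0P/negP => /eqP B0.
have : p.1 * p.1 <= -1.
  apply: (@weak_maximum_principle _ D (fun q => q.1 * q.1) (fun q => q.1 + q.1) (fun=> 0)
    (fun=> 2) (fun=> 0) (-1)) => //.
  - by apply: within_mul; exact: within_fst.
  - move=> q Dq.
    have g1 := has_gradM (@has_grad_fst R (closure D) q) (@has_grad_fst R (closure D) q).
    have g2 := has_gradD (@has_grad_fst R (closure D) q) (@has_grad_fst R (closure D) q).
    have [A B] := has_grad_partials oD Dq g1.
    have [A' _] := has_grad_partials oD Dq g2.
    have [_ B'] := has_grad_partials oD Dq (@has_grad_cst R (closure D) 0 q).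
    split; first by apply: is_derive_eq A _; ring.
    + by apply: is_derive_eq B _; ring.
    + by apply: is_derive_eq A' _; ring.
    + exact: B'.
  - by move=> q; rewrite B0 => -[].
  - exact: subset_closure.
by rewrite leNgt (lt_le_trans (ltrN10 R))// -expr2 sqr_ge0.
Qed.

Lemma compact_boundary D : bounded_set D -> compact (boundary D).
Proof.
move=> bD; apply: (subclosed_compact _ (compact_closure_plane bD)).
  rewrite /boundary setDE; apply: closedI; first exact: closed_closure.
  exact/open_closedC/open_interior.
by move=> q [].
Qed.

End boundary.

(** * Comparison with the ellipse, and the estimate at a boundary maximum *)

Section comparison.
Context (R : realType).
Implicit Types (p q : plane R) (D : set (plane R)) (E : ellipse R).
Local Notation F := false.
Local Notation T := true.

(* [c * (1 - form)], with [c = a^2 b^2 / (2 (a^2 + b^2))], is the torsion function of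
   the ellipse: it has Laplacian [-1] and dominates [u]. *)
Lemma normal_derivative_le_ellipse D U E p (n1 n2 : R) :
  open D -> bounded_set D -> extension_data D U ->
  (forall q, D q -> -1 <= U [:: F; F] q + U [:: T; T] q) ->
  (forall q, boundary D q -> U [::] q = 0) ->
  D `<=` ellipse_region E -> boundary D p -> ellipse_curve E p ->
  n1 ^+ 2 + n2 ^+ 2 = 1 ->
  (\forall t \near 0^'+, D (p.1 + t * n1, p.2 + t * n2)) ->
  U [:: F] p * n1 + U [:: T] p * n2 <=
    (semiaxis1 E * semiaxis2 E) ^+ 2 / (semiaxis1 E ^+ 2 + semiaxis2 E ^+ 2) *
    ellipse_gradnorm E p.
Proof.
move=> oD bD EU lap U0 DE bp Ep nn Dn.
set a := semiaxis1 E; set b := semiaxis2 E.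
have a0 : 0 < a := semiaxis1_gt0 E; have b0 : 0 < b := semiaxis2_gt0 E.
set th := tilt E; set e := ellipse_center E.
have [[dG dG1] [dH dH1] _ _] := ellipse_defining E p.
rewrite -/a -/b in dG dG1 dH dH1.
pose X := coord1 th e; pose Y := coord2 th e.
pose phi q := 1 - (X q / a) ^+ 2 + - (Y q / b) ^+ 2.
pose phi1 q := - (2 * X q / a ^+ 2) * cos th + - (2 * Y q / b ^+ 2) * - sin th.
pose phi2 q := - (2 * X q / a ^+ 2) * sin th + - (2 * Y q / b ^+ 2) * cos th.
have gphi q : has_grad setT phi (phi1 q) (phi2 q) q.
  exact: has_grad_separable (dG _) (dH _).
have gcomb k l q : has_grad setT (fun q => - (2 * X q / a ^+ 2) * k + - (2 * Y q / b ^+ 2) * l)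
    ((- (2 / a ^+ 2) * k) * cos th + (- (2 / b ^+ 2) * l) * - sin th)
    ((- (2 / a ^+ 2) * k) * sin th + (- (2 / b ^+ 2) * l) * cos th) q.
  apply: (@has_grad_separable _ _ _ _ (fun t => - (2 * t / a ^+ 2) * k)
    (fun t => - (2 * t / b ^+ 2) * l)).
    by apply: is_derive_eq (is_derive1M (dG1 _) (is_derive_cst k _ _)) _; rewrite mulr0 addr0.
  by apply: is_derive_eq (is_derive1M (dH1 _) (is_derive_cst l _ _)) _; rewrite mulr0 addr0.
have gphi1 q := gcomb (cos th) (- sin th) q.
have gphi2 q := gcomb (sin th) (cos th) q.
(* The Laplacian of [phi] is [- 2 (a^-2 + b^-2) = - 1 / c]. *)
pose c := (a * b) ^+ 2 / (2 * (a ^+ 2 + b ^+ 2)).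
have ab0 : 0 < a ^+ 2 + b ^+ 2 by rewrite addr_gt0// exprn_gt0.
have c0 : 0 < c by rewrite divr_gt0 ?mulr_gt0// exprn_gt0// mulr_gt0.
have cphi : {within closure D, continuous phi}.
  apply: (@has_grad_within _ _ _ phi1 phi2) => q _; exact: has_grad_sub (gphi q).
have phi_form q : phi q = 1 - ellipse_form E q by rewrite /phi -addrA -opprD.
have phi0 q : closure D q -> 0 <= phi q.
  move=> Cq; rewrite -oppr_le0.
  apply: (closure_le openT (within_opp cphi) _ Cq Logic.I) => z /DE Ez _.
  by rewrite oppr_le0 phi_form subr_ge0 ltW.
pose w q := U [::] q + - c * phi q.
have w_le q : closure D q -> w q <= 0.
  apply: (weak_maximum_principle (w1 := fun q => U [:: F] q + - c * phi1 q)
    (w2 := fun q => U [:: T] q + - c * phi2 q)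
    (w11 := fun q => U [:: F; F] q + - c * ((- (2 / a ^+ 2) * cos th) * cos th
       + (- (2 / b ^+ 2) * - sin th) * - sin th))
    (w22 := fun q => U [:: T; T] q + - c * ((- (2 / a ^+ 2) * sin th) * sin th
       + (- (2 / b ^+ 2) * cos th) * cos th)) oD bD).
  - exact: within_add (ext_within EU _) (within_mul (@within_cst _ _ _) cphi).
  - move=> z Dz; have Cz := @subset_closure _ D _ Dz.
    have ST : closure D `<=` setT by [].
    have [A B] := has_grad_partials oD Dz
      (has_gradD (ext_grad EU [::] Cz) (has_gradZ (- c) (has_grad_sub ST (gphi z)))).
    have [A' _] := has_grad_partials oD Dz
      (has_gradD (ext_grad EU [:: F] Cz) (has_gradZ (- c) (has_grad_sub ST (gphi1 z)))).
    have [_ B'] := has_grad_partials oD Dz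
      (has_gradD (ext_grad EU [:: T] Cz) (has_gradZ (- c) (has_grad_sub ST (gphi2 z)))).
    by split.
  - move=> z Dz _; have := lap z Dz; rewrite -subr_ge0 opprK => H.
    rewrite (_ : _ + _ = U [:: F; F] z + U [:: T; T] z + 1)//.
    transitivity (U [:: F; F] z + U [:: T; T] z +
      2 * c * ((a ^+ 2)^-1 + (b ^+ 2)^-1) * (cos th ^+ 2 + sin th ^+ 2)); first by ring.
    by rewrite cos2Dsin2 /c; congr (_ + _); field; rewrite !gt_eqF.
  - move=> z bz; rewrite /w U0// add0r mulNr oppr_le0 mulr_ge0 ?(ltW c0)// phi0//.
    by case: bz.
have Cp : closure D p by case: bp.
have wp : w p = 0 by rewrite /w U0// phi_form Ep subrr mulr0 addr0.
have gw := has_gradD (ext_grad EU [::] Cp)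
  (has_gradZ (- c) (has_grad_sub (fun q _ => Logic.I) (gphi p))).
have := @has_grad_nonpos _ _ _ _ _ _ (n1, n2) gw; rewrite /= => /(_ _)/wrap[].
  apply: filterS Dn => t Dt; split; first exact: subset_closure.
  by rewrite -/(w _) -/(w _) wp; apply: w_le; exact: subset_closure.
set r := ellipse_gradnorm E p.
have r2 : r ^+ 2 = (X p / a ^+ 2) ^+ 2 + (Y p / b ^+ 2) ^+ 2.
  by rewrite sqr_sqrtr// addr_ge0// sqr_ge0.
have r0 : 0 <= r by rewrite sqrtr_ge0.
(* Cauchy-Schwarz for the gradient of [phi], of norm [2 r], and the unit vector [(n1, n2)]; below,
   the difference of the squares is a square by Lagrange's identity. *)
suff : phi1 p * n1 + phi2 p * n2 <= 2 * r.
  move=> H1 H2; rewrite (_ : _ / _ * r = c * (2 * r)); last by rewrite /c; field; rewrite gt_eqF.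
  apply: (@le_trans _ _ (c * (phi1 p * n1 + phi2 p * n2))); last by rewrite ler_pM2l.
  by rewrite -subr_le0; apply: le_trans H2; rewrite le_eqVlt; apply/orP; left; apply/eqP; ring.
apply: le_trans (ler_norm _) _.
rewrite -(ler_pXn2r (_ : 0 < 2)%N) ?nnegrE ?mulr_ge0// real_normK ?num_real//.
rewrite exprMn r2 -[leRHS]mulr1 -[X in _ <= _ * X]nn -[leRHS]mulr1.
rewrite -[X in _ <= _ * X](cos2Dsin2 th) -subr_ge0.
rewrite (_ : _ - _ = 4 * (X p / a ^+ 2 * (- sin th * n1 + cos th * n2)
  - Y p / b ^+ 2 * (cos th * n1 + sin th * n2)) ^+ 2
  + 4 * ((X p / a ^+ 2) ^+ 2 + (Y p / b ^+ 2) ^+ 2) * (n1 ^+ 2 + n2 ^+ 2) *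
    (cos th ^+ 2 + sin th ^+ 2 - (cos th ^+ 2 + sin th ^+ 2)) ); last first.
  by rewrite /phi1 /phi2; ring.
by rewrite subrr mulr0 addr0 mulr_ge0 ?sqr_ge0.
Qed.


Lemma top_eigenvalue_nonpos D U (f f1 f2 : R -> R) p (x y : R -> R) :
  let M := top_eigenvalue (U [:: F; F] p) (U [:: T; F] p) (U [:: T; T] p) in
  let k := arc_curvature x y 0 in let k' := derive1 (arc_curvature x y) 0 in
  open D -> bounded_set D -> extension_data D U ->
  (forall t : R, is_derive t 1 f (f1 t)) -> (forall t : R, is_derive t 1 f1 (f2 t)) ->
  (forall q, D q -> U [:: F; F] q + U [:: T; T] q = - f (U [::] q)) ->
  (forall q, D q -> f1 (U [::] q) <= 0 /\ f2 (U [::] q) <= 0) -> f1 0 <= 0 -> f 0 = 1 ->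
  (forall q, boundary D q -> U [::] q = 0) -> (forall q, closure D q -> 0 <= U [::] q) ->
  boundary_arc D p x y -> 0 < k ->
  (U [:: T] p * derive1 x 0 - U [:: F] p * derive1 y 0) *
    (k * (1 + k' ^+ 2 / (9 * k ^+ 4))) <= 1 ->
  (forall q e1 e2, boundary D q -> hessian_form U e1 e2 q <= M * (e1 * e1 + e2 * e2)) ->
  M <= 0.
Proof.
move=> M k k' oD bD EU df df1 eqD f12 f10 f0 U0 Upos arc k0 cond Hmax.
rewrite leNgt; apply/negP => M0.
have [e1 [e2 [ee H1 H2]]] := top_eigenvector (U [:: F; F] p) (U [:: T; F] p) (U [:: T; T] p).
rewrite -/M in H1 H2.
have unit := arc_unit_speed arc.
have Hfr := arc_frenet arc.
have [p0 Harc] := arc.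
have bp : boundary D p by have [_ _ + _] := nbhs_singleton Harc; rewrite p0.
have Cp : closure D p by case: bp.
have arcD : \forall s \near (0 : R), boundary D (x s, y s).
  by apply: filterS Harc => s [].
have arcN : \forall t \near 0^'+, D (p.1 + t * - derive1 y 0, p.2 + t * derive1 x 0).
  have [_ _ _] := nbhs_singleton Harc; rewrite -p0; apply: filterS => t.
  by rewrite mulrN.
move: k0 cond; rewrite /k /k'.
move: (arc_curvature x y) (derive1 x) (derive1 y) Hfr unit arcN {arc Harc k k'}.
move=> k x1 y1 Hfr unit arcN k0 cond.
have arcC : \forall s \near (0 : R), closure D (x s, y s).
  by apply: filterS arcD => s [].
(* The maximum principle for [u_ee] requires a nonnegative bound, and this is where [M > 0] is
   assumed for contradiction. *)
have wM q : closure D q -> hessian_form U e1 e2 q <= M.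
  apply: (hessian_form_max oD EU df df1 eqD bD (ltW M0) f12) => z bz.
  by apply: le_trans (Hmax z e1 e2 bz) _; rewrite -!expr2 ee mulr1.
have wp : hessian_form U e1 e2 p = M.
  rewrite /hessian_form /quadratic.
  transitivity (e1 * (U [:: F; F] p * e1 + U [:: T; F] p * e2) +
    e2 * (U [:: T; F] p * e1 + U [:: T; T] p * e2)); first by ring.
  by rewrite H1 H2 -[RHS]mulr1 -[X in _ = _ * X]ee; ring.
have [dx dy _ _ _] := nbhs_singleton Hfr.
have sym q : closure D q -> U [:: F; T] q = U [:: T; F] q.
  by move=> Cq; rewrite -(ext_sym EU [::] [::] Cq).
have symF q : closure D q -> U [:: F; T; F] q = U [:: T; F; F] q.
  by move=> Cq; rewrite -(ext_sym EU [::] [:: F] Cq).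
have symT q : closure D q -> U [:: F; T; T] q = U [:: T; T; F] q.
  move=> Cq; rewrite -(ext_sym EU [::] [:: T] Cq) /=.
  by rewrite -(ext_sym EU [:: T] [::] Cq).
have gw : has_grad (closure D) (hessian_form U e1 e2)
    (quadratic e1 e2 (U [:: F; F; F]) (U [:: T; F; F]) (U [:: T; T; F]) p)
    (quadratic e1 e2 (U [:: T; F; F]) (U [:: T; T; F]) (U [:: T; T; T]) p) p.
  rewrite {1}/quadratic -symF// -symT//.
  exact: has_grad_quadratic (ext_grad EU [:: F; F] Cp) (ext_grad EU [:: T; F] Cp)
    (ext_grad EU [:: T; T] Cp).
have tang : quadratic e1 e2 (U [:: F; F; F]) (U [:: T; F; F]) (U [:: T; T; F]) p * x1 0 +
    quadratic e1 e2 (U [:: T; F; F]) (U [:: T; T; F]) (U [:: T; T; T]) p * y1 0 = 0.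
  have dw : is_derive (0 : R) 1 (fun s => hessian_form U e1 e2 (x s, y s))
    (quadratic e1 e2 (U [:: F; F; F]) (U [:: T; F; F]) (U [:: T; T; F]) p * x1 0 +
    quadratic e1 e2 (U [:: T; F; F]) (U [:: T; T; F]) (U [:: T; T; T]) p * y1 0).
    apply: (has_grad_curve _ dx dy arcC); rewrite p0.
    exact: gw.
  apply: (derive_at_max dw); apply: filterS arcC => s /wM; by rewrite p0 wp.
have norm : quadratic e1 e2 (U [:: F; F; F]) (U [:: T; F; F]) (U [:: T; T; F]) p * - y1 0 +
    quadratic e1 e2 (U [:: T; F; F]) (U [:: T; T; F]) (U [:: T; T; T]) p * x1 0 <= 0.
  have := @has_grad_nonpos _ _ _ _ _ _ (- y1 0, x1 0) gw.
  apply.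
  apply: filterS arcN => t Dt; split; first exact: subset_closure.
  by rewrite [leRHS]wp; apply: wM; exact: subset_closure.
have vpos : 0 <= U [:: T] p * x1 0 - U [:: F] p * y1 0.
  have := @has_grad_nonpos _ _ _ _ _ _ (- y1 0, x1 0) (has_gradZ (-1) (ext_grad EU [::] Cp)).
  rewrite /= => /(_ _)/wrap[].
    apply: filterS arcN => t Dt; split; first exact: subset_closure.
    by rewrite !mulN1r lerN2 U0//; apply: Upos; exact: subset_closure.
  by lra.
have [A B] := pde_grad oD EU df df1 eqD Cp.
rewrite symT// !U0// in A B.
have tr := pde_closure EU df eqD Cp; rewrite U0// f0 in tr.
have := @curve_third_order _ (closure D) (U [::]) (U [:: F]) (U [:: T])
  (U [:: F; F]) (U [:: T; F]) (U [:: T; T])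
  (U [:: F; F; F]) (U [:: T; F; F]) (U [:: T; T; F]) (U [:: T; T; T]) x y x1 y1 k (derive1 k).
case.
- by move=> q; exact: ext_grad.
- by move=> q; exact: ext_grad.
- by move=> q Cq; rewrite -sym//; exact: ext_grad.
- by move=> q; exact: ext_grad.
- by move=> q Cq; rewrite -symF//; exact: ext_grad.
- by move=> q Cq; rewrite -symT//; exact: ext_grad.
- exact: Hfr.
- by apply: filterS2 arcC arcD => s Cs bs; split; [|exact: U0].
rewrite p0 => E1 E2 E3.
have := boundary_eigenvalue_nonpos unit ee H1 H2 tr A B f10 vpos k0 cond E1 E2 E3.
move=> /(_ _ _)/wrap[].
- by rewrite -[RHS]tang /quadratic; ring.
- by apply: le_trans norm; rewrite le_eqVlt; apply/orP; left; apply/eqP; rewrite /quadratic; ring.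
by rewrite leNgt M0.
Qed.

End comparison.

(** * From the pointwise hypotheses to concavity *)

(** Without any arc, [curvature] takes its default value 0, so a positive curvature yields an
    arc. *)
Lemma boundary_arc_exists (R : realType) (D : set (plane R)) p :
  0 < curvature D p -> exists x y, boundary_arc D p x y.
Proof.
move=> k0; apply: contrapT => no; move: k0; rewrite /curvature xgetPN ?ltxx// => k [x [y [arc _]]].
by apply: no; exists x, y.
Qed.

(** A tangent line is a set defined through arcs, empty if there are none; that of [D] contains [p],
    so equality provides an arc of [D']. *)
Lemma tangent_line_arc (R : realType) (D D' : set (plane R)) p x y :
  boundary_arc D p x y -> tangent_line D' p = tangent_line D p ->
  exists x y, boundary_arc D' p x y.
Proof.
move=> arc E; have : tangent_line D p (p.1 + 0 * derive1 x 0, p.2 + 0 * derive1 y 0).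
  by exists x, y, 0.
by rewrite -E => -[x' [y' [_ [arc' _]]]]; exists x', y'.
Qed.

Lemma le_at_zero_of_derive_nonpos (R : realType) (f f1 : R -> R) (s : R) :
  (forall t : R, is_derive t 1 f (f1 t)) -> 0 <= s ->
  (forall t, 0 <= t <= s -> f1 t <= 0) -> f s <= f 0.
Proof.
move=> df s0 f10.
have cf : {within `[0, s], continuous f}.
  by apply: derivable_within_continuous => t _; case: (df t).
have [c] := MVT_segment s0 (fun t _ => df t) cf.
rewrite in_itv /= => cs E; rewrite -subr_le0 E subr0.
by rewrite mulr_le0_ge0 ?f10.
Qed.

Lemma within_top_eigenvalue (R : realType) (S : set (plane R)) (A B C : plane R -> R) :
  {within S, continuous A} -> {within S, continuous B} -> {within S, continuous C} ->
  {within S, continuous (fun q => top_eigenvalue (A q) (B q) (C q))}.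
Proof.
move=> cA cB cC.
have c2 : {within S, continuous (fun _ : plane R => 2^-1 : R)} by exact: within_cst.
have cAC := within_mul (within_add cA (within_opp cC)) c2.
have cs := within_add (within_mul cAC cAC) (within_mul cB cB).
exact: within_add (within_mul (within_add cA cC) c2) (within_comp (@sqrt_continuous R) cs).
Qed.

Theorem theorem1p1 (R : realType) (Omega : set (plane R)) (f : R -> R)
    (u : plane R -> R)
    (HOmega : bounded_convex_domain Omega)
    (Hbd : smooth_boundary Omega)
    (Hf : smooth f)
    (Hfpos : forall t : R, 0 < f t)
    (Hu : smooth_on_closure Omega u)
    (Heq : forall p, Omega p -> - laplacian u p = f (u p))
    (Hzero : forall p, boundary Omega p -> u p = 0)
    (H1 : forall p, boundary Omega p ->
      0 < curvature Omega p /\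
      exists (E : ellipse R) (A : R),
        [/\ area (ellipse_region E) = A%:E,
            Omega `<=` ellipse_region E,
            ellipse_curve E p,
            tangent_line (ellipse_region E) p = tangent_line Omega p &
            let K := curvature Omega p in
            let dK := dcurvature Omega p in
            let KE := curvature (ellipse_region E) p in
            let dKE := dcurvature (ellipse_region E) p in
            KE * (pi `^ (2 / 3) / (A `^ (2 / 3) * KE `^ (4 / 3)) + 1 +
                  dKE ^+ 2 / (9 * KE ^+ 4)) >=
            K * (1 + dK ^+ 2 / (9 * K ^+ 4))])
    (H2 : f 0 = 1 /\
      forall t : R, 0 <= t <= sup (u @` closure Omega) ->
        [/\ 0 < f t, derive1n 2 f t <= 0 & derive1 f t <= 0]) :
  concave_on (closure Omega) u.
Proof.
have [oD nD bD cvD] := HOmega.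
have subC := @subset_closure _ Omega.
have [U [Uu cU DU gU symU]] := smooth_on_closure_extension oD cvD Hu.
have EU := ExtensionData cU gU symU.
move: Heq Hzero H2; rewrite -Uu => Heq U0 [f0 H2].
have df (t : R) : is_derive t 1 f (derive1 f t) := derivable_is_derive1 (Hf 0%N t).
have df1 (t : R) : is_derive t 1 (derive1 f) (derive1n 2 f t) := derivable_is_derive1 (Hf 1%N t).
move: (derive1 f) (derive1n 2 f) df df1 H2 => f1 f2 df df1 H2.
have eqD p : Omega p -> U [:: false; false] p + U [:: true; true] p = - f (U [::] p).
  move=> Dp; rewrite -(Heq p Dp) opprK (DU [:: false; false] p Dp) (DU [:: true; true] p Dp).
  by rewrite -Uu.
have Upos p : closure Omega p -> 0 <= U [::] p.
  move=> Cp; rewrite -oppr_le0.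
  apply: (weak_maximum_principle (w1 := fun q => -1 * U [:: false] q)
    (w2 := fun q => -1 * U [:: true] q) (w11 := fun q => -1 * U [:: false; false] q)
    (w22 := fun q => -1 * U [:: true; true] q) oD bD (within_opp (cU [::])) _ _ _ Cp).
  - move=> z Dz; have Cz := subC _ Dz.
    have g l := has_grad_partials oD Dz (has_gradZ (-1) (gU l z Cz)).
    have [A B] := g [::]; have [A1 _] := g [:: false]; have [_ B1] := g [:: true].
    split; [|  |exact: A1|exact: B1].
      by rewrite (_ : (fun q => - U [::] q) = (fun q => -1 * U [::] q))//; apply/funext => q; rewrite mulN1r.
    by rewrite (_ : (fun q => - U [::] q) = (fun q => -1 * U [::] q))//; apply/funext => q; rewrite mulN1r.
  - by move=> z Dz _; rewrite -mulrDr eqD// mulrNN mul1r ltW.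
  - by move=> z bz; rewrite U0// oppr0.
(* The supremum is an upper bound because [u] has a maximum on the compact closure. *)
have Usup p : closure Omega p -> 0 <= U [::] p <= sup (U [::] @` closure Omega).
  move=> Cp; rewrite Upos//=; apply: ub_le_sup; last by exists p.
  have [z Cz zmax] := compact_EVT_max (ex_intro _ p Cp) (compact_closure_plane bD) (cU [::]).
  by exists (U [::] z) => _ [q Cq <-]; apply: zmax; rewrite inE.
have f12 p : Omega p -> f1 (U [::] p) <= 0 /\ f2 (U [::] p) <= 0.
  by move=> Dp; have [_ A B] := H2 _ (Usup p (subC _ Dp)).
have lap p : Omega p -> -1 <= U [:: false; false] p + U [:: true; true] p.
  (* On [[0, u p]], which lies in the range covered by the assumption, [f] is nonincreasing, so
     [f (u p) <= f 0 = 1]. *)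
  move=> Dp; rewrite eqD// lerN2 -f0.
  have /andP[s0 ssup] := Usup p (subC _ Dp).
  apply: (le_at_zero_of_derive_nonpos df s0) => t /andP[t0 ts].
  by have [] := H2 t; rewrite ?t0 ?(le_trans ts ssup).
have [b0 Db0] := boundary_nonempty oD bD nD.
have bC q : boundary Omega q -> closure Omega q by case.
(* A boundary point, where [u] vanishes, puts 0 in the range covered by the assumption. *)
have f10 : f1 0 <= 0 by have := Usup b0 (bC _ Db0); rewrite (U0 b0 Db0) => /H2[].
have cM : {within boundary Omega, continuous (fun q =>
    top_eigenvalue (U [:: false; false] q) (U [:: true; false] q) (U [:: true; true] q))}.
  by apply: within_top_eigenvalue; apply: continuous_subspaceW (cU _).
have [p] := compact_EVT_max (ex_intro _ b0 Db0) (compact_boundary bD) cM.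
rewrite inE => bp pmax; set M := top_eigenvalue _ _ _ in pmax.
have secM q e1 e2 : boundary Omega q -> hessian_form U e1 e2 q <= M * (e1 * e1 + e2 * e2).
  move=> bq.
  apply: (@le_trans _ _ (top_eigenvalue (U [:: false; false] q) (U [:: true; false] q)
    (U [:: true; true] q) * (e1 * e1 + e2 * e2))).
    apply: le_trans (top_eigenvalue_bound _ _ _ e1 e2).
    by rewrite le_eqVlt; apply/orP; left; apply/eqP; rewrite /hessian_form /quadratic; ring.
  rewrite ler_wpM2r//; first by rewrite addr_ge0// -expr2 sqr_ge0.
  by apply: pmax; rewrite inE.
have M0 : M <= 0.
  have [K0 [E [A [areaE DE Ep tanE]]]] := H1 p bp.
  have [x [y [arc KE dKE]]] := dcurvature_arc (smooth_boundary_defining Hbd bp) (boundary_arc_exists K0).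
  rewrite /= (ellipse_condition_lhs (tangent_line_arc arc tanE) areaE) KE dKE.
  rewrite KE in K0 => cond.
  apply: (top_eigenvalue_nonpos oD bD EU df df1 eqD f12 f10 f0 U0 Upos arc K0 _ secM).
  have [p0 Harc] := arc; have [_ u1 _ Dn] := nbhs_singleton Harc.
  have := @normal_derivative_le_ellipse _ _ U E p (- derive1 y 0) (derive1 x 0)
    oD bD EU lap U0 DE bp Ep.
  rewrite sqrrN addrC => /(_ u1) /(_ _)/wrap[].
    by apply: filterS Dn => t; rewrite -p0 mulrN.
  have [r0 _ _] := ellipse_curvature (tangent_line_arc arc tanE).
  have a0 := semiaxis1_gt0 E; have b0' := semiaxis2_gt0 E.
  move: cond r0 K0; move: (arc_curvature x y 0) (derive1 (arc_curvature x y) 0) (derive1 x 0) (derive1 y 0).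
  move: (ellipse_gradnorm E p) (semiaxis1 E) (semiaxis2 E) a0 b0' => r a b a0 b0' k k' x1 y1 cond r0 k0 vle.
  have ab0 : 0 < a ^+ 2 + b ^+ 2 by rewrite addr_gt0// exprn_gt0.
  have V0 : 0 < (a * b) ^+ 2 / (a ^+ 2 + b ^+ 2) * r.
    by rewrite mulr_gt0// divr_gt0// exprn_gt0// mulr_gt0.
  have q0 : 0 <= k * (1 + k' ^+ 2 / (9 * k ^+ 4)).
    by rewrite mulr_ge0 ?ltW// ltr_wpDr// divr_ge0 ?sqr_ge0// mulr_ge0// exprn_ge0// ltW.
  (* Let [V] be the positive quantity of [V0]: the normal derivative of [u] is at most [V] by
     comparison, and [k * (1 + ...)] is at most [V^-1] by the curvature condition. *)
  apply: (@le_trans _ _ ((a * b) ^+ 2 / (a ^+ 2 + b ^+ 2) * r * (k * (1 + k' ^+ 2 / (9 * k ^+ 4))))).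
    by rewrite ler_wpM2r//; apply: le_trans vle; rewrite le_eqVlt; apply/orP; left; apply/eqP; ring.
  apply: le_trans (ler_wpM2l (ltW V0) cond) _.
  by rewrite le_eqVlt; apply/orP; left; apply/eqP; field; rewrite !gt_eqF.
apply: (concave_of_hessian oD cvD EU) => e1 e2 q Cq.
apply: (hessian_form_max oD EU df df1 eqD bD (lexx 0) f12 _ Cq) => z bz.
apply: le_trans (secM z e1 e2 bz) _.
by rewrite mulr_le0_ge0// addr_ge0// -expr2 sqr_ge0.
Qed.
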